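(* Let $H$ be a stringent hyperfield, let $M$ be a left $H$-matroid on $E$ and let $e\in E$. Then $\mathcal{V}(M/ e) = \mathcal{V}(M)^e$ and $\mathcal{V}(M\setminus e) = \mathcal{V}(M)_e$.
   Context: A hyperfield $H$ with hyperaddition $\boxplus$ is stringent if $a\boxplus b$ is a singleton whenever $a\neq-b$. $\mathcal V(M)$ is the set of vectors of $M$: the $V\in H^E$ with $0\in V_{e_1}Y_{e_1}\boxplus\cdots\boxplus V_{e_n}Y_{e_n}$ for all cocircuits $Y$ ($E=\{e_1,\dots,e_n\}$). For $\mathcal Q\subseteq H^E$, $\mathcal Q^e=\{Q\setminus e:Q\in\mathcal Q\}$ and $\mathcal Q_e=\{Q\setminus e: Q\in\mathcal Q,Q_e=0\}$, with $Q\setminus e$ the restriction to $E\setminus e$. $M\setminus e$ has circuits $\mathcal C(M)_e$; $M/e$ has circuits the support-minimal nonzero elements of $\mathcal C(M)^e$. *)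

(* Defs.v *)
(* MathComp, with the classical sets of MathComp-Analysis. *)
From HB Require Import structures.
From mathcomp Require Import all_boot.
From mathcomp Require Import boolp classical_sets.

Set Implicit Arguments.
Unset Strict Implicit.
Unset Printing Implicit Defensive.

Local Open Scope classical_set_scope.

(* Multiplication is not assumed commutative.  The choiceType structure is no
   restriction on the carrier, since classical choice is available. *)
HB.mixin Record isSkewHyperfield H of Choice H := {
  hzero : H;
  hone : H;
  hopp : H -> H;
  hmul : H -> H -> H;
  hadd : H -> H -> set H;
  hadd_neq0 : forall x y, hadd x y !=set0;
  haddC : forall x y, hadd x y = hadd y x;
  haddA : forall x y z,
    \bigcup_(u in hadd y z) hadd x u = \bigcup_(u in hadd x y) hadd u z;
  hadd0 : forall x, hadd x hzero = [set x];
  hadd_opp : forall x y, hadd x y hzero <-> y = hopp x;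
  hadd_rev : forall x y z, hadd y z x -> hadd x (hopp y) z;
  hmulA : forall x y z, hmul x (hmul y z) = hmul (hmul x y) z;
  hmul1l : forall x, hmul hone x = x;
  hmul1r : forall x, hmul x hone = x;
  hmul0l : forall x, hmul hzero x = hzero;
  hmul0r : forall x, hmul x hzero = hzero;
  hmulDr : forall a x y, hmul a @` hadd x y = hadd (hmul a x) (hmul a y);
  hmulDl : forall a x y,
    (fun z => hmul z a) @` hadd x y = hadd (hmul x a) (hmul y a);
  hone_neq0 : hone <> hzero;
  hinv_ex : forall x, x <> hzero -> exists y, hmul x y = hone /\ hmul y x = hone
}.

#[short(type="skewHyperfieldType")]
HB.structure Definition SkewHyperfield := {H of isSkewHyperfield H & Choice H}.

Definition stringent (H : skewHyperfieldType) : Prop :=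
  forall a b : H, a <> hopp b -> exists c, hadd a b = [set c].

Definition hsetadd (H : skewHyperfieldType) (A B : set H) : set H :=
  \bigcup_(a in A) \bigcup_(b in B) hadd a b.

Lemma hsetaddC (H : skewHyperfieldType) : commutative (@hsetadd H).
Proof.
move=> A B; apply/seteqP; split=> x [a Aa [b Bb abx]];
  by exists b => //; exists a => //; rewrite haddC.
Qed.

Lemma hsetaddA (H : skewHyperfieldType) : associative (@hsetadd H).
Proof.
move=> A B C; apply/seteqP; split=> x.
  move=> [a Aa [u [b Bb [c Cc bcu]] aux]].
  have : (\bigcup_(u in hadd b c) hadd a u) x by exists u.
  by rewrite haddA => -[v abv vcx]; exists v;
    [exists a => //; exists b | exists c].
move=> [v [a Aa [b Bb abv]] [c Cc vcx]].
have : (\bigcup_(u in hadd a b) hadd u c) x by exists v.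
by rewrite -haddA => -[u bcu aux]; exists a => //; exists u => //;
  exists b => //; exists c.
Qed.

Lemma hsetadd0l (H : skewHyperfieldType) :
  left_id [set (@hzero H)] (@hsetadd H).
Proof.
move=> A; apply/seteqP; split=> x.
  by move=> [_ -> [b Ab]]; rewrite haddC hadd0 => ->.
by move=> Ax; exists hzero => //; exists x => //; rewrite haddC hadd0.
Qed.

(* Hypersums over a finite index type do not depend on an order or bracketing. *)
#[warnings="-redundant-canonical-projection"]
HB.instance Definition _ (H : skewHyperfieldType) :=
  Monoid.isComLaw.Build (set H) [set (@hzero H)] (@hsetadd H)
    (@hsetaddA H) (@hsetaddC H) (@hsetadd0l H).

Section Vectors.
Variables (H : skewHyperfieldType) (E : finType).
Implicit Types (X Y Z : {ffun E -> H}) (C D : set {ffun E -> H}).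

Definition hvec0 : {ffun E -> H} := [ffun _ => hzero].

Definition lscale (a : H) X : {ffun E -> H} := [ffun i => hmul a (X i)].

Definition rscale (a : H) X : {ffun E -> H} := [ffun i => hmul (X i) a].

Definition hsupp X : {set E} := [set i | X i != hzero]%SET.

Definition hsupps C : set {set E} := hsupp @` C.

Definition orthogonal X Y : Prop :=
  (\big[@hsetadd H/[set hzero]]_(i : E) [set hmul (X i) (Y i)]) hzero.

Definition korthogonal (k : nat) C D : Prop :=
  forall X Y, C X -> D Y -> #|hsupp X :&: hsupp Y| <= k -> orthogonal X Y.

End Vectors.

Section UnderlyingMatroid.
Variables (E : finType) (Cs : set {set E}).
Implicit Types (I B K : {set E}).

(* [Cs] is a family of circuits of an ordinary matroid. *)
Definition indep I : Prop := forall S, Cs S -> ~ S \subset I.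

Definition basis B : Prop :=
  indep B /\ forall I, indep I -> B \subset I -> I = B.

(* The bases of the dual matroid are the complements of the bases. *)
Definition codep K : Prop := forall B, basis B -> ~ K \subset ~: B.

Definition cocircuit_supports : set {set E} :=
  [set K | codep K /\ forall K', codep K' -> K' \subset K -> K' = K].

(* Distinctness is essential: no circuit elimination is possible between
   scalings of one circuit. *)
Definition modular_pair (S T : {set E}) : Prop :=
  [/\ Cs S, Cs T, S <> T &
      ~ exists S' T', [/\ Cs S', Cs T', S' <> T' &
                          S' :|: T' \proper S :|: T]].

End UnderlyingMatroid.

Section HMatroids.
Variables (H : skewHyperfieldType) (E : finType).
Implicit Types (C D : set {ffun E -> H}).

(* Circuit axioms of an H-matroid for a given scaling action.  These are the
   weak ones: elimination is only required for modular pairs. *)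
Definition circuit_axioms (scale : H -> {ffun E -> H} -> {ffun E -> H}) C :=
  [/\ ~ C (hvec0 H E),
      forall X a, C X -> a <> hzero -> C (scale a X),
      forall X Y, C X -> C Y -> hsupp X \subset hsupp Y ->
        exists2 a, a <> hzero & Y = scale a X &
      forall X Y e, C X -> C Y -> modular_pair (hsupps C) (hsupp X) (hsupp Y) ->
        X e = hopp (Y e) -> X e <> hzero ->
        exists Z, [/\ C Z, Z e = hzero & forall i, hadd (X i) (Y i) (Z i)]].

Definition left_matroid C : Prop := circuit_axioms (@lscale H E) C.

Definition right_matroid D : Prop := circuit_axioms (@rscale H E) D.

(* [D] is the set of circuits of the dual right H-matroid of the left
   H-matroid with circuits [C]; [D] exists and is determined by [C]. *)
Definition dual_matroid C D : Prop :=
  [/\ right_matroid D, hsupps D = cocircuit_supports (hsupps C) &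
      korthogonal 3 C D].

Definition cocircuits C : set {ffun E -> H} :=
  [set Y | exists2 D, dual_matroid C D & D Y].

Definition vectors C : set {ffun E -> H} :=
  [set V | forall Y, cocircuits C Y -> orthogonal V Y].

End HMatroids.

Section Minors.
Variables (H : skewHyperfieldType) (E : finType) (e : E).
Implicit Types (Q C : set {ffun E -> H}).

Definition restr (X : {ffun E -> H}) : {ffun {i : E | i != e} -> H} :=
  [ffun i => X (val i)].

(* $Q^e$ *)
Definition restr_all Q : set {ffun {i : E | i != e} -> H} := restr @` Q.

(* $Q_e$ *)
Definition restr_zero Q : set {ffun {i : E | i != e} -> H} :=
  restr @` (Q `&` [set X | X e = hzero]).

Definition deletion C : set {ffun {i : E | i != e} -> H} := restr_zero C.

Definition contraction C : set {ffun {i : E | i != e} -> H} :=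
  [set X | [/\ restr_all C X, X <> hvec0 H _ &
     forall Y, restr_all C Y -> Y <> hvec0 H _ ->
       hsupp Y \subset hsupp X -> hsupp Y = hsupp X]].

End Minors.

Arguments restr {H E} e X.
Arguments restr_all {H E} e Q.
Arguments restr_zero {H E} e Q.
Arguments deletion {H E} e C.
Arguments contraction {H E} e C.

(* Main.v *)
Require Import Defs.
From mathcomp Require Import all_boot zify.
From mathcomp Require Import boolp classical_sets.
From mathcomp.boot Require Import fintype finset.

(* In a stringent hyperfield a finite sum of elements is either a single element or a set
   of the form a - a, and membership of x in y - y behaves like |x| < |y| for a valuation
   if 1 is not in 1 - 1, and like |x| <= |y| for a total order up to sign otherwise.

   A circuit X and a cocircuit Y are orthogonal also when their supports share more than
   three elements: Y is one of the cocircuits of a line of the dual matroid, the other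
   cocircuits of that line meet X in fewer elements, and an extremal choice among the
   latter yields the orthogonality of X and Y.

   Let W be orthogonal to all cocircuits.  If 1 is not in 1 - 1, a basis of the support of
   W that is extremal for the valuation makes W a sum of fundamental circuits in which
   every coordinate is a single-valued sum.  Otherwise a 3-painting lemma produces, for
   every e in the support of W, a circuit that agrees with W at e and conforms to W.  In
   both cases, if X.y and X.y' intersect for every circuit X, then so do W.y and W.y'.

   For the deletion, take for y the restriction of a cocircuit and y' = 0.  For the
   contraction, the admissible values at e are the common elements of the sets W.(Y \ e)
   over the cocircuits Y with Y_e = -1.  If all of these contain 0, take 0; otherwise one
   of them is a singleton, and it meets, hence is contained in, all the others. *)

Set Implicit Arguments.
Unset Strict Implicit.
Unset Printing Implicit Defensive.

(** * Stringent hyperfields *)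

(** That a vector of [M] restricts to a vector of the minor is immediate once the cocircuits of the
    minor are known; the difficulty is to extend a vector of the minor to [e]. Being a vector is a
    condition on cocircuits, whereas [M] supplies information about circuits, such as the value X_e.
    The transfer from circuits to vectors is stated with intersecting sets W.y and W.y' because a
    term of a hypersum cannot be moved across an equation of sets. Cocircuits are the members of
    some dual right matroid, so a dual has to be constructed and shown to be unique, for [M] and for
    both minors. For [M] its entries are read off from circuits that meet a cocircuit support in two
    elements. From there on the proof works with dual pairs, a notion in which no elimination is
    demanded: 3-orthogonality yields elimination for the cocircuits, so minors of dual pairs are
    dual pairs without an elimination argument. *)

Section Hyperfield.
Variable H : skewHyperfieldType.
Implicit Types (x y z a b c w : H) (A B : set H).

Lemma hadd0l x : hadd hzero x = [set x]%classic.
Proof. by rewrite haddC hadd0. Qed.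

Lemma hadd_oppP x y : hadd x y hzero -> y = hopp x.
Proof. by move/hadd_opp. Qed.

Lemma hoppK x : hopp (hopp x) = x.
Proof. by apply/esym/hadd_oppP; rewrite haddC; apply/hadd_opp. Qed.

Lemma hopp0 : hopp (hzero : H) = hzero.
Proof. by apply/esym/hadd_oppP; rewrite hadd0. Qed.

Lemma hopp_inj : injective (@hopp H).
Proof. exact: can_inj hoppK. Qed.

Lemma hmulN1 x : hmul (hopp hone) x = hopp x.
Proof.
apply: hadd_oppP; rewrite -{1}[x]hmul1l -hmulDl.
by exists hzero; rewrite ?hmul0l //; apply/hadd_opp.
Qed.

Lemma hmulrN1 x : hmul x (hopp hone) = hopp x.
Proof.
apply: hadd_oppP; rewrite -{1}[x]hmul1r -hmulDr.
by exists hzero; rewrite ?hmul0r //; apply/hadd_opp.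
Qed.

Lemma hmulNl x y : hmul (hopp x) y = hopp (hmul x y).
Proof. by rewrite -hmulN1 -hmulA hmulN1. Qed.

Lemma hmulrN x y : hmul x (hopp y) = hopp (hmul x y).
Proof. by rewrite -hmulrN1 hmulA hmulrN1. Qed.

Lemma hadd_mull a x y z : hadd x y z -> hadd (hmul a x) (hmul a y) (hmul a z).
Proof. by move=> h; rewrite -hmulDr; exists z. Qed.

Lemma hadd_mulr a x y z : hadd x y z -> hadd (hmul x a) (hmul y a) (hmul z a).
Proof. by move=> h; rewrite -hmulDl; exists z. Qed.

Lemma haddN x y z : hadd x y z -> hadd (hopp x) (hopp y) (hopp z).
Proof. by move/(hadd_mull (hopp hone)); rewrite !hmulN1. Qed.

Lemma hadd_revl x y z : hadd y z x -> hadd x (hopp z) y.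
Proof. by rewrite haddC => /hadd_rev. Qed.

Definition hinv x : H := xget hzero [set y | hmul x y = hone /\ hmul y x = hone]%classic.

Lemma hmulVr x : x <> hzero -> hmul x (hinv x) = hone.
Proof. by move=> /hinv_ex[y yx]; rewrite /hinv; case: xgetP => [z _ []|/(_ y)]. Qed.

Lemma hmulVl x : x <> hzero -> hmul (hinv x) x = hone.
Proof. by move=> /hinv_ex[y yx]; rewrite /hinv; case: xgetP => [z _ []|/(_ y)]. Qed.

Lemma hinv_neq0 x : x <> hzero -> hinv x <> hzero.
Proof. by move=> /hmulVr xV x0; apply: (@hone_neq0 H); rewrite -xV x0 hmul0r. Qed.

Lemma hmulKl a x : a <> hzero -> hmul (hinv a) (hmul a x) = x.
Proof. by move=> a0; rewrite hmulA hmulVl // hmul1l. Qed.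

Lemma hmulVKl a x : a <> hzero -> hmul a (hmul (hinv a) x) = x.
Proof. by move=> a0; rewrite hmulA hmulVr // hmul1l. Qed.

Lemma hmulKr a x : a <> hzero -> hmul (hmul x a) (hinv a) = x.
Proof. by move=> a0; rewrite -hmulA hmulVr // hmul1r. Qed.

Lemma hmulVKr a x : a <> hzero -> hmul (hmul x (hinv a)) a = x.
Proof. by move=> a0; rewrite -hmulA hmulVl // hmul1r. Qed.

Lemma hmul_inj a x y : a <> hzero -> hmul a x = hmul a y -> x = y.
Proof. by move=> a0 axy; rewrite -[x](hmulKl _ a0) axy hmulKl. Qed.

Lemma hmulr_inj a x y : a <> hzero -> hmul x a = hmul y a -> x = y.
Proof. by move=> a0 axy; rewrite -[x](hmulKr _ a0) axy hmulKr. Qed.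

Lemma hmul_eq0 x y : hmul x y = hzero -> x = hzero \/ y = hzero.
Proof.
move=> xy0; have [x0|x0] := EM (x = hzero); first by left.
by right; rewrite -[y](hmulKl _ x0) xy0 hmul0r.
Qed.

Lemma hmul_neq0 x y : x <> hzero -> y <> hzero -> hmul x y <> hzero.
Proof. by move=> x0 y0 /hmul_eq0[]. Qed.

Lemma hopp_neq0 x : x <> hzero -> hopp x <> hzero.
Proof. by move=> x0 /(congr1 (@hopp H)); rewrite hoppK hopp0. Qed.

Lemma hsetaddP A B z : hsetadd A B z <-> exists a b, [/\ A a, B b & hadd a b z].
Proof.
by split=> [[a Aa [b Bb abz]]|[a [b [Aa Bb abz]]]]; exists a => //; exists b.
Qed.

Lemma hsetadd1 x y : hsetadd [set x]%classic [set y]%classic = hadd x y.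
Proof.
apply/seteqP; split=> z; first by move=> /hsetaddP[_ [_ [-> -> //]]].
by move=> xyz; apply/hsetaddP; exists x, y.
Qed.

Lemma hsetaddS A A' B B' : (A `<=` A')%classic -> (B `<=` B')%classic ->
  (hsetadd A B `<=` hsetadd A' B')%classic.
Proof.
move=> AA' BB' z /hsetaddP[a [b [Aa Bb abz]]].
by apply/hsetaddP; exists a, b; split; [exact: AA'|exact: BB'|].
Qed.

Lemma hsetadd_0P A B : hsetadd A B hzero <-> exists2 a, A a & B (hopp a).
Proof.
split=> [/hsetaddP[a [b [Aa Bb /hadd_oppP ab]]]|[a Aa Ba]].
  by exists a; rewrite // -ab.
by apply/hsetaddP; exists a, (hopp a); split => //; apply/hadd_opp.
Qed.

Lemma hsetadd_neq0 A B : (A !=set0 -> B !=set0 -> hsetadd A B !=set0)%classic.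
Proof.
move=> [a Aa] [b Bb]; have [z abz] := hadd_neq0 a b.
by exists z; apply/hsetaddP; exists a, b.
Qed.

(* For stringent [H], [ball y x] plays the role of |x| < |y| if 1 is not in 1 - 1, and of
   |x| <= |y| otherwise. *)
Definition ball x : set H := hadd x (hopp x).

Lemma ball0 x : ball x hzero. Proof. exact/hadd_opp. Qed.

(** By reversibility, membership in y - y becomes absorption by [y], a form to which associativity
    applies. *)
Lemma ballE x y : ball y x <-> hadd y x y.
Proof.
by rewrite /ball [hadd y x]haddC; split=> h; have := hadd_revl h; rewrite ?hoppK.
Qed.

Lemma ball_oppc y : ball (hopp y) = ball y.
Proof. by rewrite /ball hoppK haddC. Qed.

Lemma ball_opp x y : ball y x -> ball y (hopp x).
Proof. by move=> /haddN; rewrite hoppK haddC. Qed.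

Lemma ball_mull a x y : ball y x -> ball (hmul a y) (hmul a x).
Proof. by move=> /(hadd_mull a); rewrite hmulrN. Qed.

Lemma ball_mulr a x y : ball y x -> ball (hmul y a) (hmul x a).
Proof. by move=> /(hadd_mulr a); rewrite hmulNl. Qed.

Lemma ball_mullI a x y : a <> hzero -> ball (hmul a y) (hmul a x) -> ball y x.
Proof. by move=> a0 /(ball_mull (hinv a)); rewrite !hmulKl. Qed.

Lemma ball_mulrI a x y : a <> hzero -> ball (hmul y a) (hmul x a) -> ball y x.
Proof. by move=> a0 /(ball_mulr (hinv a)); rewrite !hmulKr. Qed.

Lemma ball_zero x : ball hzero x -> x = hzero.
Proof. by rewrite /ball hopp0 hadd0. Qed.

Section Sums.
Variable I : finType.
Implicit Types (P : pred I) (F G : I -> set H).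

Lemma hsumS P F G : (forall i, P i -> F i `<=` G i)%classic ->
  (\big[@hsetadd H/[set hzero]]_(i | P i) F i `<=`
   \big[@hsetadd H/[set hzero]]_(i | P i) G i)%classic.
Proof.
move=> FG; apply: (big_ind2 (fun A B : set H => A `<=` B)%classic) => //.
by move=> A A' B B'; apply: hsetaddS.
Qed.

Lemma hsum_nonempty P F : (forall i, P i -> F i !=set0)%classic ->
  (\big[@hsetadd H/[set hzero]]_(i | P i) F i !=set0)%classic.
Proof.
move=> F0; apply: (big_ind (fun A : set H => A !=set0)%classic) => //.
- by exists hzero.
- by move=> A B; apply: hsetadd_neq0.
Qed.

Lemma hsetadd_mull a A B :
  (hmul a @` hsetadd A B = hsetadd (hmul a @` A) (hmul a @` B))%classic.
Proof.
apply/seteqP; split=> z.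
  move=> [w /hsetaddP[x [y [Ax By xyw]]] <-]; apply/hsetaddP.
  exists (hmul a x), (hmul a y); split; [by exists x|by exists y|].
  exact: hadd_mull.
move=> /hsetaddP[_ [_ [[x Ax <-] [y By <-]]]]; rewrite -hmulDr => -[w xyw <-].
by exists w => //; apply/hsetaddP; exists x, y.
Qed.

Lemma hsetadd_mulr a A B : ((fun z => hmul z a) @` hsetadd A B =
  hsetadd ((fun z => hmul z a) @` A) ((fun z => hmul z a) @` B))%classic.
Proof.
apply/seteqP; split=> z.
  move=> [w /hsetaddP[x [y [Ax By xyw]]] <-]; apply/hsetaddP.
  exists (hmul x a), (hmul y a); split; [by exists x|by exists y|].
  exact: hadd_mulr.
move=> /hsetaddP[_ [_ [[x Ax <-] [y By <-]]]]; rewrite -hmulDl => -[w xyw <-].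
by exists w => //; apply/hsetaddP; exists x, y.
Qed.

Lemma hsum_mull a P F : (hmul a @` (\big[@hsetadd H/[set hzero]]_(i | P i) F i) =
  \big[@hsetadd H/[set hzero]]_(i | P i) (hmul a @` F i))%classic.
Proof.
apply: (big_morph (fun A => hmul a @` A)%classic (hsetadd_mull a)).
by rewrite image_set1 hmul0r.
Qed.

Lemma hsum_mulr a P F :
  ((fun z => hmul z a) @` (\big[@hsetadd H/[set hzero]]_(i | P i) F i) =
  \big[@hsetadd H/[set hzero]]_(i | P i) ((fun z => hmul z a) @` F i))%classic.
Proof.
apply: (big_morph (fun A => (fun z => hmul z a) @` A)%classic (hsetadd_mulr a)).
by rewrite image_set1 hmul0l.
Qed.

Lemma hsum_sub A P F : A hzero -> (forall x y z, A x -> A y -> hadd x y z -> A z) ->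
  (forall i, P i -> F i `<=` A)%classic ->
  (\big[@hsetadd H/[set hzero]]_(i | P i) F i `<=` A)%classic.
Proof.
move=> A0 AD FA; apply: (big_ind (fun B : set H => B `<=` A)%classic) => //.
- by move=> _ ->.
- by move=> B B' BA BA' z /hsetaddP[x [y [/BA Ax /BA' Ay /AD]]]; apply.
Qed.

End Sums.
End Hyperfield.

(** * Absorption and the shape of finite sums *)

Section Stringent.
Variables (H : skewHyperfieldType) (HS : stringent H).
Implicit Types (x y z a b c w : H) (A B : set H).

Lemma hadd_single x y z : x <> hopp y -> hadd x y z -> hadd x y = [set z]%classic.
Proof. by move=> /HS[c ->] ->. Qed.

Lemma hadd_uniq x y z z' : x <> hopp y -> hadd x y z -> hadd x y z' -> z = z'.
Proof. by move=> /HS[c ->] -> ->. Qed.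

Lemma ball_absorb x y : ball y x -> x <> hopp y -> hadd y x = [set y]%classic.
Proof.
move=> /ballE yxy xy.
by apply: hadd_single => // /(congr1 (@hopp H)); rewrite hoppK => /esym.
Qed.

Lemma haddA_left x y z u w : hadd x y u -> hadd u z w ->
  exists2 v, hadd y z v & hadd x v w.
Proof.
move=> xyu uzw.
have : (\bigcup_(u in hadd x y) hadd u z)%classic w by exists u.
by rewrite -haddA => -[v]; exists v.
Qed.

Lemma haddA_right x y z v w : hadd y z v -> hadd x v w ->
  exists2 u, hadd x y u & hadd u z w.
Proof.
move=> yzv xvw.
have : (\bigcup_(v in hadd y z) hadd x v)%classic w by exists v.
by rewrite haddA => -[u]; exists u.
Qed.

Lemma ball_trans y x z : ball y x -> ball z y -> ball z x.
Proof.
move=> /ballE yxy zy; have [yz|yz] := EM (y = hopp z).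
  by rewrite -ball_oppc -yz; apply/ballE.
apply/ballE; move/ballE: (zy) => zyz.
by have [u] := haddA_right yxy zyz; rewrite (ball_absorb zy yz) => ->.
Qed.

(** The source of comparability. An element [u] of x + y differs from [x], since [x] does not absorb
    [y], so u - x is the singleton {y}. As -x absorbs [z], so does y. *)
Lemma ball_notin_trans x y z : ball x z -> ~ ball x y -> ball y z.
Proof.
move=> xz nxy; have [xy|xy] := EM (x = hopp y); first by rewrite -ball_oppc -xy.
have [u xyu] := hadd_neq0 x y.
have ux : u <> x by move=> ux; apply/nxy/ballE; rewrite -{2}ux.
have uxy : hadd u (hopp x) y by exact: hadd_rev.
have zx : hadd (hopp x) z (hopp x) by apply/ballE; rewrite ball_oppc.
have [v] := haddA_right zx uxy.
by rewrite (hadd_single _ uxy) => [-> /ballE //|]; rewrite hoppK.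
Qed.

Lemma ball_hadd y x x' z : ball y x -> ball y x' -> hadd x x' z -> ball y z.
Proof.
move=> yx yx' xx'z; have [xx'|xx'] := EM (x = hopp x').
  by apply: ball_trans yx; move: xx'z; rewrite xx' -ball_oppc /ball hoppK haddC.
move/ballE: yx => yx; move/ballE: yx' => yx'.
have [v xx'v] := haddA_left yx yx'.
by rewrite (hadd_uniq xx' xx'v xx'z) => /ballE.
Qed.

(** Otherwise |z| exceeds both |x| and |x'|, so that z - x is {z}; it contains x', which gives x' =
    z. *)
Lemma notin_ball_hadd w x x' z :
  ~ ball x w -> ~ ball x' w -> hadd x x' z -> ~ ball z w.
Proof.
move=> nxw nx'w xx'z zw.
have [xx'|xx'] := EM (x = hopp x').
  apply: nxw; apply: ball_trans zw _.
  by rewrite /ball; have -> : hopp x = x' by rewrite xx' hoppK.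
have zx' : ball z x'.
  by apply: contrapT => nzx'; apply: nx'w; apply: ball_notin_trans nzx'.
have zx : ball z x.
  by apply: contrapT => nzx; apply: nxw; apply: ball_notin_trans nzx.
have x'zx : hadd z (hopp x) x'.
  by exact: hadd_rev.
move: x'zx; rewrite ball_absorb; last 1 first.
- by move=> /hopp_inj zx0; apply: nxw; rewrite zx0.
- by move=> x'z; apply: nx'w; rewrite x'z.
- exact: ball_opp.
Qed.

Lemma ball_add_ball a x : ball a x -> hsetadd (ball a) [set x]%classic = ball a.
Proof.
move=> ax.
have [xa|xa] := EM (x = a); last first.
  have -> : ball a = hsetadd [set a]%classic [set hopp a]%classic by rewrite hsetadd1.
  rewrite -hsetaddA hsetadd1 (@ball_absorb _ (hopp a)) ?hsetadd1 ?ball_oppc //.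
  by rewrite hoppK.
have [xa'|xa'] := EM (x = hopp a); last first.
  have -> : ball a = hsetadd [set hopp a]%classic [set a]%classic.
    by rewrite hsetadd1 haddC.
  by rewrite -hsetaddA hsetadd1 (ball_absorb ax).
apply/seteqP; split=> z.
  move=> /hsetaddP[u [_ [au -> uxz]]].
  by apply: ball_hadd au ax uxz.
by move=> az; apply/hsetaddP; exists a, x; split=> //; [rewrite -{2}xa | rewrite xa'].
Qed.

(** A sum a - a is unchanged by a term in [ball a] and collapses to {b i} for a term outside. The
    set [A], closed under negation and addition, keeps track of the size of [a]: it bounds the
    radius by any bound on the terms. *)
Lemma hsum_shape (I : finType) (P : pred I) (b : I -> H) A :
  A hzero -> (forall x, A x -> A (hopp x)) ->
  (forall x y z, A x -> A y -> hadd x y z -> A z) ->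
  (forall i, P i -> A (b i)) ->
  (exists s, \big[@hsetadd H/[set hzero]]_(i | P i) [set b i] = [set s])%classic \/
  (exists2 a, A a & \big[@hsetadd H/[set hzero]]_(i | P i) [set b i] = ball a)%classic.
Proof.
move=> A0 AN AD Ab.
pose shape (B : set H) := (B `<=` A)%classic /\
  ((exists s, B = [set s]%classic) \/ (exists2 a, A a & B = ball a)).
suff: shape (\big[@hsetadd H/[set hzero]]_(i | P i) [set b i])%classic by case.
apply: (big_rec shape).
  by split=> [_ -> //|]; left; exists hzero.
move=> i B Pi [BA Bs]; split.
  by move=> z /hsetaddP[x [y [-> /BA Ay]]]; apply: AD => //; apply: Ab.
rewrite hsetaddC; case: Bs => [[s Bs]|[a Aa Ba]]; subst B.
  rewrite hsetadd1; have [sb|/HS[c ->]] := EM (s = hopp (b i)).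
    by right; exists (b i); [exact: Ab | rewrite sb haddC].
  by left; exists c.
have [ab|ab] := EM (ball a (b i)).
  by right; exists a => //; apply: ball_add_ball.
have bab u : ball a u -> hadd (b i) u = [set b i]%classic.
  move=> au; apply: ball_absorb; first exact: ball_notin_trans au ab.
  by move=> ub; apply: ab; rewrite -[b i]hoppK -ub; apply: ball_opp.
left; exists (b i); apply/seteqP; split=> z.
  by move=> /hsetaddP[u [_ [au -> ]]]; rewrite haddC bab.
move=> ->; apply/hsetaddP; exists hzero, (b i).
by split=> //; [exact: ball0 | rewrite hadd0l].
Qed.
End Stringent.

Lemma ex_maximal (I : finType) (P : I -> Prop) (lt : I -> I -> Prop) :
  (forall i, ~ lt i i) -> (forall i j k, lt i j -> lt j k -> lt i k) ->
  (exists i, P i) -> exists2 i, P i & forall j, P j -> ~ lt i j.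
Proof.
move=> irr tr [i]; pose S k := [set j | `[< lt k j >]]%SET.
have [n] := ubnP #|S i|; elim: n i => // n IH i Sn Pi.
have [[j [Pj ij]]|max] := EM (exists j, P j /\ lt i j); last first.
  by exists i => // j Pj ij; apply: max; exists j.
apply: (IH j) => //; apply: leq_trans (_ : #|S i| <= n) => //.
apply: proper_card; apply/properP; split.
  by apply/subsetP => k; rewrite !in_set => /asboolW jk; apply/asboolT/(tr i j).
by exists j; rewrite in_set; [apply/asboolT | apply/asboolPn/irr].
Qed.

(** * Leading terms when 1 lies in 1 - 1 *)

Section Idempotent.
Variables (H : skewHyperfieldType) (HS : stringent H).
Hypothesis ball11 : ball hone (hone : H).
Implicit Types (x y z a b c w : H).

Lemma ball_refl y : ball y y.
Proof. by have := ball_mull y ball11; rewrite hmul1r. Qed.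

Lemma ball_total x y : ball x y \/ ball y x.
Proof.
have [xy|nxy] := EM (ball x y); [by left | right].
exact: (ball_notin_trans HS (ball_refl x)).
Qed.

Lemma ball_anti x y : ball x y -> ball y x -> x = y \/ x = hopp y.
Proof.
move=> xy yx; have [xy'|xy'] := EM (x = hopp y); [by right | left].
have yx' : y <> hopp x by move=> yx'; apply: xy'; rewrite yx' hoppK.
have := ball_absorb HS yx xy'; rewrite haddC (ball_absorb HS xy yx').
by move=> /seteqP[/(_ x)] /= h _; apply: h.
Qed.

Lemma ball_mul x x' y y' : ball x x' -> ball y y' -> ball (hmul x y) (hmul x' y').
Proof.
by move=> xx' yy'; apply: (ball_trans HS (ball_mull _ yy')); apply: ball_mulr.
Qed.

(* The elements bounded by [b] that cannot contribute to cancelling [b]. *)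
Definition dominated b x := ball b x /\ x <> hopp b.

(** Suppose the result is -b. If x and y are not opposite, it is the larger of them, which is
    excluded. If y = -x, then -b lies in x - x, so |x| = |b| and one of x, y is -b. *)
Lemma dominated_hadd b x y z :
  dominated b x -> dominated b y -> hadd x y z -> dominated b z.
Proof.
move=> [bx xb] [by_ yb] xyz; split; first exact: ball_hadd bx by_ xyz.
move=> zb; rewrite {}zb in xyz.
have [xy|xy] := EM (x = hopp y).
  have xb' : ball x (hopp b) by rewrite /ball (_ : hopp x = y) // xy hoppK.
  have xb'' : ball x b by rewrite -[b]hoppK; apply: ball_opp.
  case: (ball_anti bx xb'') => [bx'|bx'].
    by apply: yb; rewrite bx' xy hoppK.
  by apply: xb; rewrite bx' hoppK.
have yx : y <> hopp x by move=> yx; apply: xy; rewrite yx hoppK.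
case: (ball_total x y) => [xy'|yx'].
  by move: xyz; rewrite (ball_absorb HS xy' yx) => /esym.
by move: xyz; rewrite haddC (ball_absorb HS yx' xy) => /esym.
Qed.

Lemma dominated0 b : b <> hzero -> dominated b hzero.
Proof. by move=> b0; split; [exact: ball0 | move/esym; apply: hopp_neq0]. Qed.

Section Lead.
Variable I : finType.
Implicit Types P : pred I.

Lemma hsum_dominated P (b : I -> H) w : w <> hzero -> (forall i, P i -> dominated w (b i)) ->
  (\big[@hsetadd H/[set hzero]]_(i | P i) [set b i] `<=` dominated w)%classic.
Proof.
move=> w0 bw; apply: hsum_sub; first exact: dominated0.
  by move=> x y z; apply: dominated_hadd.
by move=> i Pi _ ->; apply: bw.
Qed.

Lemma hsum_lead P (b : I -> H) g : P g -> b g <> hzero -> (forall i, P i -> ball (b g) (b i)) ->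
  (\big[@hsetadd H/[set hzero]]_(i | P i) [set b i])%classic hzero ->
  exists2 j, P j & j <> g /\ b j = hopp (b g).
Proof.
move=> Pg g0 max; rewrite (bigD1 g) //= => /hsetadd_0P[_ -> sum].
apply: contrapT => none.
have : dominated (b g) (hopp (b g)).
  apply: hsum_dominated sum => // i /andP[Pi /eqP ig]; split; first exact: max.
  by move=> bi; apply: none; exists i.
by case.
Qed.

Lemma hsum_ball P (b : I -> H) g j : P g -> P j -> j <> g -> b j = hopp (b g) ->
  (forall i, P i -> ball (b g) (b i)) ->
  (ball (b g) `<=` \big[@hsetadd H/[set hzero]]_(i | P i) [set b i])%classic.
Proof.
move=> Pg Pj jg bj max z gz; rewrite (bigD1 g) //= (bigD1 j) ?Pj /=; last by apply/eqP.
rewrite hsetaddA hsetadd1 bj; set S := (X in hsetadd _ X).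
have SB : (S `<=` ball (b g))%classic.
  apply: hsum_sub; first exact: ball0.
    by move=> x y u; apply: ball_hadd.
  by move=> i /andP[/andP[Pi _] _] _ ->; apply: max.
have [s Ss] : (S !=set0)%classic by apply: hsum_nonempty => i _; exists (b i).
(* Whatever value [s] the other terms take, [z] is recovered from [s] and an element [u] of z - s,
   which is still in the ball. *)
have [u zsu] := hadd_neq0 z (hopp s).
apply/hsetaddP; exists u, s; split=> //; last first.
  by have := hadd_revl zsu; rewrite hoppK.
exact: (ball_hadd HS gz (ball_opp (SB _ Ss)) zsu).
Qed.

Lemma ex_max_ball P (b : I -> H) : (exists i, P i) ->
  exists2 g, P g & forall i, P i -> ball (b g) (b i).
Proof.
move=> exP; have [|||g Pg max] := @ex_maximal I P (fun i j => ~ ball (b i) (b j)).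
- by move=> i; apply; apply: ball_refl.
- move=> i j k nij njk ik; apply: njk; apply: ball_trans ik _ => //.
  by case: (ball_total (b j) (b i)).
- by [].
- by exists g => // i /max /contrapT.
Qed.

End Lead.
End Idempotent.

(* [a j] and [c i j] are the terms of an orthogonality relation on a line of a matroid;
   over a field, [c i j] is a difference of two coordinates. *)
Section Line.
Variables (H : skewHyperfieldType) (HS : stringent H).
Variables (I : finType) (J : {set I}) (a : I -> H) (c : I -> I -> H).
Hypotheses (cN : forall i j, i \in J -> j \in J -> c j i = hopp (c i j))
  (cii : forall i, i \in J -> c i i = hzero)
  (cD : forall i j k, i \in J -> j \in J -> k \in J -> hadd (c i k) (c k j) (c i j))
  (c_neq0 : exists i j, [/\ i \in J, j \in J & c i j <> hzero])
  (ortho : forall i, i \in J ->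
     (\big[@hsetadd H/[set hzero]]_(j in J) [set hmul (a j) (c i j)])%classic hzero).

(** For c_pq of greatest value, c_pg + c_gq is the singleton {c_pq} for every g: if the two were
    opposite, c_pg would have a greater value. The relation of row p minus that of row q is
    therefore the sum of the [a j] times c_pq. *)
Lemma line_field : ~ ball hone (hone : H) ->
  (\big[@hsetadd H/[set hzero]]_(j in J) [set a j])%classic hzero.
Proof.
move=> nb1.
have irr (x : H) : x <> hzero -> ~ ball x x.
  by move=> x0 xx; apply: nb1; apply: (@ball_mullI _ x) => //; rewrite hmul1r.
pose P (u : I * I) := [/\ u.1 \in J, u.2 \in J & c u.1 u.2 <> hzero].
have [|||[p q] [/= pJ qJ cpq] max] := @ex_maximal _ P
  (fun u v => c u.1 u.2 <> hzero /\ ball (c v.1 v.2) (c u.1 u.2)).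
- by move=> u [u0 /irr]; apply.
- move=> u v w [u0 vu] [v0 wv]; split=> //; exact: ball_trans vu wv.
- by have [i [j ij]] := c_neq0; exists (i, j).
have single g : g \in J -> hadd (c p g) (c g q) = [set c p q]%classic.
  move=> gJ; apply: hadd_single (cD _ _ _) => // pg.
  have bpg : ball (c p g) (c p q).
    have := cD pJ qJ gJ; rewrite /ball.
    by have -> : c g q = hopp (c p g) by rewrite pg hoppK.
  have pg0 : c p g <> hzero by move=> pg0; move: bpg; rewrite pg0 => /ball_zero.
  exact: (max (p, g)).
have : hsetadd (\big[@hsetadd H/[set hzero]]_(j in J) [set hmul (a j) (c p j)])%classic
  (\big[@hsetadd H/[set hzero]]_(j in J) [set hmul (a j) (c j q)])%classic hzero.
  apply/hsetadd_0P; exists hzero; first exact: ortho.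
  rewrite -[hopp hzero](hmulN1 hzero) (_ : hmul _ _ = hmul hzero (hopp hone));
    last by rewrite hmul0l hmul0r.
  under eq_bigr => j jJ do
    rewrite (cN qJ jJ) hmulrN -hmulrN1 -(image_set1 (fun z => hmul z (hopp hone))).
  rewrite -hsum_mulr; exists hzero => //; exact: ortho.
rewrite -big_split /=.
under eq_bigr => j jJ.
  rewrite hsetadd1 -hmulDr (single _ jJ) image_set1.
  rewrite -(image_set1 (fun z => hmul z (c p q))); over.
by rewrite -hsum_mulr => -[x ax /hmul_eq0[x0|//]]; rewrite x0 in ax.
Qed.

(** If the sum misses 0, no [a j] is the negative of a largest one. In a row, a largest product can
    then only be cancelled by a sign change of [c] between two indices of [L], where [a] takes one
    largest value. Such sign changes in every relevant row contradict the transitivity that [cD]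
    imposes on [c]. *)
Lemma line_idem : ball hone (hone : H) ->
  (\big[@hsetadd H/[set hzero]]_(j in J) [set a j])%classic hzero.
Proof.
move=> b1; apply: contrapT => nsum.
have [i0 [j0 [i0J j0J ij0]]] := c_neq0.
have [l lJ lmax] := ex_max_ball HS b1 a (ex_intro (fun i => i \in J) i0 i0J).
have al0 : a l <> hzero.
  move=> al0; apply: nsum; rewrite big1 // => j /lmax.
  by rewrite al0 => /ball_zero ->.
pose L i := i \in J /\ a i = a l.
have Lmax i j : L i -> j \in J -> ball (a i) (a j) by move=> [_ ->]; apply: lmax.
pose P (u : I * I) := [&& u.1 \in J, u.2 \in J & `[< L u.2 >]].
have [|[i g] /and3P[/= iJ gJ /asboolW Lg] max] :=
    ex_max_ball HS b1 (fun u : I * I => c u.1 u.2) (P := P).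
  by exists (i0, l); rewrite /P i0J lJ; apply/asboolT.
(* The maximum ranges over second indices in [L] only; [c k j] lies in [c k g] + [c g j], which
   extends the bound to all pairs. *)
have cmax k j : k \in J -> j \in J -> ball (c i g) (c k j).
  move=> kJ jJ; apply: ball_hadd (cD kJ jJ gJ) => //.
    by apply: (max (k, g)); rewrite /P kJ gJ; apply/asboolT.
  rewrite (cN jJ gJ); apply: ball_opp.
  by apply: (max (j, g)); rewrite /P jJ gJ; apply/asboolT.
set d := c i g in cmax.
have d0 : d <> hzero by move=> d0; move: (cmax _ _ i0J j0J); rewrite d0 => /ball_zero.
have opp k j : k \in J -> L j -> c k j = d \/ c k j = hopp d ->
    exists2 j', L j' & j' <> j /\ c k j' = hopp (c k j).
  move=> kJ [jJ aj] ckj.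
  have kj0 : c k j <> hzero by case: ckj => ->; last apply: hopp_neq0.
  have cmax' m : m \in J -> ball (c k j) (c k m).
    by move=> mJ; case: ckj => ->; rewrite ?ball_oppc; apply: cmax.
  have [||m mJ [mj cam]] := hsum_lead HS b1 jJ _ _ (ortho kJ).
  - by apply: hmul_neq0 => //; rewrite aj.
  - by move=> m mJ; apply: ball_mul => //; [rewrite aj; apply: lmax | apply: cmax'].
  have am : a m = a j \/ a m = hopp (a j).
    apply: ball_anti => //; last by rewrite aj; apply: lmax.
    apply: contrapT => nmj.
    have jm : ball (a j) (a m) by rewrite aj; apply: lmax.
    have := ball_mulr (c k j) jm.
    have : ball (hmul (a m) (c k m)) (hmul (a j) (c k j)).
      by rewrite cam ball_oppc; apply: ball_refl.
    move=> h1 _; apply: nmj; apply: (@ball_mulrI _ (c k j)) => //.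
    by apply: ball_trans h1 _ => //; apply: ball_mull; apply: cmax'.
  case: am => [am|am]; last first.
    exfalso; apply: nsum; apply: (hsum_ball HS jJ mJ mj am _ (ball0 _)) => n nJ.
    by rewrite aj; apply: lmax.
  exists m; first by split=> //; rewrite am.
  by split=> //; apply: (@hmul_inj _ (a j)); rewrite ?aj // -aj -{1}am cam hmulrN.
have [|m Lm [mg cim]] := opp i g iJ Lg; first by left.
(* With d = -d, the equality of [a m] and [a g] would also make them opposite, and a pair of
   opposite largest terms puts 0 into the sum. *)
have dN : d <> hopp d.
  move=> dN; apply: nsum; case: Lm => mJ am; case: Lg => gJ' ag.
  apply: (hsum_ball HS gJ mJ mg _ _ (ball0 _)) => [|k kJ]; last by rewrite ag; apply: lmax.
  by apply: (@hmulr_inj _ d) => //; rewrite am ag hmulNl -hmulrN -dN.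
have dd k j n : k \in J -> j \in J -> n \in J -> c k n = d -> c n j = d -> c k j = d.
  move=> kJ jJ nJ kn nj; have := cD kJ jJ nJ.
  by rewrite kn nj (ball_absorb HS (ball_refl b1 d) dN).
(* Since d + d = {d}, [c j i = d] defines a strict order on [L], with j above i. By [opp], an
   element with something below it also has something above it, so none of them is maximal. *)
have [|||n [Ln [k [Lk nk]]] nmax] := @ex_maximal _
  (fun j => L j /\ exists k, L k /\ c j k = d) (fun i j => L i /\ L j /\ c j i = d).
- by move=> j [[jJ _] [_]]; rewrite cii // => /esym.
- move=> x y z [Lx [Ly yx]] [_ [Lz zy]]; do 2!split=> //.
  by case: Lx Ly Lz => xJ _ [yJ _] [zJ _]; apply: (dd _ _ y).
- exists m; split=> //; exists g; split=> //; case: Lm => mJ _.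
  by apply: (dd _ _ i) => //; rewrite (cN iJ mJ) cim hoppK.
have [nJ _] := Ln; have [|j Lj [_ nj]] := opp n k nJ Lk; first by left.
have jn : c j n = d by case: (Lj) => jJ _; rewrite (cN nJ jJ) nj nk hoppK.
by apply: (nmax j); [split=> //; exists n | split].
Qed.

Lemma line : (\big[@hsetadd H/[set hzero]]_(j in J) [set a j])%classic hzero.
Proof. by have [/line_idem|/line_field] := EM (ball hone (hone : H)). Qed.
End Line.

(** * Matroids given by a rank function *)

Section Rank.
Variables (E : finType) (r : {set E} -> nat).
Implicit Types (A B I J K S T : {set E}) (x y z : E).

Definition rank_fun := [/\ forall A, r A <= #|A|,
  forall A B, A \subset B -> r A <= r B &
  forall A B, r (A :|: B) + r (A :&: B) <= r A + r B].

Definition circuits_of : set {set E} :=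
  [set S | r S < #|S| /\ forall T, T \proper S -> r T = #|T|]%classic.

(** The subtraction does not truncate when [r] is a rank function, by [rankT_le]. *)
Definition dual_rank A := #|A| + r (~: A) - r [set: E].

Hypothesis rF : rank_fun.

Lemma rank_le_card A : r A <= #|A|. Proof. by case: rF. Qed.
Lemma rank_mono A B : A \subset B -> r A <= r B. Proof. by case: rF => _ + _; apply. Qed.
Lemma rank_submod A B : r (A :|: B) + r (A :&: B) <= r A + r B.
Proof. by case: rF. Qed.

Lemma rank_setU A B : r (A :|: B) <= r A + #|B|.
Proof. by have := rank_submod A B; have := rank_le_card B; lia. Qed.

Lemma rankU1 x A : r (x |: A) <= (r A).+1.
Proof. by rewrite setUC; have := rank_setU A [set x]%SET; rewrite cards1 addn1. Qed.

Lemma rank_closure x A B : r (x |: A) = r A -> A \subset B -> r (x |: B) = r B.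
Proof.
move=> xA AB; have := rank_submod (x |: A) B.
rewrite -setUA (setUidPr AB).
have : r A <= r ((x |: A) :&: B) by apply: rank_mono; rewrite subsetI AB subsetUr.
by have : r B <= r (x |: B) by [apply: rank_mono; rewrite subsetUr]; lia.
Qed.

Lemma nullity_mono A B : A \subset B -> #|A| + r B <= #|B| + r A.
Proof.
move=> AB; have := rank_setU A (B :\: A).
rewrite setDE setUIr setUCr setIT (setUidPr AB).
have := cardsID A B; rewrite (setIidPr AB) setDE; lia.
Qed.

Lemma indep_subset A B : A \subset B -> r B = #|B| -> r A = #|A|.
Proof. by move=> /nullity_mono + rB; have := rank_le_card A; lia. Qed.

Lemma rank_span A J : (forall x, x \in A -> r (x |: J) = r J) -> r (A :|: J) = r J.
Proof.
have [n] := ubnP #|A|; elim: n A => // n IH A An spA.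
have [->|[x xA]] := set_0Vmem A; first by rewrite set0U.
rewrite -(setD1K xA) -setUA (rank_closure (spA x xA)) ?subsetUr //.
apply: IH => [|y /setD1P[_ /spA//]].
by have := cardsD1 x A; rewrite xA; lia.
Qed.

Lemma indep_extend I A : r I = #|I| -> I \subset A ->
  exists J, [/\ I \subset J, J \subset A, r J = #|J| & r J = r A].
Proof.
move=> rI IA; pose P := [pred J : {set E} | (J \subset A) && (r J == #|J|)].
have [|J /maxsetP[/andP[JA /eqP rJ] Jmax] IJ] := @maxset_exists _ P I.
  by rewrite /= IA rI eqxx.
exists J; split=> //; rewrite -[in RHS](setUidPl JA).
apply/esym/rank_span => x xA; apply/eqP; rewrite eqn_leq andbC rank_mono ?subsetUr //=.
rewrite leqNgt; apply/negP => lt.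
have xJ : x \notin J by apply/negP => xJ; move: lt; rewrite (setUidPr _) ?sub1set ?ltnn.
have : x |: J = J.
  apply: Jmax; rewrite ?subsetUr //= subUset sub1set xA JA /= cardsU1 xJ.
  by have := rankU1 x J; lia.
by move=> xJ'; rewrite xJ' ltnn in lt.
Qed.

Lemma dep_circuit A : r A < #|A| -> exists2 S, circuits_of S & S \subset A.
Proof.
move=> dA; have [S /minsetP[/= dS Smin] SA] := @minset_exists _ [pred A | r A < #|A|] A dA.
exists S => //; split=> // T TS; apply/eqP; rewrite eqn_leq rank_le_card leqNgt /=.
by apply/negP => dT; move: (TS); rewrite (Smin T dT (proper_sub TS)) properxx.
Qed.

Lemma circuit_through x A : x \notin A -> r (x |: A) = r A ->
  exists S, [/\ circuits_of S, x \in S & S \subset x |: A].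
Proof.
move=> xA rxA; have [||I [_ IA rI rIA]] := @indep_extend set0 A.
- by have := rank_le_card set0; rewrite cards0; lia.
- exact: sub0set.
have xI : x \notin I by apply: contra xA; apply: (subsetP IA).
have [|S cS SI] := @dep_circuit (x |: I).
  rewrite cardsU1 xI -rI rIA -rxA ltnS; apply: rank_mono; exact: setUS.
exists S; split=> //; last by apply: subset_trans SI _; apply: setUS.
apply: contraT => xS; case: cS => + _; rewrite ltnNge => /negP[].
rewrite (@indep_subset S I) //; apply/subsetP => y yS.
by move/subsetP: SI => /(_ y yS) /setU1P[yx|//]; rewrite -yx yS in xS.
Qed.

Lemma circuit_rank S : circuits_of S -> #|S| = (r S).+1.
Proof.
move=> [dS minS]; have [S0|[x xS]] := set_0Vmem S.
  by move: dS; rewrite S0 cards0.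
have xp : S :\ x \proper S by apply: properD1.
have := minS _ xp; have := rank_mono (proper_sub xp); have := cardsD1 x S.
by rewrite xS; lia.
Qed.

Lemma circuit_indep S A : circuits_of S -> S \subset A -> r A < #|A|.
Proof. by move=> [dS _] SA; have := nullity_mono SA; lia. Qed.

Lemma circuit_sub S T : circuits_of S -> circuits_of T -> S \subset T -> S = T.
Proof.
move=> [dS _] [_ minT] ST; apply/eqP; apply: contraT => neq.
by move: dS; rewrite minT ?ltnn // properEneq neq ST.
Qed.

Lemma circuit_nullity2 S T A : circuits_of S -> circuits_of T -> S <> T ->
  S \subset A -> T \subset A -> r A + 2 <= #|A|.
Proof.
move=> cS cT ST SA TA; have := nullity_mono (A := S :|: T) (B := A).
rewrite subUset SA TA => /(_ isT).
have := rank_submod S T; have := circuit_rank cS; have := circuit_rank cT.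
have : r (S :&: T) = #|S :&: T|.
  case: (cS) => _; apply; rewrite properEneq subsetIl andbT.
  by apply/eqP => /setIidPl /(circuit_sub cS cT).
by have := cardsUI S T; lia.
Qed.

Lemma nullity2_circuits A : r A + 2 <= #|A| ->
  exists S T, [/\ circuits_of S, circuits_of T, S <> T, S \subset A & T \subset A].
Proof.
move=> nA; have [|S cS SA] := @dep_circuit A; first by lia.
have [S0|[x xS]] := set_0Vmem S; first by have := circuit_rank cS; rewrite S0 cards0.
have xA := subsetP SA x xS.
have [|T cT TA] := @dep_circuit (A :\ x).
  have := rank_mono (subD1set A x); have := cardsD1 x A; rewrite xA; lia.
exists S, T; split=> //; last by apply: subset_trans TA (subD1set _ _).
by move=> ST; move/subsetP: TA => /(_ x); rewrite -ST xS !inE eqxx => /(_ isT).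
Qed.

(** Modularity amounts to nullity 2 of the union. A pair with smaller union would lie in the union
    minus a point x; as x lies on a circuit there, removing it lowers the nullity below 2, too
    little for two distinct circuits. *)
Lemma modular_pair_of S T A : circuits_of S -> circuits_of T -> S <> T ->
  S :|: T \subset A -> #|A| <= r A + 2 -> modular_pair circuits_of S T.
Proof.
move=> cS cT ST STA nA; split=> // -[S' [T' [cS' cT' ST' lt]]].
have [lt' [x xST xST']] := properP lt.
have := @circuit_nullity2 S' T' ((S :|: T) :\ x) cS' cT' ST'.
rewrite !subsetD1.
move: xST' lt'; rewrite in_setU negb_or subUset => /andP[-> ->] /andP[-> ->].
move=> /(_ isT isT).
have : exists C, [/\ circuits_of C, x \in C & C \subset S :|: T].
  by case/setUP: xST => xC; [exists S|exists T]; split=> //; rewrite ?subsetUl ?subsetUr.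
move=> [C [cC xC CST]].
have rx : r (x |: C :\ x) = r (C :\ x).
  rewrite setD1K //; have := circuit_rank cC; have := cardsD1 x C; rewrite xC.
  by case: (cC) => _ /(_ _ (properD1 xC)) ->; lia.
have := rank_closure rx (setSD [set x] CST).
rewrite setD1K //; have := cardsD1 x (S :|: T); rewrite xST.
by have := nullity_mono STA; lia.
Qed.

Lemma modular_pair_nullity S T : modular_pair circuits_of S T ->
  #|S :|: T| <= r (S :|: T) + 2.
Proof.
move=> [cS cT ST mod]; rewrite leqNgt; apply/negP => big.
have [S0|[x xS]] := set_0Vmem S; first by have := circuit_rank cS; rewrite S0 cards0.
have xST : x \in S :|: T by rewrite in_setU xS.
have [|S' [T' [cS' cT' ST' S'A T'A]]] := @nullity2_circuits ((S :|: T) :\ x).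
  have := rank_mono (subD1set (S :|: T) x); have := cardsD1 x (S :|: T).
  by rewrite xST; lia.
apply: mod; exists S', T'; split=> //.
apply: sub_proper_trans (properD1 xST).
by rewrite subUset S'A.
Qed.

Lemma indep_circuits I : indep circuits_of I <-> r I = #|I|.
Proof.
split=> [ind|rI S cS SI]; last by have := circuit_indep cS SI; lia.
apply/eqP; rewrite eqn_leq rank_le_card leqNgt /=; apply/negP => /dep_circuit[S cS].
exact: ind.
Qed.

Lemma basis_circuits B : basis circuits_of B <-> r B = #|B| /\ r B = r [set: E].
Proof.
split=> [[/indep_circuits rB Bmax]|[rB rBT]].
  have [J [BJ _ rJ rJT]] := indep_extend rB (subsetT B).
  by split=> //; rewrite -rJT (Bmax J) //; apply/indep_circuits.
split=> [|I /indep_circuits rI BI]; first exact/indep_circuits.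
apply/esym/eqP; rewrite eqEcard BI -rI -rB rBT; apply: rank_mono; exact: subsetT.
Qed.

Lemma codep_circuits K : codep circuits_of K <-> r (~: K) < r [set: E].
Proof.
split=> [coK|ltK B /basis_circuits[rB rBT] KB].
  rewrite ltnNge; apply/negP => leK.
  have [||J [_ JK rJ rJK]] := @indep_extend set0 (~: K).
  - by have := rank_le_card set0; rewrite cards0; lia.
  - exact: sub0set.
  apply: (coK J); last by rewrite -setCS setCK.
  apply/basis_circuits; split=> //; rewrite rJK; apply/eqP; rewrite eqn_leq leK andbT.
  by apply: rank_mono; apply: subsetT.
have : B \subset ~: K by rewrite -setCS setCK.
by move=> /rank_mono; lia.
Qed.

Lemma rankT_le A : r [set: E] <= #|A| + r (~: A).
Proof. by have := rank_setU (~: A) A; rewrite setUC setUCr; lia. Qed.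

Lemma circuits_ofP K : r K < #|K| -> (forall x, x \in K -> r (K :\ x) = #|K :\ x|) ->
  circuits_of K.
Proof.
move=> dK minK; split=> // T TK; have [sTK [x xK xT]] := properP TK.
by apply: (indep_subset (B := K :\ x)); [rewrite subsetD1 sTK | apply: minK].
Qed.

End Rank.

(** * Duality of rank functions *)

Section Dual.
Variables (E : finType) (r : {set E} -> nat) (rF : rank_fun r).
Implicit Types (A B K S : {set E}) (x : E).

Let rank_mono := rank_mono rF.
Let rankT_le := rankT_le rF.

Lemma dual_rank_fun : rank_fun (dual_rank r).
Proof.
split=> [A|A B AB|A B]; rewrite /dual_rank.
- by have := rank_mono (subsetT (~: A)); lia.
- have := nullity_mono rF (A := ~: B) (B := ~: A); rewrite setCS => /(_ AB).
  by have := cardsC A; have := cardsC B; lia.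
- have := rank_submod rF (~: A) (~: B); rewrite -setCI -setCU.
  have := cardsUI A B; have := rankT_le (A :|: B); have := rankT_le (A :&: B).
  by have := rankT_le A; have := rankT_le B; lia.
Qed.


Lemma dual_rankE A : dual_rank r A + r [set: E] = #|A| + r (~: A).
Proof. by rewrite /dual_rank; have := rankT_le A; lia. Qed.

(** The description of cocircuits as the complements of hyperplanes. *)
Lemma cocircuitP K : circuits_of (dual_rank r) K <->
  r (~: K) < r [set: E] /\ forall x, x \in K -> r (x |: ~: K) = r [set: E].
Proof.
have rC x : x \in K -> ~: (K :\ x) = x |: ~: K.
  by move=> xK; apply/setP => y; rewrite !inE negb_and negbK.
split=> [[dK minK]|[dK minK]].
  split; first by have := dual_rankE K; lia.
  move=> x xK; rewrite -rC //; have := minK _ (properD1 xK).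
  have := dual_rankE (K :\ x).
  by lia.
apply: (circuits_ofP dual_rank_fun); first by have := dual_rankE K; lia.
move=> x xK; have := dual_rankE (K :\ x); rewrite rC // minK //; lia.
Qed.

Lemma cocircuit_supports_circuits :
  cocircuit_supports (circuits_of r) = circuits_of (dual_rank r).
Proof.
have coP K : codep (circuits_of r) K <-> dual_rank r K < #|K|.
  by split=> [/(codep_circuits rF)|dK]; [|apply/(codep_circuits rF)];
     have := dual_rankE K; lia.
apply/seteqP; split=> K.
  move=> [/coP dK minK]; split=> // T TK.
  apply/eqP; rewrite eqn_leq (rank_le_card dual_rank_fun) leqNgt /=.
  by apply/negP => /coP /minK TK'; move: (TK); rewrite TK' ?properxx ?proper_sub.
move=> [dK minK]; split=> [|K' /coP dK' K'K]; first exact/coP.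
apply/eqP; apply: contraT => neq.
by move: dK'; rewrite minK ?ltnn // properEneq neq.
Qed.

Lemma circuit_cocircuit_meet S K x : circuits_of r S -> circuits_of (dual_rank r) K ->
  x \in S -> x \in K -> exists2 y, y \in S :&: K & y != x.
Proof.
move=> cS /cocircuitP[lt eqT] xS xK.
have [//|none] := pselect (exists2 y, y \in S :&: K & y != x).
have SK : S :\ x \subset ~: K.
  apply/subsetP => y /setD1P[yx yS]; rewrite inE; apply/negP => yK.
  by apply: none; exists y; rewrite ?inE ?yS.
have : r (x |: ~: K) = r (~: K).
  apply: (rank_closure rF _ SK); rewrite setD1K //.
  have := circuit_rank rF cS; have := cardsD1 x S; rewrite xS.
  by case: (cS) => _ /(_ _ (properD1 xS)) ->; lia.
by rewrite eqT // => e; rewrite e ltnn in lt.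
Qed.

Lemma cocircuit_avoiding A : r A < r [set: E] ->
  exists2 K, circuits_of (dual_rank r) K & [disjoint K & A].
Proof.
move=> ltA; have [|K cK KA] := @dep_circuit _ _ dual_rank_fun (~: A).
  by have := dual_rankE (~: A); rewrite setCK; lia.
by exists K => //; rewrite disjoints_subset.
Qed.

End Dual.

(** * The rank function of a family with circuit elimination *)

Section CircuitRank.
Variables (E : finType) (Cs : set {set E}).
Implicit Types (A B I J S T U : {set E}) (x y z e : E).
Hypotheses (Cs0 : ~ Cs set0)
  (Cs_sub : forall S T, Cs S -> Cs T -> S \subset T -> S = T)
  (Cs_elim : forall S T e, Cs S -> Cs T -> S <> T -> e \in S -> e \in T ->
     exists2 U, Cs U & U \subset (S :|: T) :\ e).

Definition circuit_rank_fun A := \max_(I : {set E} | (I \subset A) && `[< indep Cs I >]) #|I|.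
Let rk := circuit_rank_fun.

Lemma indep_sub I J : J \subset I -> indep Cs I -> indep Cs J.
Proof. by move=> JI iI S cS SJ; apply: (iI S cS); apply: subset_trans SJ JI. Qed.

Lemma depP A : ~ indep Cs A -> exists2 S, Cs S & S \subset A.
Proof.
by move=> dA; apply: contrapT => none; apply: dA => S cS SA; apply: none; exists S.
Qed.

Lemma sub_in_setU1 S x A y : S \subset x |: A -> y \in S -> y <> x -> y \in A.
Proof. by move=> /subsetP SA /SA /setU1P[]. Qed.

(** Exchange, by induction on the part of [I] outside [B]: an element x of that part is traded for
    an element y outside [I] of the circuit in x |: B. Elimination shows that the new set is
    independent and that every element of [I] outside it still depends on it. *)
Lemma indep_card_le B I : indep Cs B -> indep Cs I ->
  (forall x, x \in I -> x \notin B -> ~ indep Cs (x |: B)) -> #|I| <= #|B|.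
Proof.
have [n] := ubnP #|I :\: B|; elim: n B => // n IH B In iB iI dep.
have [/eqP|[x /setDP[xI xB]]] := set_0Vmem (I :\: B).
  by rewrite setD_eq0 => /subset_leq_card.
have [S cS SB] := depP (dep x xI xB).
have SnI : ~~ (S \subset I) by apply/negP => /(iI S cS).
have [y yS yI] := subsetPn SnI.
have yx : y <> x by move=> yx; rewrite yx xI in yI.
have yB : y \in B := sub_in_setU1 SB yS yx.
pose B' := x |: (B :\ y).
have B'z z : z \in B' <-> z = x \/ (z \in B /\ z <> y).
  rewrite !inE; split=> [/orP[/eqP|/andP[/eqP]]|[->|[-> /eqP ->]]]; rewrite ?eqxx ?orbT //; tauto.
have xS : x \in S.
  apply: contraT => xS; case: (iB S cS); apply/subsetP => z zS.
  by apply: (sub_in_setU1 SB zS) => zx; rewrite -zx zS in xS.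
have sub z : z \in I -> z \notin B' -> z \notin B.
  move=> zI; apply: contra => zB; apply/B'z; right; split=> // zy.
  by rewrite -zy zI in yI.
have -> : #|B| = #|B'|.
  by rewrite /B' cardsU1 !inE negb_and xB orbT (cardsD1 y B) yB.
apply: IH => //.
- apply: leq_trans (_ : #|I :\: B| <= n) => //; apply: proper_card; apply/properP; split.
    by apply/subsetP => z /setDP[zI zB']; rewrite inE zI (sub z zI zB').
  exists x; first by rewrite inE xI xB.
  by apply/negP => /setDP[_ /negP]; apply; apply/B'z; left.
- move=> T cT TB'.
  have xT : x \in T.
    apply: contraT => xT; case: (iB T cT); apply/subsetP => z zT.
    have /B'z[zx|[]//] := subsetP TB' z zT.
    by rewrite -zx zT in xT.
  have ST : S <> T by move=> ST; move: (subsetP TB' y); rewrite -ST => /(_ yS) /B'z[//|[]].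
  have [U cU US] := Cs_elim cS cT ST xS xT.
  apply: (iB U cU); apply: subset_trans US _; apply/subsetP => z /setD1P[/eqP zx].
  case/setUP => [zS|/(subsetP TB') /B'z[|[]]//].
  exact: sub_in_setU1 SB zS zx.
- move=> z zI zB'; have zB := sub z zI zB'.
  have zx : z <> x by move=> zx; case/negP: zB'; apply/B'z; left.
  have [V cV VB] := depP (dep z zI zB).
  have VB' w : w \in V -> w <> y -> w \in z |: B'.
    move=> wV wy; apply/setU1P; have [|wz] := pselect (w = z); [by left|right].
    by apply/B'z; right; split=> //; apply: sub_in_setU1 VB wV wz.
  have [yV|yV] := boolP (y \in V); last first.
    move=> ind; apply: (ind V cV); apply/subsetP => w wV; apply: VB' => //.
    by move=> wy; rewrite -wy wV in yV.
  have zV : z \in V.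
    apply: contraT => zV; case: (iB V cV); apply/subsetP => w wV.
    by apply: (sub_in_setU1 VB wV) => wz; rewrite -wz wV in zV.
  have SV : S <> V.
    move=> SV; case/negP: zB; rewrite -SV in zV; exact: sub_in_setU1 SB zV zx.
  have [U cU US] := Cs_elim cS cV SV yS yV.
  move=> ind; apply: (ind U cU); apply: subset_trans US _.
  apply/subsetP => w /setD1P[/eqP wy] /setUP[wS|wV]; last exact: VB'.
  apply/setU1P; right; apply/B'z.
  by have [|wx] := pselect (w = x); [left | right; split=> //; apply: sub_in_setU1 SB wS wx].
Qed.

Lemma leq_circuit_rank I A : I \subset A -> indep Cs I -> #|I| <= rk A.
Proof.
move=> IA iI; apply: (leq_bigmax_cond (F := fun I : {set E} => #|I|)).
by rewrite IA; apply: asboolT.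
Qed.

Lemma indep_ext J A : J \subset A -> indep Cs J ->
  exists I, [/\ J \subset I, I \subset A, indep Cs I & #|I| = rk A].
Proof.
move=> JA iJ; pose P := [pred I : {set E} | (I \subset A) && `[< indep Cs I >]].
have [|I /maxsetP[/andP[IA /asboolW iI] Imax] JI] := @maxset_exists _ P J.
  by rewrite /= JA; apply: asboolT.
exists I; split=> //; apply/eqP; rewrite eqn_leq leq_circuit_rank //=.
apply/bigmax_leqP => K /andP[KA /asboolW iK]; apply: indep_card_le => // x xK xI ix.
have : x |: I = I.
  apply: Imax; last exact: subsetUr.
  by rewrite /= subUset sub1set IA (subsetP KA) //=; apply: asboolT.
by move=> xII; rewrite -xII setU11 in xI.
Qed.

Lemma indep_set0 : indep Cs set0.
Proof. by move=> S cS; rewrite subset0 => /eqP S0; apply: Cs0; rewrite -S0. Qed.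

Lemma circuit_rank_fun_rank : rank_fun rk.
Proof.
split=> [A|A B AB|A B].
- by apply/bigmax_leqP => I /andP[IA _]; apply: subset_leq_card.
- have [I [_ IA iI <-]] := indep_ext (sub0set A) indep_set0.
  by apply: leq_circuit_rank iI; apply: subset_trans AB.
- have [J [_ JAB iJ <-]] := indep_ext (sub0set (A :&: B)) indep_set0.
  have JAB' : J \subset A :|: B.
    by apply: subset_trans JAB _; apply: subset_trans (subsetIl _ _) (subsetUl _ _).
  have [I [JI IAB iI <-]] := indep_ext JAB' iJ.
  have := @leq_circuit_rank (I :&: A) A (subsetIr _ _) (indep_sub (subsetIl _ _) iI).
  have := @leq_circuit_rank (I :&: B) B (subsetIr _ _) (indep_sub (subsetIl _ _) iI).
  have := cardsUI (I :&: A) (I :&: B); rewrite -setIUr (setIidPl IAB).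
  have : #|J| <= #|(I :&: A) :&: (I :&: B)|.
    apply: subset_leq_card; move: JAB; rewrite !subsetI JI => /andP[-> ->] //.
  lia.
Qed.

Lemma circuits_of_circuit_rank : circuits_of rk = Cs.
Proof.
have indP I : indep Cs I <-> rk I = #|I|.
  split=> [iI|rI].
    apply/eqP; rewrite eqn_leq leq_circuit_rank // andbT.
    exact: (rank_le_card circuit_rank_fun_rank).
  have [J [_ JI iJ]] := indep_ext (sub0set I) indep_set0.
  by rewrite -/rk rI => JI'; have <- : J = I by apply/eqP; rewrite eqEcard JI JI' /=.
apply/seteqP; split=> S.
  move=> [dS minS]; have [|T cT TS] := @depP S.
    by move=> /indP rS; rewrite rS ltnn in dS.
  have [<- //|/eqP neq] := pselect (T = S).
  have /minS /indP iT : T \proper S by rewrite properEneq neq.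
  by case: (iT T cT).
move=> cS; split.
  have := rank_le_card circuit_rank_fun_rank S; rewrite leq_eqVlt => /orP[/eqP /indP|//].
  by move=> /(_ S cS); case.
move=> T TS; apply/indP => U cU UT.
have US : U = S by apply: Cs_sub => //; apply: subset_trans UT (proper_sub TS).
by move: (sub_proper_trans UT TS); rewrite US properxx.
Qed.

End CircuitRank.

(** * Dual pairs of circuit sets *)

Section Dot.
Variables (H : skewHyperfieldType) (E : finType).
Implicit Types (X Y Z : {ffun E -> H}) (C D : set {ffun E -> H})
  (e f g i : E) (a : H).

Definition hdot X Y : set H :=
  (\big[@hsetadd H/[set hzero]]_(i : E) [set hmul (X i) (Y i)])%classic.

Lemma hsum_on (J : {set E}) (F : E -> set H) :
  (forall i, i \notin J -> F i = [set hzero]%classic) ->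
  (\big[@hsetadd H/[set hzero]]_(i : E) F i =
   \big[@hsetadd H/[set hzero]]_(i in J) F i)%classic.
Proof. by move=> F0; apply/esym/big_rmcond => i; apply: F0. Qed.

Lemma hsuppP X i : reflect (X i <> hzero) (i \in hsupp X).
Proof. by rewrite inE; apply: (iffP negP) => h /eqP. Qed.

Lemma hsuppPn X i : reflect (X i = hzero) (i \notin hsupp X).
Proof. by rewrite inE negbK; apply: eqP. Qed.

Lemma lscaleE a X i : lscale a X i = hmul a (X i). Proof. exact: ffunE. Qed.
Lemma rscaleE a X i : rscale a X i = hmul (X i) a. Proof. exact: ffunE. Qed.

Lemma hsupp_lscale a X : a <> hzero -> hsupp (lscale a X) = hsupp X.
Proof.
move=> a0; apply/setP => i; apply/hsuppP/hsuppP; rewrite ffunE.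
  by move=> aX X0; apply: aX; rewrite X0 hmul0r.
exact: hmul_neq0.
Qed.

Lemma hsupp_rscale a X : a <> hzero -> hsupp (rscale a X) = hsupp X.
Proof.
move=> a0; apply/setP => i; apply/hsuppP/hsuppP; rewrite ffunE.
  by move=> aX X0; apply: aX; rewrite X0 hmul0l.
by move=> X0; apply: hmul_neq0.
Qed.

Lemma hdot_on (J : {set E}) X Y :
  (forall i, X i <> hzero -> Y i <> hzero -> i \in J) ->
  hdot X Y = (\big[@hsetadd H/[set hzero]]_(i in J) [set hmul (X i) (Y i)])%classic.
Proof.
move=> XYJ; apply: hsum_on => i iJ; congr classical_sets.set1.
have [->|X0] := pselect (X i = hzero); first by rewrite hmul0l.
have [->|Y0] := pselect (Y i = hzero); first by rewrite hmul0r.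
by rewrite XYJ in iJ.
Qed.

Lemma orthogonal2 X Y e f : e <> f ->
  (forall i, X i <> hzero -> Y i <> hzero -> i = e \/ i = f) ->
  orthogonal X Y <-> hmul (X f) (Y f) = hopp (hmul (X e) (Y e)).
Proof.
move=> /eqP ef XY; rewrite /orthogonal -/(hdot X Y) (@hdot_on [set e; f]); last first.
  by move=> i Xi Yi; rewrite !inE; case: (XY i Xi Yi) => ->; rewrite eqxx ?orbT.
by rewrite big_setU1 ?inE //= big_set1 hsetadd1; exact: hadd_opp.
Qed.

Lemma orthogonal3 X Y e f g : e <> f -> e <> g -> f <> g ->
  (forall i, X i <> hzero -> Y i <> hzero -> [\/ i = e, i = f | i = g]) ->
  orthogonal X Y <->
    hadd (hmul (X e) (Y e)) (hmul (X f) (Y f)) (hopp (hmul (X g) (Y g))).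
Proof.
move=> /eqP ef /eqP eg /eqP fg XY; rewrite /orthogonal -/(hdot X Y).
rewrite (@hdot_on (e |: [set f; g])); last first.
  by move=> i Xi Yi; rewrite !inE; case: (XY i Xi Yi) => ->; rewrite eqxx ?orbT.
rewrite big_setU1 ?inE ?negb_or ?ef //= big_setU1 ?inE //= big_set1.
rewrite hsetaddA hsetadd1 hsetaddC.
split=> [/hsetadd_0P[_ ->]//|efg].
by apply/hsetadd_0P; exists (hmul (X g) (Y g)).
Qed.

Lemma card_set3_le e f g : #|e |: [set f; g]| <= 3.
Proof. by rewrite cardsU1 cards2; case: (_ \notin _); case: (_ != _). Qed.

Section Korthogonal.
Variables (C D : set {ffun E -> H}) (CD : korthogonal 3 C D).

Lemma korthogonal3 X Y e f g : C X -> D Y -> e <> f -> e <> g -> f <> g ->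
  (forall i, X i <> hzero -> Y i <> hzero -> [\/ i = e, i = f | i = g]) ->
  hadd (hmul (X e) (Y e)) (hmul (X f) (Y f)) (hopp (hmul (X g) (Y g))).
Proof.
move=> CX DY ef eg fg XY; apply/orthogonal3 => //; apply: CD => //.
apply: leq_trans (card_set3_le e f g); apply: subset_leq_card; apply/subsetP => i.
by move=> /setIP[/hsuppP Xi /hsuppP Yi]; rewrite !inE; case: (XY i Xi Yi) => ->; rewrite eqxx ?orbT.
Qed.

Lemma korthogonal2 X Y e f : C X -> D Y -> e <> f ->
  (forall i, X i <> hzero -> Y i <> hzero -> i = e \/ i = f) ->
  hmul (X f) (Y f) = hopp (hmul (X e) (Y e)).
Proof.
move=> CX DY ef XY; apply/orthogonal2 => //; apply: CD => //.
apply: leq_trans (card_set3_le e e f); apply: subset_leq_card; apply/subsetP => i.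
by move=> /setIP[/hsuppP Xi /hsuppP Yi]; rewrite !inE; case: (XY i Xi Yi) => ->; rewrite eqxx ?orbT.
Qed.

End Korthogonal.

(** The rank function is explicit so that minors can name theirs. Elimination is not a field: for
    [D] it is derived in [dp_modular_elimination], and [dual_matroid] asks for it on that side
    only. *)
Record dual_pair (r : {set E} -> nat) C D : Prop := DualPair {
  dp_rank : rank_fun r;
  dp_circuits : hsupps C = circuits_of r;
  dp_cocircuits : hsupps D = circuits_of (dual_rank r);
  dp_lscale : forall X a, C X -> a <> hzero -> C (lscale a X);
  dp_rscale : forall Y a, D Y -> a <> hzero -> D (rscale a Y);
  dp_lsub : forall X X', C X -> C X' -> hsupp X \subset hsupp X' ->
    exists2 a, a <> hzero & X' = lscale a X;
  dp_rsub : forall Y Y', D Y -> D Y' -> hsupp Y \subset hsupp Y' ->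
    exists2 a, a <> hzero & Y' = rscale a Y;
  dp_orth : korthogonal 3 C D
}.

End Dot.

Lemma rank_cocircuit (E : finType) (r : {set E} -> nat) (K A : {set E}) x :
  rank_fun r -> circuits_of (dual_rank r) K -> A \subset ~: K -> x \in K ->
  r (x |: A) = (r A).+1.
Proof.
move=> rF /(cocircuitP rF)[lt top] AK xK; apply/eqP; rewrite eqn_leq rankU1 //=.
rewrite ltn_neqAle rank_mono ?subsetUr // andbT; apply/eqP => rAx.
by have := rank_closure rF (esym rAx) AK; rewrite top // => rK; rewrite rK ltnn in lt.
Qed.

Section DualPair.
Variables (H : skewHyperfieldType) (E : finType) (r : {set E} -> nat).
Variables (C D : set {ffun E -> H}) (CD : dual_pair r C D).
Implicit Types (X Y Z : {ffun E -> H}) (S K A : {set E}) (e f g h i x : E) (a : H).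

Let rF := dp_rank CD.
Let kor := dp_orth CD.

Lemma dp_cocircuit Y : D Y -> circuits_of (dual_rank r) (hsupp Y).
Proof. by move=> DY; rewrite -(dp_cocircuits CD); exists Y. Qed.

Lemma dp_circuit_ex S : circuits_of r S -> exists2 X, C X & hsupp X = S.
Proof. by rewrite -(dp_circuits CD) => -[X CX <-]; exists X. Qed.

Lemma dp_cocircuit_ex K : circuits_of (dual_rank r) K -> exists2 Y, D Y & hsupp Y = K.
Proof. by rewrite -(dp_cocircuits CD) => -[Y DY <-]; exists Y. Qed.

Lemma dp_through x A : x \notin A -> r (x |: A) = r A ->
  exists X, [/\ C X, X x <> hzero & forall i, X i <> hzero -> i = x \/ i \in A].
Proof.
move=> xA rxA; have [S [cS xS SA]] := circuit_through rF xA rxA.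
have [X CX XS] := dp_circuit_ex cS; exists X; split=> //; first by apply/hsuppP; rewrite XS.
by move=> i /hsuppP; rewrite XS => /(subsetP SA) /setU1P.
Qed.

(* On the complement [L] of the union of the supports of a modular pair, the rank is two
   less than on the whole, so every element lies, with [L] and one element from each of
   the differences of the supports, in a circuit meeting the cocircuits in at most three
   elements. *)
Lemma dp_modular_elimination Y1 Y2 e : D Y1 -> D Y2 ->
  modular_pair (hsupps D) (hsupp Y1) (hsupp Y2) ->
  Y1 e = hopp (Y2 e) -> Y1 e <> hzero ->
  exists Z, [/\ D Z, Z e = hzero & forall i, hadd (Y1 i) (Y2 i) (Z i)].
Proof.
move=> D1 D2; rewrite (dp_cocircuits CD) => mod e12 e1.
have c1 := dp_cocircuit D1; have c2 := dp_cocircuit D2.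
have rF' := dual_rank_fun rF.
set K1 := hsupp Y1 in mod c1 *; set K2 := hsupp Y2 in mod c2 *.
have null := modular_pair_nullity rF' mod; have [_ _ K12 _] := mod.
have null' := circuit_nullity2 rF' c1 c2 K12 (subsetUl K1 K2) (subsetUr K1 K2).
have := dual_rankE rF (K1 :|: K2); set L := ~: (K1 :|: K2) => rL.
have eU : e \in K1 :|: K2 by rewrite in_setU; apply/orP; left; apply/hsuppP.
(* A third cocircuit of the same dual line, avoiding [e]. It carries the vector sought, scaled to
   agree with [Y1] at a point [f] outside [K2]; agreement with [Y2] at a point [g] outside [K1] is
   then forced by [e12]. *)
have [|K3 c3 K3U] := @dep_circuit _ _ rF' ((K1 :|: K2) :\ e).
  have := rank_mono rF' (subD1set (K1 :|: K2) e); have := cardsD1 e (K1 :|: K2).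
  by rewrite eU; move: null'; clear; lia.
have eK3 : e \notin K3 by apply/negP => /(subsetP K3U); rewrite in_setD1 eqxx.
have eK1 : e \in K1 by apply/hsuppP.
have eK2 : e \in K2 by apply/hsuppP => e2; apply: e1; rewrite e12 e2 hopp0.
have [f fK3 fK2] : exists2 f, f \in K3 & f \notin K2.
  apply/subsetPn/negP => K32; case/negP: eK3.
  by rewrite (circuit_sub c3 c2 K32).
have [g gK3 gK1] : exists2 g, g \in K3 & g \notin K1.
  apply/subsetPn/negP => K31; case/negP: eK3.
  by rewrite (circuit_sub c3 c1 K31).
have fK1 : f \in K1 by move: (subsetP K3U f fK3); rewrite in_setD1 in_setU (negPf fK2) orbF => /andP[].
have gK2 : g \in K2 by move: (subsetP K3U g gK3); rewrite in_setD1 in_setU (negPf gK1) => /andP[].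
have LK1 : L \subset ~: K1 by rewrite /L setCU subsetIl.
have LK2 : L \subset ~: K2 by rewrite /L setCU subsetIr.
have LK3 : L \subset ~: K3.
  by rewrite /L setCS; apply: subset_trans K3U (subD1set _ _).
have rfg : r (f |: (g |: L)) = r [set: E].
  apply/eqP; rewrite eqn_leq rank_mono ?subsetT //=.
  rewrite (rank_cocircuit rF c1) //; last by rewrite subUset sub1set inE gK1.
  by rewrite (rank_cocircuit rF c2) //; move: rL null; clear; lia.
have fg : f <> g by move=> fg; rewrite fg gK2 in fK2.
have supp0 Y i : i \notin hsupp Y -> Y i = hzero by move/hsuppPn.
have thru i : i \in K1 :|: K2 -> i <> f -> i <> g -> exists X, [/\ C X, X i <> hzero &
    forall j, X j <> hzero -> [\/ j = f, j = g | j = i] \/ j \in L].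
  move=> iU iF ig; have [||X [CX Xi Xs]] := @dp_through i (f |: (g |: L)).
  - by rewrite !in_setU1 !negb_or; move/eqP: iF => ->; move/eqP: ig => ->; rewrite in_setC iU.
  - by apply/eqP; rewrite rfg eqn_leq rank_mono ?subsetT //= -rfg rank_mono ?subsetUr.
  exists X; split=> // j /Xs[->|]; first by left; constructor 3.
  by move=> /setU1P[->|/setU1P[->|jL]]; [left; constructor 1|left; constructor 2|right].
have inL A Y j : L \subset ~: hsupp Y -> Y j <> hzero -> j \in L -> False.
  by move=> LY /hsuppP jY /(subsetP LY); rewrite in_setC jY.
have [Z0 DZ0 Z0K] := dp_cocircuit_ex c3.
pose a := hmul (hinv (Z0 f)) (Y1 f).
have Z0f : Z0 f <> hzero by apply/hsuppP; rewrite Z0K.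
have Y1f : Y1 f <> hzero by apply/hsuppP.
have a0 : a <> hzero by apply: hmul_neq0 => //; apply: hinv_neq0.
pose Z := rscale a Z0; have DZ : D Z by apply: dp_rscale CD _ _ DZ0 a0.
have ZK : hsupp Z = K3 by rewrite hsupp_rscale.
have Zf : Z f = Y1 f by rewrite ffunE hmulVKl.
have Ze : Z e = hzero by apply: supp0; rewrite ZK.
have fe : f <> e by move=> fe; rewrite -fe fK3 in eK3.
have ge : g <> e by move=> ge; rewrite -ge gK3 in eK3.
have Y1g := supp0 Y1 g gK1; have Y2f := supp0 Y2 f fK2.
have on1 X i : C X -> i <> f ->
    (forall j, X j <> hzero -> [\/ j = f, j = g | j = i] \/ j \in L) ->
    hmul (X f) (Y1 f) = hopp (hmul (X i) (Y1 i)).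
  move=> CX iF Xs; apply: (korthogonal2 kor CX D1 iF) => j /Xs[[->|->|->]|jL]; try tauto.
  by move=> Yj; case: (inL K1 Y1 j).
have on2 X i : C X -> i <> g ->
    (forall j, X j <> hzero -> [\/ j = f, j = g | j = i] \/ j \in L) ->
    hmul (X g) (Y2 g) = hopp (hmul (X i) (Y2 i)).
  move=> CX ig Xs; apply: (korthogonal2 kor CX D2 ig) => j /Xs[[->|->|->]|jL]; try tauto.
  by move=> Yj; case: (inL K1 Y2 j).
have Zg : Z g = Y2 g.
  have [//|||X [CX Xe Xs]] := thru e; [exact/nesym|exact/nesym|].
  have o1 := on1 X e CX (nesym fe) Xs; have o2 := on2 X e CX (nesym ge) Xs.
  have o3 : hmul (X g) (Z g) = hopp (hmul (X f) (Z f)).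
    apply: (korthogonal2 kor CX DZ fg) => j /Xs[[->|->|->]|jL] Zj; try tauto.
    by case: (inL K1 Z j) => //; rewrite ZK.
  apply: (@hmul_inj _ (X g)).
    move=> Xg; move: o2; rewrite Xg hmul0l => /(congr1 (@hopp H)); rewrite hoppK hopp0.
    by move=> /esym; apply: hmul_neq0 => //; apply/hsuppP.
  by rewrite o3 Zf o1 o2 hoppK e12 hmulrN.
exists Z; split=> // i.
have [->|iF] := pselect (i = f); first by rewrite Zf Y2f hadd0.
have [->|ig] := pselect (i = g); first by rewrite Zg Y1g hadd0l.
have [iU|iU] := boolP (i \in K1 :|: K2); last first.
  have /norP[/supp0 -> /supp0 ->] : ~~ ((i \in K1) || (i \in K2)) by rewrite -in_setU.
  by rewrite supp0 ?hadd0 // ZK; apply: contra iU => /(subsetP K3U) /setD1P[].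
have [X [CX Xi Xs]] := thru i iU iF ig.
have o1 := on1 X i CX iF Xs; have o2 := on2 X i CX ig Xs.
have := @korthogonal3 _ _ _ _ kor X Z f g i CX DZ fg (nesym iF) (nesym ig).
have XZ j : X j <> hzero -> Z j <> hzero -> [\/ j = f, j = g | j = i].
  by move=> /Xs[//|jL] Zj; case: (inL K1 Z j) => //; rewrite ZK.
move=> /(_ XZ); rewrite Zf Zg o1 o2 => /haddN; rewrite !hoppK.
by move=> /(hadd_mull (hinv (X i))); rewrite !hmulKl.
Qed.

Lemma dp_right_matroid : right_matroid D.
Proof.
split; [|exact: dp_rscale CD|exact: dp_rsub CD|exact: dp_modular_elimination].
move=> /dp_cocircuit [+ _]; rewrite (_ : hsupp _ = set0) ?cards0 //.
by apply/setP => i; rewrite !inE ffunE eqxx.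
Qed.

Lemma dp_dual_matroid : dual_matroid C D.
Proof.
split; [exact: dp_right_matroid | | exact: kor].
by rewrite (dp_cocircuits CD) (dp_circuits CD) cocircuit_supports_circuits.
Qed.

End DualPair.

(** * Uniqueness of the dual *)

Section CocircuitVectors.
Variables (H : skewHyperfieldType) (E : finType) (r : {set E} -> nat).
Variables (C : set {ffun E -> H}).
Hypotheses (rF : rank_fun r) (Cr : hsupps C = circuits_of r).
Implicit Types (X Y Z : {ffun E -> H}) (A K B S : {set E}) (e f g i x y : E).

Lemma circuit_vector X : C X -> circuits_of r (hsupp X).
Proof. by move=> CX; rewrite -Cr; exists X. Qed.

Lemma circuit_vector_through x A : x \notin A -> r (x |: A) = r A ->
  exists X, [/\ C X, X x <> hzero & hsupp X \subset x |: A].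
Proof.
move=> xA rxA; have [S [cS xS SA]] := circuit_through rF xA rxA.
have [X CX XS] : exists2 X, C X & hsupp X = S by move: cS; rewrite -Cr => -[X CX <-]; exists X.
by exists X; split=> //; [apply/hsuppP; rewrite XS | rewrite XS].
Qed.

Lemma rank_compl_cocircuit K : circuits_of (dual_rank r) K -> (r (~: K)).+1 = r [set: E].
Proof.
move=> cK; have [lt top] := (cocircuitP rF K).1 cK.
have [K0|[x xK]] := set_0Vmem K; first by move: lt; rewrite K0 setC0 ltnn.
by rewrite -(rank_cocircuit rF cK (subxx _) xK) top.
Qed.

Lemma circuit_vector_meet X K e : C X -> circuits_of (dual_rank r) K ->
  X e <> hzero -> e \in K -> exists f, [/\ f \in K, X f <> hzero & f <> e].
Proof.
move=> CX cK /hsuppP Xe eK.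
have [f /setIP[/hsuppP Xf fK] /eqP fe] := circuit_cocircuit_meet rF (circuit_vector CX) cK Xe eK.
by exists f.
Qed.

Lemma circuit_vector_meet2 X K e f : C X -> circuits_of (dual_rank r) K ->
  X e <> hzero -> e \in K -> (forall i, i \in K -> X i <> hzero -> i = e \/ i = f) ->
  X f <> hzero.
Proof.
by move=> CX cK Xe eK XK; have [g [gK Xg ge]] := circuit_vector_meet CX cK Xe eK; case: (XK g gK Xg) => // <-.
Qed.

Lemma circuit_vector_pair K e f : circuits_of (dual_rank r) K -> e \in K -> f \in K -> e <> f ->
  exists X, [/\ C X, X f <> hzero & forall i, i \in K -> X i <> hzero -> i = e \/ i = f].
Proof.
move=> cK eK fK ef; have [_ top] := (cocircuitP rF K).1 cK.
have [||X [CX Xf Xs]] := @circuit_vector_through f (e |: ~: K).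
- by rewrite !inE fK orbF; apply/eqP => fe; apply: ef.
- by apply/eqP; rewrite top // eqn_leq rank_mono ?subsetT //= -(top e eK) rank_mono ?subsetUr.
exists X; split=> // i iK /hsuppP /(subsetP Xs); rewrite !inE iK orbF.
by move=> /orP[/eqP|/eqP]; [right|left].
Qed.

(** Any two elements of a cocircuit are its only common elements with some circuit, and
    orthogonality to that circuit fixes the ratio of the two entries. *)
Lemma cocircuit_vector_uniq D D' Y Y' : korthogonal 3 C D -> korthogonal 3 C D' ->
  D Y -> D' Y' -> circuits_of (dual_rank r) (hsupp Y) -> hsupp Y' = hsupp Y ->
  exists2 a, a <> hzero & Y' = rscale a Y.
Proof.
move=> kD kD' DY DY' cK YY'.
have [K0|[e eK]] := set_0Vmem (hsupp Y).
  by case: cK => + _; rewrite K0 cards0.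
have Ye : Y e <> hzero by apply/hsuppP.
have Y'e : Y' e <> hzero by apply/hsuppP; rewrite YY'.
exists (hmul (hinv (Y e)) (Y' e)); first by apply: hmul_neq0 => //; apply: hinv_neq0.
apply/ffunP => f; rewrite ffunE; have [<-|ef] := pselect (e = f); first by rewrite hmulVKl.
have [fK|fK] := boolP (f \in hsupp Y); last first.
  by rewrite (hsuppPn _ _ fK) hmul0l; apply/hsuppPn; rewrite YY'.
have [X [CX Xf XK]] := circuit_vector_pair cK eK fK ef.
apply: (@hmul_inj _ (X f)) => //.
rewrite (korthogonal2 kD' CX DY' ef); last first.
  by move=> i Xi /hsuppP; rewrite YY' => /XK; apply.
rewrite hmulA (korthogonal2 kD CX DY ef); last by move=> i Xi /hsuppP /XK; apply.
by rewrite hmulNl -!hmulA hmulVKl.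
Qed.

End CocircuitVectors.

Lemma dual_uniq (H : skewHyperfieldType) (E : finType) (r : {set E} -> nat)
    (C D D' : set {ffun E -> H}) :
  dual_pair r C D -> dual_matroid C D' -> D' = D.
Proof.
move=> CD [[_ D'scale _ _] D'supp kD'].
have kD := dp_orth CD; have rF := dp_rank CD; have Cr := dp_circuits CD.
have suppE : hsupps D' = hsupps D.
  by rewrite D'supp (dp_cocircuits CD) Cr cocircuit_supports_circuits.
have sub (D1 D2 : set {ffun E -> H}) : korthogonal 3 C D1 -> korthogonal 3 C D2 ->
    hsupps D1 = hsupps D2 -> hsupps D2 = hsupps D ->
    (forall X a, D2 X -> a <> hzero -> D2 (rscale a X)) -> (D1 `<=` D2)%classic.
  move=> k1 k2 D12 D2D sc Y DY.
  have [Y2 D2Y2 YY2] : hsupps D2 (hsupp Y) by rewrite -D12; exists Y.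
  have [|a a0 ->] := cocircuit_vector_uniq rF Cr k2 k1 D2Y2 DY _ (esym YY2); last exact: sc.
  by rewrite -(dp_cocircuits CD) -D2D; exists Y2.
by apply/seteqP; split; apply: sub => //; exact: dp_rscale CD.
Qed.

Lemma dp_cocircuits_eq (H : skewHyperfieldType) (E : finType) (r : {set E} -> nat)
    (C D : set {ffun E -> H}) : dual_pair r C D -> cocircuits C = D.
Proof.
move=> CD; apply/seteqP; split=> [Y [D' /(dual_uniq CD) ->]//|Y DY].
by exists D => //; exact: dp_dual_matroid CD.
Qed.

(** * The underlying matroid, and ratios of circuit entries on a cocircuit *)

Section LeftMatroid.
Variables (H : skewHyperfieldType) (E : finType).
Variables (M : set {ffun E -> H}) (hM : left_matroid M).
Implicit Types (X Y Z : {ffun E -> H}) (A B K S T U I J : {set E}) (e f g i x y b : E).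

Lemma left_scale X a : M X -> a <> hzero -> M (lscale a X).
Proof. by case: hM => _ + _ _; apply. Qed.

Lemma left_uniq X X' : M X -> M X' -> hsupp X \subset hsupp X' ->
  exists2 a, a <> hzero & X' = lscale a X.
Proof. by case: hM => _ _ + _; apply. Qed.

Lemma left_elim X X' e : M X -> M X' ->
  modular_pair (hsupps M) (hsupp X) (hsupp X') -> X e <> hzero -> X' e <> hzero ->
  exists a Z, [/\ a <> hzero, M Z, Z e = hzero &
                  forall i, hadd (hmul a (X i)) (X' i) (Z i)].
Proof.
move=> MX MX' mod Xe X'e; pose a := hopp (hmul (X' e) (hinv (X e))).
have a0 : a <> hzero by apply/hopp_neq0/hmul_neq0 => //; apply: hinv_neq0.
case: hM => _ sc _ /(_ (lscale a X) X' e (sc _ _ MX a0) MX').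
rewrite hsupp_lscale // => /(_ mod); rewrite ffunE.
have aX : hmul a (X e) = hopp (X' e) by rewrite hmulNl hmulVKr.
rewrite aX => /(_ erefl (hopp_neq0 X'e)) [Z [MZ Ze Zi]].
by exists a, Z; split=> // i; have := Zi i; rewrite ffunE.
Qed.

Lemma hadd_supp (x y z : H) : hadd x y z -> z <> hzero -> x <> hzero \/ y <> hzero.
Proof.
move=> xyz z0; have [x0|] := pselect (x = hzero); [right|by left].
by move=> y0; apply: z0; move: xyz; rewrite x0 y0 hadd0.
Qed.

(* A pair that is not modular is replaced by one with a smaller union. *)
Lemma left_circuit_elim S T e : hsupps M S -> hsupps M T -> S <> T -> e \in S -> e \in T ->
  exists2 U, hsupps M U & U \subset (S :|: T) :\ e.
Proof.
have [n] := ubnP #|S :|: T|; elim: n S T => // n IH S T nST cS cT ST eS eT.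
have [mod|nmod] := pselect (modular_pair (hsupps M) S T).
  case: cS cT => [X MX XS] [X' MX' XT]; subst S T.
  have [a [Z [a0 MZ Ze Zi]]] := left_elim MX MX' mod (hsuppP _ _ eS) (hsuppP _ _ eT).
  exists (hsupp Z); first by exists Z.
  apply/subsetP => i /hsuppP iZ; rewrite in_setD1 in_setU.
  rewrite (_ : i != e); last by apply/eqP => ie; apply: iZ; rewrite ie.
  apply/orP; case: (hadd_supp (Zi i) iZ) => [aX|X'i]; [left|right]; apply/hsuppP => //.
  by move=> X0; apply: aX; rewrite X0 hmul0r.
have [S' [T' [cS' cT' ST' lt]]] : exists S' T', [/\ hsupps M S', hsupps M T', S' <> T' &
    S' :|: T' \proper S :|: T].
  by apply: contrapT => none; apply: nmod.
have sub U : U \subset S' :|: T' -> e \notin U -> U \subset (S :|: T) :\ e.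
  by move=> US eU; rewrite subsetD1 eU andbT; apply: subset_trans US (proper_sub lt).
have [eS'|eS'] := boolP (e \in S'); last by exists S'; rewrite ?sub ?subsetUl.
have [eT'|eT'] := boolP (e \in T'); last by exists T'; rewrite ?sub ?subsetUr.
have [|U cU] := IH S' T' _ cS' cT' ST' eS' eT'; first by have := proper_card lt; lia.
by rewrite subsetD1 => /andP[US eU]; exists U; rewrite ?sub.
Qed.

Lemma left_matroid_rank : exists r, rank_fun r /\ hsupps M = circuits_of r.
Proof.
have c0 : ~ hsupps M set0.
  case: hM => nM0 _ _ _ [X MX X0]; apply: nM0.
  rewrite (_ : hvec0 _ _ = X) //; apply/ffunP => i; rewrite ffunE; apply/esym/hsuppPn.
  by rewrite X0 inE.
have csub S T : hsupps M S -> hsupps M T -> S \subset T -> S = T.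
  move=> [X MX <-] [X' MX' <-] /(left_uniq MX MX')[a a0 ->].
  by rewrite hsupp_lscale.
exists (circuit_rank_fun (hsupps M)); split.
  exact: circuit_rank_fun_rank c0 left_circuit_elim.
by rewrite (circuits_of_circuit_rank c0 csub left_circuit_elim).
Qed.

Section Dual.
Variables (r : {set E} -> nat) (rF : rank_fun r) (Mr : hsupps M = circuits_of r).

Lemma same_supp_or_modular X X' A : M X -> M X' -> hsupp X \subset A -> hsupp X' \subset A ->
  #|A| <= r A + 2 -> hsupp X = hsupp X' \/ modular_pair (hsupps M) (hsupp X) (hsupp X').
Proof.
move=> MX MX' XA X'A nA; have [|XX'] := pselect (hsupp X = hsupp X'); [by left|right].
rewrite Mr; apply: (modular_pair_of rF (A := A)) => //; try exact: circuit_vector Mr _ _.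
by rewrite subUset XA.
Qed.

Lemma same_supp X X' A : M X -> M X' -> hsupp X \subset A -> hsupp X' \subset A ->
  #|A| <= (r A).+1 -> hsupp X = hsupp X'.
Proof.
move=> MX MX' XA X'A nA; apply: contrapT => XX'.
have := circuit_nullity2 rF (circuit_vector Mr MX) (circuit_vector Mr MX') XX' XA X'A.
by lia.
Qed.

Section Cocircuit.
Variables (K : {set E}) (cK : circuits_of (dual_rank r) K).

Let rK : (r (~: K)).+1 = r [set: E] := rank_compl_cocircuit rF cK.

(** The bases of the hyperplane complementary to the cocircuit [K]. *)
Definition hyp_basis B := [/\ B \subset ~: K, r B = #|B| & #|B|.+1 = r [set: E]].

Lemma hyp_basis_ext I : I \subset ~: K -> r I = #|I| ->
  exists2 B, hyp_basis B & I \subset B.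
Proof.
move=> IK rI; have [B [IB BK rB rBK]] := indep_extend rF rI IK.
by exists B => //; split=> //; lia.
Qed.

Lemma hyp_basis_rank B A e : hyp_basis B -> e \in K -> e |: B \subset A -> r A = r [set: E].
Proof.
move=> [BK rB cB] eK eBA; apply/eqP; rewrite eqn_leq rank_mono ?subsetT //=.
apply: leq_trans (rank_mono rF eBA).
by rewrite (rank_cocircuit rF cK) //; lia.
Qed.

Lemma hyp_basis_circuit B e f : hyp_basis B -> e \in K -> f \in K -> e <> f ->
  exists X, [/\ M X, X e <> hzero, X f <> hzero & hsupp X \subset f |: (e |: B)].
Proof.
move=> hB eK fK ef; have [BK _ _] := hB.
have [||X [MX Xf Xs]] := @circuit_vector_through _ _ r M rF Mr f (e |: B).
- rewrite in_setU1 negb_or; apply/andP; split; first by apply/eqP/nesym.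
  by apply/negP => /(subsetP BK); rewrite inE fK.
- by rewrite !(@hyp_basis_rank B _ e) // subsetUr.
exists X; split=> //.
apply: (circuit_vector_meet2 rF Mr MX cK Xf fK) => i iK /hsuppP /(subsetP Xs).
case/setU1P => [->|/setU1P[->|/(subsetP BK)]]; try tauto.
by rewrite inE iK.
Qed.

Lemma card_setU1_le x A : #|x |: A| <= #|A|.+1.
Proof. by rewrite cardsU1; case: (_ \notin _). Qed.

(** Eliminating [e] gives a circuit that meets [K] at most in [f]. A circuit cannot meet a cocircuit
    in one element, so its entry at [f], which lies in X' f - X f, is 0. *)
Lemma ratio_modular X X' e f : M X -> M X' ->
  hsupp X = hsupp X' \/ modular_pair (hsupps M) (hsupp X) (hsupp X') ->
  e \in K -> f \in K -> X e <> hzero -> X e = X' e ->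
  (forall i, i \in K -> X i <> hzero -> i = e \/ i = f) ->
  (forall i, i \in K -> X' i <> hzero -> i = e \/ i = f) -> X f = X' f.
Proof.
move=> MX MX' XX' eK fK Xe ee XK X'K; case: XX' => [XX'|mod].
  have [|a a0 X'a] := left_uniq MX MX'; first by rewrite XX'.
  suff a1 : a = hone by rewrite X'a ffunE a1 hmul1l.
  by apply: (@hmulr_inj _ (X e)) => //; rewrite hmul1l [RHS]ee X'a ffunE.
have X'e : X' e <> hzero by rewrite -ee.
have [a [Z [a0 MZ Ze Zi]]] := left_elim MX MX' mod Xe X'e.
have aN : a = hopp hone.
  apply: (@hmulr_inj _ (X e)) => //; rewrite hmulN1.
  have := Zi e; rewrite Ze -ee haddC => /hadd_oppP //.
have ZK i : i \in K -> Z i <> hzero -> i = f.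
  move=> iK Z0; have : i = e \/ i = f.
    case: (hadd_supp (Zi i) Z0) => [aX|/X'K]; last exact.
    by apply: XK => // X0; apply: aX; rewrite X0 hmul0r.
  by case=> // ie; case: Z0; rewrite ie.
have Zf : Z f = hzero.
  apply: contrapT => Zf; have [g [gK Zg gf]] := circuit_vector_meet rF Mr MZ cK Zf fK.
  exact: (gf (ZK g gK Zg)).
by have := Zi f; rewrite Zf aN hmulN1 => /hadd_oppP; rewrite hoppK.
Qed.

(* [B'] is moved towards [B] by basis exchanges, each of which produces a modular pair. *)
Lemma ratio_basis B B' X X' e f : hyp_basis B -> hyp_basis B' -> M X -> M X' ->
  e \in K -> f \in K -> e <> f ->
  hsupp X \subset f |: (e |: B) -> hsupp X' \subset f |: (e |: B') ->
  X e <> hzero -> X e = X' e -> X f = X' f.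
Proof.
move=> hB + MX + eK fK ef XB + Xe +.
have [n] := ubnP #|B' :\: B|; elim: n B' X' => // n IH B' X' nB hB' MX' X'B ee.
have onK D Z : hyp_basis D -> hsupp Z \subset f |: (e |: D) ->
    forall i, i \in K -> Z i <> hzero -> i = e \/ i = f.
  move=> [DK _ _] ZD i iK /hsuppP /(subsetP ZD).
  by case/setU1P => [->|/setU1P[->|/(subsetP DK)]]; try tauto; rewrite inE iK.
have [BK rB cB] := hB; have [B'K rB' cB'] := hB'.
have [/eqP|[x /setDP[xB' xB]]] := set_0Vmem (B' :\: B).
  rewrite setD_eq0 => BB'; have BB : B' = B by apply/eqP; rewrite eqEcard BB'; lia.
  rewrite {}BB in X'B.
  apply: (@ratio_modular X X' e f) => //; try exact: (onK B).
  apply: (same_supp_or_modular MX MX' XB X'B).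
  rewrite (@hyp_basis_rank B _ e) ?subsetUr //.
  by have := card_setU1_le f (e |: B); have := card_setU1_le e B; move: cB; clear; lia.
(* The exchanged basis: [J] is [B'] with [x] replaced by some [y] of [B]. The circuits on e, f with
   [J] and with [B'] lie in {y, f, e} together with [B'], a set of nullity at most 2, so they have
   equal supports or form a modular pair. *)
have [||J [BJ JBB rJ rJB]] := @indep_extend _ r rF (B' :\ x) ((B' :\ x) :|: B).
- by apply: (indep_subset rF (subD1set _ _)).
- exact: subsetUl.
have JK : J \subset ~: K.
  apply: subset_trans JBB _; rewrite subUset BK andbT.
  exact: subset_trans (subD1set _ _) B'K.
have cJ : #|J|.+1 = r [set: E].
  have := rank_mono rF JK; have := rank_mono rF (subsetUr (B' :\ x) B); move: rK rB cB rJ rJB; clear; lia.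
have hJ : hyp_basis J by split.
have [y yJ yB'] : exists2 y, y \in J & y \notin B' :\ x.
  apply/subsetPn/negP => /subset_leq_card; have := cardsD1 x B'; rewrite xB'.
  by move: cJ cB'; clear; lia.
have JE : J = y |: (B' :\ x).
  apply/esym/eqP; rewrite eqEcard subUset sub1set yJ BJ /= cardsU1 yB'.
  by have := cardsD1 x B'; rewrite xB'; move: cJ cB'; clear; lia.
have yB : y \in B by move: (subsetP JBB y yJ); rewrite in_setU (negPf yB').
have yx : y != x by apply/eqP => yx; rewrite -yx yB in xB.
have [X1 [MX1 X1e X1f X1J]] := hyp_basis_circuit hJ eK fK ef.
pose a := hmul (X e) (hinv (X1 e)).
have a0 : a <> hzero by apply: hmul_neq0 => //; apply: hinv_neq0.
pose X2 := lscale a X1; have MX2 : M X2 := left_scale MX1 a0.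
have X2e : X2 e = X e by rewrite ffunE hmulVKr.
have X2J : hsupp X2 \subset f |: (e |: J) by rewrite hsupp_lscale.
have -> : X f = X2 f.
  apply: (IH J) => //.
  apply: leq_trans (_ : #|B' :\: B| <= n) => //; apply: proper_card; apply/properP; split.
    by rewrite JE; apply/subsetP => z; rewrite !inE; case: eqP => [->|_]; rewrite ?yB //= => /and3P[-> _ ->].
  exists x; first by rewrite inE xB.
  by rewrite JE !inE eqxx (eq_sym x) (negPf yx) andbF.
apply: (@ratio_modular X2 X' e f) => //; rewrite ?X2e //; try exact: (onK J); try exact: (onK B').
apply: (@same_supp_or_modular _ _ (y |: (f |: (e |: B')))) => //.
- apply: subset_trans X2J _; rewrite JE; apply/subsetP => z; rewrite !inE.
  by move=> /or4P[->|->|->|/andP[_ ->]]; rewrite ?orbT.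
- exact: subset_trans X'B (subsetUr _ _).
rewrite (@hyp_basis_rank B' _ e) //; last by rewrite setUA subsetUr.
have := card_setU1_le y (f |: (e |: B')); have := card_setU1_le f (e |: B').
by have := card_setU1_le e B'; move: cB'; clear; lia.
Qed.

Lemma circuit_hyp_basis X e : M X -> X e <> hzero -> e \in K ->
  exists2 B, hyp_basis B & hsupp X :\: K \subset B.
Proof.
move=> MX Xe eK; apply: hyp_basis_ext; first by rewrite setDE subsetIr.
have [_ minX] := circuit_vector Mr MX; apply: minX; apply/properP.
split; first exact: subsetDl.
by exists e; [apply/hsuppP | rewrite inE eK].
Qed.

Lemma supp_hyp_basis X B e f : hsupp X :\: K \subset B ->
  (forall i, i \in K -> X i <> hzero -> i = e \/ i = f) -> hsupp X \subset f |: (e |: B).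
Proof.
move=> XB XK; apply/subsetP => i iX; rewrite !in_setU1.
have [iK|iK] := boolP (i \in K).
  by case: (XK i iK (hsuppP _ _ iX)) => ->; rewrite eqxx ?orbT.
by rewrite (subsetP XB) ?orbT // inE iK.
Qed.

Lemma ratio_uniq X X' e f : M X -> M X' -> e \in K -> f \in K -> e <> f ->
  (forall i, i \in K -> X i <> hzero -> i = e \/ i = f) ->
  (forall i, i \in K -> X' i <> hzero -> i = e \/ i = f) ->
  X e <> hzero -> X e = X' e -> X f = X' f.
Proof.
move=> MX MX' eK fK ef XK X'K Xe ee.
have [B hB XB] := circuit_hyp_basis MX Xe eK.
have X'e : X' e <> hzero by rewrite -ee.
have [B' hB' XB'] := circuit_hyp_basis MX' X'e eK.
by apply: (ratio_basis hB hB' MX MX' eK fK ef _ _ Xe ee); apply: supp_hyp_basis.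
Qed.

End Cocircuit.
End Dual.
End LeftMatroid.

(** * Existence of the dual *)

Section DualExistence.
Variables (H : skewHyperfieldType) (E : finType).
Variables (M : set {ffun E -> H}) (hM : left_matroid M).
Variables (r : {set E} -> nat) (rF : rank_fun r) (Mr : hsupps M = circuits_of r).
Implicit Types (X Y Z : {ffun E -> H}) (A B K S T I J : {set E}) (e f g i x y b : E).

Section Cocircuit.
Variables (K : {set E}) (cK : circuits_of (dual_rank r) K) (e0 : E) (e0K : e0 \in K).

Definition meets_in X e f := forall i, i \in K -> X i <> hzero -> i = e \/ i = f.

Lemma meets_inC X e f : meets_in X e f -> meets_in X f e.
Proof. by move=> XK i iK /(XK i iK); tauto. Qed.

(** The value forced by orthogonality to a circuit that meets [K] in [e0] and [f] only, when the
    entry at [e0] is 1. By [ratio_uniq] it does not depend on the circuit. *)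
Definition dual_entry f : H := xget hzero [set y | exists X, [/\ M X, meets_in X e0 f,
  X e0 = hone & hmul (X f) y = hopp hone]]%classic.

Definition dual_vector : {ffun E -> H} :=
  [ffun f => if f == e0 then hone else if f \in K then dual_entry f else hzero].

Lemma meets_in_neq0 X e f : M X -> e \in K -> meets_in X e f -> X e <> hzero -> X f <> hzero.
Proof. by move=> MX eK XK Xe; apply: (circuit_vector_meet2 rF Mr MX cK Xe eK). Qed.

Lemma dual_vector0 : dual_vector e0 = hone.
Proof. by rewrite ffunE eqxx. Qed.

Lemma dual_vectorE X f : M X -> f \in K -> f <> e0 -> meets_in X e0 f -> X e0 <> hzero ->
  hmul (X f) (dual_vector f) = hopp (X e0).
Proof.
move=> MX fK fe XK Xe; rewrite ffunE fK; move/eqP: (fe) => /negPf ->.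
have normal Z : M Z -> meets_in Z e0 f -> Z e0 <> hzero ->
    let Z' := lscale (hinv (Z e0)) Z in [/\ M Z', meets_in Z' e0 f & Z' e0 = hone].
  move=> MZ ZK Ze; split; first by apply: (left_scale hM) => //; apply: hinv_neq0.
    by move=> i iK; rewrite ffunE => Zi; apply: ZK => // Z0; apply: Zi; rewrite Z0 hmul0r.
  by rewrite ffunE hmulVl.
have [MX' X'K X'e] := normal X MX XK Xe; set X' := lscale _ _ in MX' X'K X'e.
have X'f : X' f <> hzero.
  by apply: (meets_in_neq0 MX' e0K X'K); rewrite X'e; apply: hone_neq0.
have X'y : hmul (X' f) (dual_entry f) = hopp hone.
  rewrite /dual_entry; case: xgetP => [y _ [Z [MZ ZK Ze Zf]]|].
    rewrite -Zf; congr hmul; apply: (ratio_uniq hM rF Mr cK MX' MZ e0K fK) => //.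
    - exact/nesym.
    - by rewrite X'e; apply: hone_neq0.
    - by rewrite X'e Ze.
  move=> /(_ (hmul (hinv (X' f)) (hopp hone))) []; exists X'; split=> //.
  by rewrite hmulVKl.
move/(congr1 (hmul (X e0))): X'y; rewrite ffunE hmulrN hmul1r => <-.
by rewrite -hmulA hmulVKl.
Qed.

Lemma dual_vector_supp : hsupp dual_vector = K.
Proof.
apply/setP => f; apply/hsuppP/idP.
  by rewrite ffunE; case: eqP => [->|_] //; case: ifP.
move=> fK; have [->|fe] := pselect (f = e0); first by rewrite dual_vector0; apply: hone_neq0.
have [X [MX Xf XK]] := circuit_vector_pair rF Mr cK e0K fK (nesym fe).
have Xe : X e0 <> hzero by apply: (meets_in_neq0 MX fK (meets_inC XK)).
move=> Y0; have := dual_vectorE MX fK fe XK Xe.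
by rewrite Y0 hmul0r => /(congr1 (@hopp H)); rewrite hoppK hopp0 => /esym.
Qed.

(** If [e0] is neither f nor g, circuits meeting [K] in {e0, f} and in {e0, g} are taken over one
    hyperplane basis that contains [X] off [K]. Eliminating [e0] from them gives a circuit with the
    support of [X], hence a multiple of [X]. *)
Lemma dual_vector_orth2 X f g : M X -> f \in K -> g \in K -> f <> g ->
  meets_in X f g -> X f <> hzero ->
  hmul (X g) (dual_vector g) = hopp (hmul (X f) (dual_vector f)).
Proof.
move=> MX fK gK fg XK Xf.
have Xg : X g <> hzero by apply: (meets_in_neq0 MX fK XK).
have [fe|fe] := pselect (f = e0).
  by subst f; rewrite dual_vector0 hmul1r; apply: dual_vectorE => //; apply/nesym.
have [ge|ge] := pselect (g = e0).
  subst g; rewrite (dual_vectorE MX fK fe (meets_inC XK) Xg).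
  by rewrite dual_vector0 hmul1r hoppK.
have [B hB XB] := circuit_hyp_basis rF Mr cK MX Xf fK.
have XBfg : hsupp X \subset f |: (g |: B).
  by rewrite setUCA; apply: (supp_hyp_basis XB XK).
have [X1 [MX1 X1e X1f X1B]] := hyp_basis_circuit rF Mr cK hB e0K fK (nesym fe).
have [X2 [MX2 X2e X2g X2B]] := hyp_basis_circuit rF Mr cK hB e0K gK (nesym ge).
have [BK rB cB] := hB.
have inB i D : i \in K -> i \in D :|: B -> i \in D.
  by move=> iK /setUP[//|/(subsetP BK)]; rewrite inE iK.
have X1K : meets_in X1 e0 f.
  move=> i iK /hsuppP /(subsetP X1B); rewrite setUA => /(inB _ _ iK).
  by rewrite !inE => /orP[/eqP|/eqP]; tauto.
have X2K : meets_in X2 e0 g.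
  move=> i iK /hsuppP /(subsetP X2B); rewrite setUA => /(inB _ _ iK).
  by rewrite !inE => /orP[/eqP|/eqP]; tauto.
have X1g : X1 g = hzero by apply: contrapT => /(X1K g gK) [|/esym].
have X2f : X2 f = hzero by apply: contrapT => /(X2K f fK) [].
pose A := e0 |: (f |: (g |: B)).
have X1A : hsupp X1 \subset A.
  apply: subset_trans X1B _; rewrite /A [g |: B]setUC setUCA; apply: setUS.
  by apply: setUS; exact: subsetUl.
have X2A : hsupp X2 \subset A.
  by apply: subset_trans X2B _; rewrite /A setUCA; apply: setUS; apply: subsetUr.
have nA : #|A| <= r A + 2.
  rewrite (hyp_basis_rank rF cK hB e0K); last by apply: setUS; rewrite setUA subsetUr.
  have := card_setU1_le e0 (f |: (g |: B)); have := card_setU1_le f (g |: B).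
  by have := card_setU1_le g B; move: cB; clear; rewrite /A; lia.
have [X12|mod] := same_supp_or_modular rF Mr MX1 MX2 X1A X2A nA.
  by case: X1f; apply/hsuppPn; rewrite X12; apply/hsuppPn.
have [a [Z [a0 MZ Ze Zi]]] := left_elim hM MX1 MX2 mod X1e X2e.
have Zf : Z f = hmul a (X1 f) by have := Zi f; rewrite X2f hadd0.
have Zg : Z g = X2 g by have := Zi g; rewrite X1g hmul0r hadd0l.
have ZB : hsupp Z \subset f |: (g |: B).
  apply/subsetP => i iZ; have ie : i <> e0 by move=> ie; move/hsuppP: iZ; rewrite ie.
  have : i \in A.
    case: (hadd_supp (Zi i) (hsuppP _ _ iZ)) => [aX|/hsuppP /(subsetP X2A)//].
    by apply: (subsetP X1A); apply/hsuppP => X0; apply: aX; rewrite X0 hmul0r.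
  by move=> /setU1P[].
have XZ : hsupp Z = hsupp X.
  apply: (same_supp rF Mr MZ MX ZB XBfg).
  rewrite (hyp_basis_rank rF cK hB gK); last exact: subsetUr.
  have := card_setU1_le f (g |: B); have := card_setU1_le g B; move: cB; clear; lia.
have [|c c0 ->] := left_uniq hM MZ MX; first by rewrite XZ.
rewrite !lscaleE -!hmulA -hmulrN; congr hmul.
rewrite Zg Zf -hmulA (dual_vectorE MX2 gK ge X2K X2e) (dual_vectorE MX1 fK fe X1K X1e).
by rewrite hmulrN hoppK; have := Zi e0; rewrite Ze => /hadd_oppP ->; rewrite hoppK.
Qed.

(** [X] is written, up to a factor, as the elimination of a point [b] outside [K] from a circuit
    meeting [K] in {e, f} and one meeting it in {f, g}. Only the entry at f is a proper hypersum,
    and the two-element case turns it into the relation claimed. The basis [T] serves to find a [b]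
    that both circuits contain and [X] avoids. *)
Lemma dual_vector_orth3 X e f g : M X -> e \in K -> f \in K -> g \in K ->
  e <> f -> e <> g -> f <> g -> X e <> hzero -> X f <> hzero -> X g <> hzero ->
  (forall i, i \in K -> X i <> hzero -> [\/ i = e, i = f | i = g]) ->
  hadd (hmul (X e) (dual_vector e)) (hmul (X f) (dual_vector f))
    (hopp (hmul (X g) (dual_vector g))).
Proof.
move=> MX eK fK gK ef eg fg Xe Xf Xg XK; pose I := hsupp X :\: K.
have [B hB XB] := circuit_hyp_basis rF Mr cK MX Xe eK.
have [BK rB cB] := hB.
have BnK i : i \in K -> i \notin B by move=> iK; apply/negP => /(subsetP BK); rewrite inE iK.
have rI : r (e |: (f |: I)) = #|e |: (f |: I)|.
  have [_ minX] := circuit_vector Mr MX; apply: minX; apply/properP; split.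
    by rewrite !subUset !sub1set subsetDl; apply/and3P; split; [apply/hsuppP|apply/hsuppP|].
  exists g; first exact/hsuppP.
  rewrite !inE gK !negb_or /= andbT; apply/andP; split; apply/eqP; exact/nesym.
have [|T [IT TB rT rTE]] := indep_extend rF rI (A := e |: (f |: B)).
  by do 2!apply: setUS.
have eT : e \in T by apply: (subsetP IT); rewrite setU11.
have fT : f \in T by apply: (subsetP IT); rewrite setUCA setU11.
have rTtop : r T = r [set: E].
  rewrite rTE (hyp_basis_rank rF cK hB fK) // subsetUr //.
have [b bB bT] : exists2 b, b \in B & b \notin T.
  apply/subsetPn/negP => BT.
  have : e |: (f |: B) \subset T by rewrite !subUset !sub1set eT fT.
  move=> /subset_leq_card; rewrite !cardsU1 !inE negb_or !BnK //.
  by move/eqP: ef => ->; move: rT rTtop cB; clear; lia.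
have TE : T = (e |: (f |: B)) :\ b.
  apply/eqP; rewrite eqEcard subsetD1 TB bT /=.
  have := card_setU1_le e (f |: B); have := card_setU1_le f B.
  have := cardsD1 b (e |: (f |: B)); rewrite !inE bB !orbT.
  by move: rT rTtop cB; clear; lia.
have [X1 [MX1 X1e X1f X1B]] := hyp_basis_circuit rF Mr cK hB eK fK ef.
have [X2 [MX2 X2f X2g X2B]] := hyp_basis_circuit rF Mr cK hB fK gK fg.
have inB i D : i \in K -> i \in D :|: B -> i \in D.
  by move=> iK /setUP[//|/(subsetP BK)]; rewrite inE iK.
have X1K : meets_in X1 e f.
  move=> i iK /hsuppP /(subsetP X1B); rewrite setUA => /(inB _ _ iK).
  by rewrite !inE => /orP[/eqP|/eqP]; tauto.
have X2K : meets_in X2 f g.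
  move=> i iK /hsuppP /(subsetP X2B); rewrite setUA => /(inB _ _ iK).
  by rewrite !inE => /orP[/eqP|/eqP]; tauto.
have X1g : X1 g = hzero by apply: contrapT => /(X1K g gK) [|] /esym.
have X2e : X2 e = hzero by apply: contrapT => /(X2K e eK) [].
have X1b : X1 b <> hzero.
  move=> /hsuppPn X1b; have : hsupp X1 \subset T.
    by rewrite TE subsetD1 X1b andbT setUCA.
  by move=> /(circuit_indep rF (circuit_vector Mr MX1)); rewrite rT ltnn.
have XT : hsupp X \subset g |: T.
  apply/subsetP => i iX; rewrite in_setU1; have [iK|iK] := boolP (i \in K).
    by case: (XK i iK (hsuppP _ _ iX)) => ->; rewrite ?eT ?fT ?eqxx ?orbT.
  by rewrite (subsetP IT) ?orbT // !in_setU1 in_setD iK iX !orbT.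
have nT : #|g |: T| <= (r (g |: T)).+1.
  have := rank_mono rF (subsetUr [set g] T); have := card_setU1_le g T.
  by move: rT; clear; lia.
have X2b : X2 b <> hzero.
  move=> /hsuppPn X2b; have : hsupp X2 \subset g |: T.
    apply/subsetP => i iX2; have := subsetP X2B i iX2; rewrite TE in_setU1 => /orP[iG|iB].
      by rewrite in_setU1 iG.
    rewrite in_setU1 in_setD1 in_setU1 iB !orbT /= andbT; apply/orP; right.
    by apply/eqP => ib; rewrite ib (negPf X2b) in iX2.
  move=> X2T; have := same_supp rF Mr MX2 MX X2T XT nT => X2X.
  by apply: Xe; apply/hsuppPn; rewrite -X2X; apply/hsuppPn.
pose A := g |: (e |: (f |: B)).
have X1A : hsupp X1 \subset A.
  by apply: subset_trans X1B _; rewrite /A [f |: (e |: B)]setUCA subsetUr.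
have X2A : hsupp X2 \subset A.
  by apply: subset_trans X2B _; rewrite /A; apply: setUS; apply: subsetUr.
have nA : #|A| <= r A + 2.
  rewrite (hyp_basis_rank rF cK hB eK); last first.
    by apply/subsetP => i; rewrite !inE => /orP[->|->]; rewrite ?orbT.
  have := card_setU1_le g (e |: (f |: B)); have := card_setU1_le e (f |: B).
  by have := card_setU1_le f B; move: cB; rewrite /A; clear; lia.
have [X12|mod] := same_supp_or_modular rF Mr MX1 MX2 X1A X2A nA.
  by case: X1e; apply/hsuppPn; rewrite X12; apply/hsuppPn.
have [a [Z [a0 MZ Zb Zi]]] := left_elim hM MX1 MX2 mod X1b X2b.
have Ze : Z e = hmul a (X1 e) by have := Zi e; rewrite X2e hadd0.
have Zg : Z g = X2 g by have := Zi g; rewrite X1g hmul0r hadd0l.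
have ZT : hsupp Z \subset g |: T.
  apply/subsetP => i iZ; have ib : i <> b by move=> ib; move/hsuppP: iZ; rewrite ib.
  have : i \in A.
    case: (hadd_supp (Zi i) (hsuppP _ _ iZ)) => [aX|/hsuppP /(subsetP X2A)//].
    by apply: (subsetP X1A); apply/hsuppP => X0; apply: aX; rewrite X0 hmul0r.
  by rewrite TE /A !in_setU1 in_setD1 !in_setU1; move/eqP: ib => ->.
have XZ : hsupp Z = hsupp X := same_supp rF Mr MZ MX ZT XT nT.
have [|c c0 ->] := left_uniq hM MZ MX; first by rewrite XZ.
rewrite !lscaleE -!hmulA -hmulrN; apply: hadd_mull.
have o1 := dual_vector_orth2 MX1 eK fK ef X1K X1e.
have o2 := dual_vector_orth2 MX2 fK gK fg X2K X2f.
have := hadd_mulr (dual_vector f) (Zi f); rewrite -hmulA o1 hmulrN hmulA -Ze.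
have -> : hmul (X2 f) (dual_vector f) = hopp (hmul (Z g) (dual_vector g)).
  by rewrite Zg o2 hoppK.
by move=> /hadd_rev; rewrite hoppK haddC.
Qed.

Lemma dual_vector_korthogonal X : M X -> #|hsupp X :&: K| <= 3 -> orthogonal X dual_vector.
Proof.
move=> MX c3.
have on i : X i <> hzero -> dual_vector i <> hzero -> i \in hsupp X :&: K.
  by move=> /hsuppP iX /hsuppP; rewrite dual_vector_supp inE iX.
have [X0|[e eXK]] := set_0Vmem (hsupp X :&: K).
  by rewrite /orthogonal -/(hdot _ _) (hdot_on on) X0 big_set0.
have [/hsuppP Xe eK] := setIP eXK.
have [f [fK Xf fe]] := circuit_vector_meet rF Mr MX cK Xe eK.
have fXK : f \in hsupp X :&: K by rewrite inE fK andbT; apply/hsuppP.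
have [sub|] := boolP (hsupp X :&: K \subset [set e; f]).
  have XK i : i \in K -> X i <> hzero -> i = e \/ i = f.
    move=> iK /hsuppP Xi; have := subsetP sub i; rewrite !inE in Xi *; rewrite iK Xi => /(_ isT).
    by move=> /orP[/eqP|/eqP]; tauto.
  apply/(@orthogonal2 _ _ _ _ e f); first exact/nesym.
    by move=> i Xi Yi; have /setIP[_ iK] := on i Xi Yi; apply: XK.
  by apply: dual_vector_orth2 => //; exact/nesym.
move=> /subsetPn[g gXK gef]; have [/hsuppP Xg gK] := setIP gXK.
move: gef; rewrite !inE negb_or => /andP[/eqP ge /eqP gf].
have XKE : e |: [set f; g] = hsupp X :&: K.
  apply/eqP; rewrite eqEcard !subUset !sub1set eXK fXK gXK /=.
  have eg : e \notin [set f; g] by rewrite !inE negb_or; apply/andP; split; apply/eqP/nesym.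
  by rewrite cardsU1 eg cards2 (_ : f != g) //; apply/eqP/nesym.
have XK i : i \in hsupp X :&: K -> [\/ i = e, i = f | i = g].
  by rewrite -XKE !inE => /or3P[] /eqP ->; [constructor 1|constructor 2|constructor 3].
apply/(@orthogonal3 _ _ _ _ e f g); try exact/nesym.
  by move=> i Xi Yi; apply/XK/on.
apply: dual_vector_orth3 => //; try exact/nesym.
by move=> i iK Xi; apply: XK; rewrite inE iK andbT; apply/hsuppP.
Qed.

End Cocircuit.

(** A definition by orthogonality, since [dual_vector] depends on the element at which it is
    normalised. Closure under scaling then comes from orthogonality, and [dual_vector] supplies the
    existence. *)
Definition dual_circuits : set {ffun E -> H} :=
  [set Y | circuits_of (dual_rank r) (hsupp Y) /\
     forall X, M X -> #|hsupp X :&: hsupp Y| <= 3 -> orthogonal X Y]%classic.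

Lemma orthogonal_rscale X Y a : orthogonal X Y -> orthogonal X (rscale a Y).
Proof.
move=> XY; rewrite /orthogonal.
under eq_bigr => i _ do rewrite ffunE hmulA -(image_set1 (fun z => hmul z a)).
by rewrite -hsum_mulr; exists hzero; rewrite ?hmul0l.
Qed.

Lemma dual_circuits_pair : dual_pair r M dual_circuits.
Proof.
have kor : korthogonal 3 M dual_circuits by move=> X Y MX [_]; apply.
split=> //.
- apply/seteqP; split=> [_ [Y [cY _] <-] //|K cK].
  have [K0|[e eK]] := set_0Vmem K.
    by case: cK => + _; rewrite K0 cards0.
  exists (dual_vector K e); last exact: dual_vector_supp.
  split; rewrite dual_vector_supp // => X; exact: dual_vector_korthogonal.
- exact: left_scale hM.
- move=> Y a [cY oY] a0; split; rewrite hsupp_rscale // => X MX XY.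
  by apply: orthogonal_rscale; apply: oY.
- exact: left_uniq hM.
- move=> Y Y' DY DY' YY'; have [cY _] := DY; have [cY' _] := DY'.
  apply: (cocircuit_vector_uniq rF Mr kor kor DY DY' cY).
  by apply/esym/(circuit_sub cY cY').
Qed.

End DualExistence.

Lemma dual_pair_ex (H : skewHyperfieldType) (E : finType)
    (M : set {ffun E -> H}) :
  left_matroid M -> exists r D, dual_pair r M D.
Proof.
move=> hM; have [r [rF Mr]] := left_matroid_rank hM.
by exists r, (dual_circuits M r); apply: dual_circuits_pair.
Qed.

(** * Orthogonality of circuits and cocircuits *)

Section Orthogonality.
Variables (H : skewHyperfieldType) (HS : stringent H) (E : finType) (r : {set E} -> nat).
Variables (C D : set {ffun E -> H}) (CD : dual_pair r C D).
Implicit Types (X Y U : {ffun E -> H}) (B G I J K T : {set E}) (b e f g h i j k : E).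

(** The cocircuits [W g] of the dual line through [Y] vanish on [I], the part of [X] off [K], and at
    [g]. So [W g], for [g] in [J], meets [X] in a proper subset of [J], the induction applies to it,
    and [line] combines these relations. *)
Lemma dp_orthogonal X Y : C X -> D Y -> orthogonal X Y.
Proof.
have kor := dp_orth CD; have rF := dp_rank CD; have Cr := dp_circuits CD.
move=> CX; have [n] := ubnP #|hsupp X :&: hsupp Y|; elim: n Y => // n IH Y nXY DY.
have [|big] := leqP #|hsupp X :&: hsupp Y| 3; first exact: kor.
have cK := dp_cocircuit CD DY; set K := hsupp Y in nXY big cK.
pose J := hsupp X :&: K; pose I := hsupp X :\: K; have cJ : 3 < #|J| := big.
have [f1 f1J] : exists f1, f1 \in J by apply/set0Pn; rewrite -card_gt0; apply: leq_trans cJ.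
have [f2 /setD1P[/eqP f21 f2J]] : exists f2, f2 \in J :\ f1.
  by apply/set0Pn; rewrite -card_gt0; move: cJ; rewrite (cardsD1 f1) f1J; clear; lia.
have [f3 /setD1P[/eqP f32 /setD1P[/eqP f31 f3J]]] : exists f3, f3 \in (J :\ f1) :\ f2.
  apply/set0Pn; rewrite -card_gt0; move: cJ; rewrite (cardsD1 f1) f1J (cardsD1 f2).
  by rewrite in_setD1 f2J (introN eqP f21); clear; lia.
have [f1X f1K] := setIP f1J; have [f2X f2K] := setIP f2J; have [f3X f3K] := setIP f3J.
have [B hB IB] := circuit_hyp_basis rF Cr cK CX (hsuppP _ _ f1X) f1K.
have [BK rB cB] := hB.
have BnK i : i \in K -> i \notin B by move=> iK; apply/negP => /(subsetP BK); rewrite in_setC iK.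
have rI : r (f1 |: (f2 |: I)) = #|f1 |: (f2 |: I)|.
  have [_ minX] := circuit_vector Cr CX; apply: minX; apply/properP; split.
    by rewrite !subUset !sub1set subsetDl f1X f2X.
  exists f3 => //; rewrite !in_setU1 in_setD f3K !negb_or /= andbT.
  by apply/andP; split; apply/eqP.
(* [f3] keeps {f1, f2} with [I] a proper part of the circuit, hence independent. The basis [T]
   through it misses some [b] of [B]; dropping [b] from [B] leaves a set that contains [I] and still
   spans together with [f1] and [f2]. *)
have [|T [IT TB rT rTE]] := indep_extend rF rI (A := f1 |: (f2 |: B)).
  by do 2!apply: setUS.
have f1T : f1 \in T by apply: (subsetP IT); rewrite setU11.
have f2T : f2 \in T by apply: (subsetP IT); rewrite setUCA setU11.
have rTtop : r T = r [set: E].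
  by rewrite rTE (hyp_basis_rank rF cK hB f2K) // subsetUr.
have [b bB bT] : exists2 b, b \in B & b \notin T.
  apply/subsetPn/negP => BT.
  have : f1 |: (f2 |: B) \subset T by rewrite !subUset !sub1set f1T f2T.
  move=> /subset_leq_card; rewrite !cardsU1 !in_setU1 negb_or !BnK //.
  by move/nesym/eqP: f21 => ->; move: rT rTtop cB; clear; lia.
pose G := B :\ b.
have IG : I \subset G.
  rewrite subsetD1 IB; apply: contra bT => bI; apply: (subsetP IT).
  by rewrite !in_setU1 bI !orbT.
have TG : T \subset f1 |: (f2 |: G).
  apply/subsetP => i iT; have := subsetP TB i iT; rewrite !in_setU1 in_setD1.
  by rewrite (_ : i != b) //; apply: contra bT => /eqP <-.
have bG : b |: G = B by rewrite setD1K.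
have bK i : i \in K -> b <> i by move=> iK ib; have := BnK i iK; rewrite -ib bB.
(* The hyperplane of this cocircuit is spanned by [g] and [G]. For [g] outside [K] the witness is a
   dummy. *)
have Yg_ex g : exists Yg, g \in K ->
    [/\ D Yg, Yg b = hone & forall i, i \in g |: G -> Yg i = hzero].
  have [gK|gK] := boolP (g \in K); last by exists Y.
  have [|Kg cKg dis] := cocircuit_avoiding rF (A := g |: G).
    have := rank_le_card rF (g |: G); have := card_setU1_le g G.
    by have := cardsD1 b B; rewrite bB -/G; move: cB; clear; lia.
  have [Z DZ ZK] := dp_cocircuit_ex CD cKg.
  have Z0 i : i \in g |: G -> Z i = hzero.
    move=> iG; apply/hsuppPn; rewrite ZK; apply/negP => iK.
    by move/pred0P: dis => /(_ i) /=; rewrite iK iG.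
  have Zb : Z b <> hzero.
    apply/hsuppP; rewrite ZK; apply: contraT => bKg.
    have := (cocircuitP rF Kg).1 cKg => -[+ _].
    have sub : g |: B \subset ~: Kg.
      rewrite -bG setUCA subUset sub1set in_setC bKg -disjoints_subset disjoint_sym.
      by [].
    by rewrite (hyp_basis_rank rF cK hB gK sub) ltnn.
  exists (rscale (hinv (Z b)) Z) => _; split.
  - by apply: dp_rscale CD _ _ DZ _; apply: hinv_neq0.
  - by rewrite rscaleE hmulVr.
  - by move=> i /Z0; rewrite rscaleE => ->; rewrite hmul0l.
have [W WP] := choice Yg_ex.
have Y0 i : i \in K -> Y i <> hzero by move/hsuppP.
(* Over a skew field, [W g] would be V + Y x_g for a fixed V and a scalar x_g. As it vanishes at
   [g], the quotient [c g h] would be x_g - x_h. *)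
pose c g h := hmul (hinv (Y h)) (W g h); pose a h := hmul (X h) (Y h).
have ac g h : h \in K -> hmul (a h) (c g h) = hmul (X h) (W g h).
  by move=> hK; rewrite -hmulA hmulVKl //; apply: Y0.
have Uex g h : g \in K -> h \in K -> g <> h -> exists U,
   [/\ U h <> hzero, hmul (U g) (Y g) = hopp (hmul (U h) (Y h)),
       hmul (hmul (U h) (Y h)) (c g h) = hopp (U b) &
       forall i, i \in K -> hadd (hmul (U g) (W i g)) (U b) (hopp (hmul (U h) (W i h)))].
  move=> gK hK gh; have [U [CU Ug Uh Us]] := hyp_basis_circuit rF Cr cK hB gK hK gh.
  have Us' i : U i <> hzero -> [\/ i = g, i = b, i = h | i \in G].
    move=> /hsuppP /(subsetP Us); rewrite -bG => /setU1P[->|/setU1P[->|/setU1P[->|iG]]].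
    - by constructor 3.
    - by constructor 1.
    - by constructor 2.
    - by constructor 4.
  have GK i : i \in b |: G -> Y i = hzero.
    rewrite bG => iB; apply/hsuppPn; apply/negP => iK.
    by have := BnK i iK; rewrite iB.
  exists U; split=> //.
  - apply: (korthogonal2 kor CU DY (nesym gh)) => i /Us'[->|->|->|iG]; try tauto.
      by rewrite GK ?setU11.
    by rewrite GK // in_setU1 iG orbT.
  - have [DW Wb W0] := WP g gK.
    rewrite -hmulA hmulVKl; last exact: Y0.
    rewrite (korthogonal2 kor CU DW (bK h hK)) ?Wb ?hmul1r // => i /Us'[->|->|->|iG]; try tauto.
      by rewrite W0 ?setU11.
    by rewrite W0 // in_setU1 iG orbT.
  - move=> i iK; have [DW Wb W0] := WP i iK.
    have := @korthogonal3 _ _ _ _ kor U (W i) g b h CU DW (nesym (bK g gK)) gh (bK h hK).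
    rewrite Wb hmul1r; apply=> j /Us'[->|->|->|jG] Wj; try (by constructor).
    by case: Wj; rewrite W0 // in_setU1 jG orbT.
have cii i : i \in J -> c i i = hzero.
  by move=> /setIP[_ iK]; have [_ _ W0] := WP i iK; rewrite /c W0 ?setU11 ?hmul0r.
have cD i j k : i \in J -> j \in J -> k \in J -> hadd (c i k) (c k j) (c i j).
  move=> /setIP[_ iK] jJ kJ; have [->|kj] := pselect (k = j).
    by rewrite (cii j jJ) hadd0.
  have [_ kK] := setIP kJ; have [_ jK] := setIP jJ.
  have [U [Uj Ukj ckj /(_ i iK)]] := Uex k j kK jK kj.
  have u0 : hmul (U j) (Y j) <> hzero by apply: hmul_neq0 => //; apply: Y0.
  have E1 : hmul (U k) (W i k) = hopp (hmul (hmul (U j) (Y j)) (c i k)).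
    by rewrite -hmulNl -Ukj /c -hmulA hmulVKl //; apply: Y0.
  have E2 : U b = hopp (hmul (hmul (U j) (Y j)) (c k j)) by rewrite ckj hoppK.
  have E3 : hmul (U j) (W i j) = hmul (hmul (U j) (Y j)) (c i j).
    by rewrite /c -hmulA hmulVKl //; apply: Y0.
  rewrite E1 E2 E3 => /haddN; rewrite !hoppK => /(hadd_mull (hinv (hmul (U j) (Y j)))).
  by rewrite !hmulKl.
have cN i j : i \in J -> j \in J -> c j i = hopp (c i j).
  by move=> iJ jJ; apply: hadd_oppP; have := cD i i j iJ iJ jJ; rewrite cii.
rewrite /orthogonal (_ : (\big[_/_]_(i : E) _)%classic =
  (\big[@hsetadd H/[set hzero]]_(i in J) [set a i])%classic).
  apply: (@line H HS E J a c) => //.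
    (* If [W f1] vanished at [f2], the complement of its support would contain the spanning set
       [T]. *)
    exists f1, f2; split=> //; apply: hmul_neq0; first by apply/hinv_neq0/Y0.
    have [DW Wb W0] := WP f1 f1K; have cW := dp_cocircuit CD DW.
    apply/hsuppP; apply: contraT => f2W.
    have [+ _] := (cocircuitP rF _).1 cW; rewrite -rTtop ltnNge => /negP[].
    apply: rank_mono => //; apply: subset_trans TG _; rewrite setUCA subUset sub1set in_setC f2W /=.
    by apply/subsetP => i /W0 /hsuppPn; rewrite in_setC.
  move=> i iJ; have [iX iK] := setIP iJ; have [DW Wb W0] := WP i iK.
  have onJ j : X j <> hzero -> W i j <> hzero -> j \in J.
    move=> /hsuppP jX Wj; rewrite in_setI jX; apply: contraT => jK; case: Wj.
    by apply: W0; rewrite in_setU1 (subsetP IG) ?orbT // in_setD jK.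
  have -> : (\big[@hsetadd H/[set hzero]]_(j in J) [set hmul (a j) (c i j)])%classic =
       hdot X (W i).
    by rewrite (hdot_on onJ); apply: eq_bigr => j /setIP[_ jK]; rewrite ac.
  apply: IH => //; apply: leq_trans (_ : #|J| <= n) => //; apply: proper_card.
  apply/properP; split; first by apply/subsetP => j /setIP[/hsuppP jX /hsuppP]; apply: onJ.
  by exists i => //; rewrite in_setI negb_and; apply/orP; right; apply/hsuppPn; apply: W0; rewrite setU11.
rewrite -/(hdot X Y) (@hdot_on _ _ J) // => i /hsuppP iX /hsuppP iY.
by rewrite in_setI iX.
Qed.

End Orthogonality.

(** * Minors *)

Section MinorRank.
Variables (E : finType) (e : E).
Notation E' := {i : E | i != e}.
Implicit Types (A B : {set E'}) (S T : {set E}) (r : {set E} -> nat).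

Definition emb A : {set E} := val @: A.

Lemma embP i S : (i \in S) -> i != e -> exists2 j : E', val j \in S & val j = i.
Proof. by move=> iS ie; exists (Sub i ie); rewrite SubK. Qed.

Lemma mem_emb A (i : E') : (val i \in emb A) = (i \in A).
Proof. by rewrite mem_imset //; apply: val_inj. Qed.

Lemma emb_notin A : e \notin emb A.
Proof. by apply/imsetP => -[[i ie] _ /= ei]; rewrite ei eqxx in ie. Qed.

Lemma emb_preim S : e \notin S -> emb [set i | val i \in S] = S.
Proof.
move=> eS; apply/setP => i; apply/imsetP/idP => [[j + ->]|iS]; first by rewrite inE.
have [|j jS ji] := embP iS; first by apply: contraNneq eS => <-.
by exists j; rewrite // inE.
Qed.

Lemma card_emb A : #|emb A| = #|A|.
Proof. by rewrite card_imset //; apply: val_inj. Qed.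

Lemma emb_sub A B : (emb A \subset emb B) = (A \subset B).
Proof.
apply/idP/idP => [AB|]; last exact: imsetS.
by apply/subsetP => i; rewrite -!mem_emb; apply: (subsetP AB).
Qed.

Lemma emb_inj : injective emb.
Proof. by move=> A B AB; apply/eqP; rewrite eqEsubset -!emb_sub AB subxx. Qed.

Lemma embU A B : emb (A :|: B) = emb A :|: emb B.
Proof. exact: imsetU. Qed.

Lemma embI A B : emb (A :&: B) = emb A :&: emb B.
Proof. by apply: imsetI => i j _ _; apply: val_inj. Qed.

Lemma setC_emb A : ~: emb A = e |: emb (~: A).
Proof.
apply/setP => i; rewrite inE in_setU1; case: (eqVneq i e) => [->|ie] /=.
  by rewrite emb_notin.
have [j _ <-] := @embP i setT (in_setT _) ie.
by rewrite !mem_emb inE.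
Qed.

Lemma setC_setU1_emb A : ~: (e |: emb A) = emb (~: A).
Proof.
by rewrite -[in RHS](setU1K (emb_notin (~: A))) -setC_emb setDE setCU setIC.
Qed.

Definition del_rank r A := r (emb A).
Definition con_rank r A := r (e |: emb A) - r [set e].

Section RankFun.
Variables (r : {set E} -> nat) (rF : rank_fun r).

Lemma del_rank_fun : rank_fun (del_rank r).
Proof.
rewrite /del_rank; split=> [A|A B AB|A B].
- by rewrite -card_emb rank_le_card.
- by apply: rank_mono rF _ _ _; rewrite emb_sub.
- by rewrite embU embI rank_submod.
Qed.

Lemma con_rankE A : con_rank r A + r [set e] = r (e |: emb A).
Proof. by rewrite /con_rank subnK // rank_mono // subsetUl. Qed.

Lemma con_rank_fun : rank_fun (con_rank r).
Proof.
split=> [A|A B AB|A B].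
- have := rank_setU rF [set e] (emb A); rewrite -con_rankE card_emb.
  by clear; lia.
- rewrite -(leq_add2r (r [set e])) !con_rankE; apply: rank_mono rF _ _ _.
  by apply: setUS; rewrite emb_sub.
- rewrite -(leq_add2r (r [set e] + r [set e])) addnACA [leqRHS]addnACA !con_rankE.
  by rewrite embU embI setUUr setUIr rank_submod.
Qed.

Lemma setT_emb : [set: E] = e |: emb setT.
Proof. by rewrite -[X in emb X]setC0 -setC_emb /emb imset0 setC0. Qed.

Lemma dual_del_rank : dual_rank (del_rank r) = con_rank (dual_rank r).
Proof.
apply/funext => A; apply/eqP; rewrite -(eqn_add2r (del_rank r setT)).
rewrite (dual_rankE del_rank_fun) -(eqn_add2r (dual_rank r [set e] + r setT)).
have rF' := dual_rank_fun rF.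
have con : con_rank (dual_rank r) A + dual_rank r [set e] = dual_rank r (e |: emb A).
  by rewrite /con_rank subnK // (rank_mono rF') // subsetUl.
have := dual_rankE rF (e |: emb A); have := dual_rankE rF [set e].
rewrite setC_setU1_emb cardsU1 emb_notin cards1 card_emb.
have -> : ~: [set e] = emb setT.
  by rewrite -[emb _](setU1K (emb_notin _)) -setT_emb setTD.
by move: con; rewrite /del_rank; clear; lia.
Qed.

Lemma dual_con_rank : dual_rank (con_rank r) = del_rank (dual_rank r).
Proof.
apply/funext => A; have := dual_rankE con_rank_fun A; have := dual_rankE rF (emb A).
have := con_rankE setT; have := con_rankE (~: A).
by rewrite -setT_emb setC_emb card_emb /del_rank; clear; lia.
Qed.

Lemma circuit_del A : circuits_of (del_rank r) A <-> circuits_of r (emb A).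
Proof.
split=> -[dA minA]; split; rewrite /del_rank ?card_emb // -?card_emb //.
  move=> T /properP[TA [_ /imsetP[j jA ->] jT]].
  have eT : e \notin T by apply/negP => /(subsetP TA); apply/negP/emb_notin.
  rewrite -(emb_preim eT) card_emb; apply: minA; apply/properP.
  by rewrite -emb_sub emb_preim //; split=> //; exists j; rewrite ?inE.
by move=> B BA; rewrite -card_emb; apply: minA; rewrite properE !emb_sub -properE.
Qed.

Lemma con_rank_circuit A S : circuits_of r S -> A != set0 -> S :\ e = emb A ->
  con_rank r A < #|A|.
Proof.
move=> cS A0 SA; have cS' := circuit_rank rF cS; have := con_rankE A.
rewrite -card_emb -SA; have := cardsD1 e S; have [eS|eS] := boolP (e \in S).
  rewrite setD1K // => cSe; have := cS => -[_ minS].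
  have -> : r [set e] = 1.
    rewrite minS ?cards1 // properE sub1set eS /=; apply: contra A0 => Se.
    have /eqP : S :\ e = set0 by apply/eqP; rewrite setD_eq0.
    by rewrite SA -cards_eq0 card_emb cards_eq0.
  by move: cS' cSe; clear; lia.
have := rank_submod rF S [set e]; rewrite [S :|: _]setUC.
have -> : S :\ e = S by apply/setDidPl; rewrite disjoint_sym disjoints1.
by move: cS'; clear; lia.
Qed.

Lemma con_circuit_min A B : circuits_of (con_rank r) A -> B \subset A ->
  con_rank r B < #|B| -> B = A.
Proof.
move=> [_ minA] BA dB; apply/eqP; apply: contraT => neq.
by rewrite minA ?ltnn // in dB; rewrite properEneq neq.
Qed.

(** A circuit S other than {e} inside [A] plus [e] suffices: S minus [e] is dependent in the
    contraction, so by minimality it is all of [A]. If [A] is independent in the original matroid,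
    [e] is not a loop, which excludes S = {e}. *)
Lemma circuit_con_ex A : circuits_of (con_rank r) A ->
  exists2 S, circuits_of r S & S :\ e = emb A.
Proof.
move=> cA; have conA := con_rankE A; have [dA _] := cA.
suff [S cS [B [SB BA B0]]] : exists2 S, circuits_of r S &
    exists B, [/\ S :\ e = emb B, B \subset A & B != set0].
  exists S => //; rewrite SB; congr emb; apply: (con_circuit_min cA BA).
  exact: con_rank_circuit cS B0 SB.
have pre S : S \subset e |: emb A -> exists B, S :\ e = emb B /\ B \subset A.
  move=> SA; have eS : e \notin S :\ e by rewrite !inE eqxx.
  exists [set i | val i \in S :\ e]; rewrite emb_preim //; split=> //.
  by rewrite -emb_sub emb_preim // subDset.
have nonempty S B : circuits_of r S -> S :\ e = emb B -> S <> [set e] -> B != set0.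
  move=> cS SB Se; apply: contraPneq Se => B0; move: SB; rewrite B0 /emb imset0 => /eqP.
  rewrite setD_eq0 subset1 => /orP[/eqP|/eqP S0]; first by rewrite notK.
  by have := circuit_rank rF cS; rewrite S0 cards0.
have [dT|iT] := ltnP (r (emb A)) #|emb A|.
  have [S cS SA] := dep_circuit rF dT.
  have [|B [SB BA]] := pre S; first by apply: subset_trans SA (subsetUr _ _).
  exists S => //; exists B; split=> //; apply: (nonempty _ _ cS SB) => Se.
  by have := emb_notin A; rewrite (subsetP SA) // Se set11.
have rT : r (emb A) = #|emb A| by have := rank_le_card rF (emb A); move: iT; clear; lia.
have re : 0 < r [set e].
  have := rank_mono rF (subsetUr [set e] (emb A)).
  by move: conA dA rT; rewrite card_emb; clear; lia.
have [|S cS SA] := @dep_circuit _ _ rF (e |: emb A).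
  rewrite cardsU1 emb_notin card_emb.
  have := rank_le_card rF [set e]; rewrite cards1.
  by move: conA dA; clear; lia.
have [B [SB BA]] := pre S SA; exists S => //; exists B; split=> //.
apply: (nonempty _ _ cS SB) => Se.
by have := circuit_rank rF cS; rewrite Se cards1; move: re; clear; lia.
Qed.

End RankFun.
End MinorRank.

Section MinorCircuits.
Variables (H : skewHyperfieldType) (E : finType) (e : E) (r : {set E} -> nat).
Variables (rF : rank_fun r) (C : set {ffun E -> H}).
Hypothesis Cr : hsupps C = circuits_of r.
Notation E' := {i : E | i != e}.
Implicit Types (X Y : {ffun E -> H}) (a : H) (A : {set E'}).

Lemma restrE X i : restr e X i = X (val i). Proof. exact: ffunE. Qed.

Lemma hsupp_restr X : emb (hsupp (restr e X)) = hsupp X :\ e.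
Proof.
apply/setP => i; rewrite in_setD1; have [->|ie] /= := eqVneq i e.
  exact/negbTE/emb_notin.
have [j _ <-] := @embP _ e i setT (in_setT _) ie.
by rewrite mem_emb !inE restrE.
Qed.

Lemma hsupp_restr0 X : X e = hzero -> emb (hsupp (restr e X)) = hsupp X.
Proof.
move=> Xe; rewrite hsupp_restr; apply/setDidPl; rewrite disjoint_sym disjoints1.
exact/hsuppPn.
Qed.

Lemma hsupp_eq0 (I : finType) (X : {ffun I -> H}) : hsupp X = set0 <-> X = hvec0 H I.
Proof.
split=> [X0|->]; last by apply/setP => i; rewrite !inE ffunE eqxx.
by apply/ffunP => i; rewrite ffunE; apply/hsuppPn; rewrite X0 inE.
Qed.

Lemma hsupps_deletion : hsupps (deletion e C) = circuits_of (del_rank r).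
Proof.
apply/seteqP; split=> [_ [_ [X [CX Xe] <-] <-]|A /circuit_del].
  by apply/circuit_del; rewrite hsupp_restr0 //; rewrite -Cr; exists X.
rewrite -Cr => -[X CX XA]; have Xe : X e = hzero.
  by apply/hsuppPn; rewrite XA emb_notin.
by exists (restr e X); [exists X | apply: emb_inj; rewrite hsupp_restr0].
Qed.

Lemma con_circuit_vector A : circuits_of (con_rank r) A ->
  exists2 X, C X & hsupp (restr e X) = A.
Proof.
move=> /(circuit_con_ex rF)[S]; rewrite -Cr => -[X CX <-] XA.
by exists X => //; apply: emb_inj; rewrite hsupp_restr.
Qed.

Lemma con_restr_dep X : C X -> restr e X <> hvec0 H _ ->
  con_rank r (hsupp (restr e X)) < #|hsupp (restr e X)|.
Proof.
move=> CX X0; apply: (con_rank_circuit rF (S := hsupp X)).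
- by rewrite -Cr; exists X.
- by apply/eqP => /hsupp_eq0.
- by rewrite hsupp_restr.
Qed.

Lemma hsupps_contraction : hsupps (contraction e C) = circuits_of (con_rank r).
Proof.
apply/seteqP; split=> [_ [_ [[X CX <-] X0 minX] <-]|A cA].
  have [A cA AX] := dep_circuit (con_rank_fun e rF) (con_restr_dep CX X0).
  have [Z CZ ZA] := con_circuit_vector cA.
  rewrite -(minX (restr e Z)) ?ZA //; first by exists Z.
  by move=> /hsupp_eq0; rewrite ZA => A0; case: cA => + _; rewrite A0 cards0.
have [X CX XA] := con_circuit_vector cA; exists (restr e X) => //; split.
- by exists X.
- by move=> /hsupp_eq0; rewrite XA => A0; case: cA => + _; rewrite A0 cards0.
- move=> _ [Z CZ <-] Z0; rewrite XA => ZA; apply: (con_circuit_min cA ZA).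
  exact: con_restr_dep.
Qed.

(** * Scaling in minors, for the left action on circuits and the right action on cocircuits alike *)

Section Scale.
Variables (sc : forall I : finType, H -> {ffun I -> H} -> {ffun I -> H}).
Hypotheses (sc_restr : forall a X, restr e (sc a X) = sc a (restr e X))
  (sc_supp : forall (I : finType) a (X : {ffun I -> H}), a <> hzero -> hsupp (sc a X) = hsupp X)
  (sc0 : forall a X, X e = hzero -> sc a X e = hzero)
  (C_sc : forall X a, C X -> a <> hzero -> C (sc a X))
  (C_sub : forall X X', C X -> C X' -> hsupp X \subset hsupp X' ->
    exists2 a, a <> hzero & X' = sc a X).

Lemma deletion_scale Z a : deletion e C Z -> a <> hzero -> deletion e C (sc a Z).
Proof.
by move=> [X [CX Xe] <-] a0; exists (sc a X); [split; [exact: C_sc | exact: sc0] | ].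
Qed.

Lemma contraction_scale Z a : contraction e C Z -> a <> hzero -> contraction e C (sc a Z).
Proof.
move=> [[X CX <-] X0 minX] a0; split.
- by exists (sc a X); [exact: C_sc | ].
- by move=> /hsupp_eq0; rewrite sc_supp // => /hsupp_eq0.
- by rewrite sc_supp.
Qed.

Lemma deletion_sub Z Z' : deletion e C Z -> deletion e C Z' -> hsupp Z \subset hsupp Z' ->
  exists2 a, a <> hzero & Z' = sc a Z.
Proof.
move=> [X [CX Xe] <-] [X' [CX' X'e] <-]; rewrite -emb_sub !hsupp_restr0 //.
by move=> /(C_sub CX CX')[a a0 ->]; exists a.
Qed.

(** By minimality the supports of the lifts agree off [e]. One then contains the other, and an
    inclusion of circuits is an equality, so scaling can be compared before restriction. *)
Lemma contraction_sub Z Z' : contraction e C Z -> contraction e C Z' ->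
  hsupp Z \subset hsupp Z' -> exists2 a, a <> hzero & Z' = sc a Z.
Proof.
move=> [[X CX <-] X0 _] [[X' CX' <-] _ minX'] XX'.
have {}XX' : hsupp X :\ e = hsupp X' :\ e.
  by rewrite -!hsupp_restr (minX' (restr e X)) //; exists X.
suff /(C_sub CX CX')[a a0 ->] : hsupp X \subset hsupp X' by exists a.
have cir Y : C Y -> circuits_of r (hsupp Y) by move=> CY; rewrite -Cr; exists Y.
have [eX'|eX'] := boolP (e \in hsupp X').
  by rewrite -(setD1K eX') -XX' -subDset.
have X'X : hsupp X' \subset hsupp X.
  have <- : hsupp X' :\ e = hsupp X'.
    by apply/setDidPl; rewrite disjoint_sym disjoints1.
  by rewrite -XX' subD1set.
by rewrite (circuit_sub (cir _ CX') (cir _ CX) X'X).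
Qed.
End Scale.
End MinorCircuits.

(** * Minors of dual pairs *)

Section MinorPairs.
Variables (H : skewHyperfieldType) (E : finType) (e : E) (r : {set E} -> nat).
Variables (C D : set {ffun E -> H}) (CD : dual_pair r C D).
Hypothesis ortho : forall X Y, C X -> D Y -> orthogonal X Y.
Implicit Types (X Y : {ffun E -> H}) (a : H).

Lemma restr_lscale a X : restr e (lscale a X) = lscale a (restr e X).
Proof. by apply/ffunP => i; rewrite !(restrE, lscaleE). Qed.

Lemma restr_rscale a X : restr e (rscale a X) = rscale a (restr e X).
Proof. by apply/ffunP => i; rewrite !(restrE, rscaleE). Qed.

Lemma lscale0 a X : X e = hzero -> lscale a X e = hzero.
Proof. by move=> Xe; rewrite lscaleE Xe hmul0r. Qed.

Lemma rscale0 a X : X e = hzero -> rscale a X e = hzero.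
Proof. by move=> Xe; rewrite rscaleE Xe hmul0l. Qed.

Lemma hdot_restr X Y : hdot X Y =
  hsetadd [set hmul (X e) (Y e)]%classic (hdot (restr e X) (restr e Y)).
Proof.
rewrite /hdot (bigD1 e) //=; congr hsetadd.
rewrite (big_sub (fun i => i != e)) /=.
by apply: eq_bigr => i _; rewrite !restrE.
Qed.

Lemma hdot_restr0 X Y : X e = hzero \/ Y e = hzero ->
  hdot X Y = hdot (restr e X) (restr e Y).
Proof.
by rewrite hdot_restr => -[->|->]; rewrite ?hmul0l ?hmul0r hsetadd0l.
Qed.

Lemma deletion_contraction_orth Z W : deletion e C Z -> contraction e D W -> orthogonal Z W.
Proof.
move=> [X' [CX X'e] <-] [[Y' DY <-] _ _]; rewrite /orthogonal -/(hdot _ _).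
by rewrite -hdot_restr0; [apply: ortho | left].
Qed.

Lemma contraction_deletion_orth Z W : contraction e C Z -> deletion e D W -> orthogonal Z W.
Proof.
move=> [[X' CX <-] _ _] [Y' [DY Y'e] <-]; rewrite /orthogonal -/(hdot _ _).
by rewrite -hdot_restr0; [apply: ortho | right].
Qed.

Lemma dual_pair_deletion : dual_pair (del_rank r) (deletion e C) (contraction e D).
Proof.
have rF := dp_rank CD; split.
- exact: del_rank_fun.
- exact: hsupps_deletion (dp_circuits CD).
- by rewrite dual_del_rank //; apply: hsupps_contraction (dp_cocircuits CD); apply: dual_rank_fun.
- move=> Z a; apply: (deletion_scale (sc := @lscale H)); [exact: restr_lscale|exact: lscale0|exact: dp_lscale CD].
- move=> Z a; apply: (contraction_scale (sc := @rscale H)); [exact: restr_rscale| |exact: dp_rscale CD].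
  by move=> I b X; apply: hsupp_rscale.
- move=> Z Z'; apply: (deletion_sub (sc := @lscale H)); [exact: restr_lscale|exact: dp_lsub CD].
- move=> Z Z'; apply: (contraction_sub (dp_cocircuits CD) (sc := @rscale H)); [exact: restr_rscale|exact: dp_rsub CD].
- by move=> Z W CZ DW _; apply: deletion_contraction_orth.
Qed.

Lemma dual_pair_contraction : dual_pair (con_rank r) (contraction e C) (deletion e D).
Proof.
have rF := dp_rank CD; split.
- exact: con_rank_fun.
- exact: hsupps_contraction (dp_circuits CD).
- by rewrite dual_con_rank //; apply: hsupps_deletion (dp_cocircuits CD); apply: dual_rank_fun.
- move=> Z a; apply: (contraction_scale (sc := @lscale H)); [exact: restr_lscale| |exact: dp_lscale CD].
  by move=> I b X; apply: hsupp_lscale.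
- move=> Z a; apply: (deletion_scale (sc := @rscale H)); [exact: restr_rscale|exact: rscale0|exact: dp_rscale CD].
- move=> Z Z'; apply: (contraction_sub (dp_circuits CD) (sc := @lscale H)); [exact: restr_lscale|exact: dp_lsub CD].
- move=> Z Z'; apply: (deletion_sub (sc := @rscale H)); [exact: restr_rscale|exact: dp_rsub CD].
- by move=> Z W CZ DW _; apply: contraction_deletion_orth.
Qed.

End MinorPairs.

(** * Vectors and circuits *)

Section Fundamental.
Variables (H : skewHyperfieldType) (E : finType) (r : {set E} -> nat).
Variables (C D : set {ffun E -> H}) (CD : dual_pair r C D).
Implicit Types (X Y Z : {ffun E -> H}) (A B S : {set E}) (g h i : E) (w : H).

Let rF := dp_rank CD.
Let Cr := dp_circuits CD.

Lemma fundamental_cocircuit B h : r B = #|B| -> h \in B ->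
  exists Y, [/\ D Y, Y h = hone & forall i, i \in B -> i <> h -> Y i = hzero].
Proof.
move=> rB hB; have [T [BT _ rT rTE]] := indep_extend rF rB (subsetT B).
have hT := subsetP BT h hB.
have [|K cK KT] := cocircuit_avoiding rF (A := T :\ h).
  have := rank_le_card rF (T :\ h); have := cardsD1 h T.
  by rewrite hT; move: rT rTE; clear; lia.
have [Z DZ ZK] := dp_cocircuit_ex CD cK.
have Z0 i : i \in T -> i <> h -> Z i = hzero.
  move=> iT ih; apply/hsuppPn; rewrite ZK; apply/negP => iK.
  by move/pred0P: KT => /(_ i) /=; rewrite in_setD1 iT iK (introN eqP ih).
have Zh : Z h <> hzero.
  apply/hsuppP; rewrite ZK; apply: contraT => hK.
  have [lt _] := (cocircuitP rF K).1 cK.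
  have : T \subset ~: K.
    rewrite -(setD1K hT) subUset sub1set in_setC hK -disjoints_subset disjoint_sym.
    by [].
  by move=> /(rank_mono rF); rewrite rTE leqNgt lt.
exists (rscale (hinv (Z h)) Z); split.
- by apply: dp_rscale CD _ _ DZ _; apply: hinv_neq0.
- by rewrite rscaleE hmulVr.
- by move=> i iB ih; rewrite rscaleE Z0 ?hmul0l //; apply: (subsetP BT).
Qed.

Lemma fundamental_circuit B g w : g \notin B -> r (g |: B) = r B -> w <> hzero ->
  exists X, [/\ C X, X g = w & hsupp X \subset g |: B].
Proof.
move=> gB rgB w0; have [X [CX Xg XB]] := circuit_vector_through rF Cr gB rgB.
have a0 : hmul w (hinv (X g)) <> hzero by apply: hmul_neq0 => //; apply: hinv_neq0.
exists (lscale (hmul w (hinv (X g))) X); split.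
- exact: dp_lscale CD _ _ CX a0.
- by rewrite lscaleE hmulVKr.
- by rewrite hsupp_lscale.
Qed.

End Fundamental.

(** * Decomposition of vectors when 1 is not in 1 - 1 *)

Section FieldLike.
Variables (H : skewHyperfieldType) (HS : stringent H) (E : finType) (r : {set E} -> nat).
Variables (C D : set {ffun E -> H}) (CD : dual_pair r C D).
Hypothesis nb1 : ~ ball hone (hone : H).
Implicit Types (X Y Z y : {ffun E -> H}) (A B S : {set E}) (g h i f : E).

Lemma ball_irr (x : H) : x <> hzero -> ~ ball x x.
Proof. by move=> x0 xx; apply: nb1; apply: (@ball_mullI _ x) => //; rewrite hmul1r. Qed.

Let rF := dp_rank CD.
Let Cr := dp_circuits CD.
Let kor := dp_orth CD.

Variable W : {ffun E -> H}.

(* [~ ball x w] reads |x| <= |w|, so the condition says that [W] restricted to [S] is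
   dominated by its values on the basis [B]. *)
Definition opt_basis B S := [/\ B \subset S, r B = #|B|, r B = r S &
  forall X g, C X -> g \in S -> g \notin B -> hsupp X \subset g |: B -> X g = W g ->
  forall h, h \in B -> ~ ball (X h) (W h)].

Lemma not_ball0 (w : H) : w <> hzero -> ~ ball hzero w.
Proof. by move=> w0 /ball_zero. Qed.

Lemma bounded_quotient (p s q : H) : s <> hzero ->
  ~ ball q s -> ~ ball p hone -> ~ ball (hmul (hmul p (hinv s)) q) hone.
Proof.
move=> s0 qs p1; have [->|p0] := pselect (p = hzero).
  by rewrite !hmul0l; apply: not_ball0; exact: hone_neq0.
rewrite -hmulA => psq; have pi0 := hinv_neq0 p0.
have b1 : ball (hmul (hinv s) q) (hinv p).
  by apply: (@ball_mullI _ p) => //; rewrite hmulVr.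
have nb : ~ ball (hmul (hinv s) q) hone.
  by move=> b; apply: qs; have := ball_mull s b; rewrite hmulVKl // hmul1r.
have := ball_notin_trans HS b1 nb.
by move=> /(ball_mull p); rewrite hmul1r hmulVr.
Qed.

(** Induction on [S] by pivoting. With [g0] removed there is an optimal [B]; if the fundamental
    circuit of [g0] exceeds [W] somewhere on [B], then [g0] replaces the element where the excess
    factor is greatest. *)
Lemma opt_basis_ex S : (forall i, i \in S -> W i <> hzero) -> exists B, opt_basis B S.
Proof.
have [n] := ubnP #|S|; elim: n S => // n IH S nS WS.
have [->|[g0 g0S]] := set_0Vmem S.
  exists set0; split=> // [|X g _]; last by rewrite inE.
  by have := rank_le_card rF set0; rewrite cards0; clear; lia.
pose S' := S :\ g0; have [||B [BS' rB rBS' opt]] := IH S'.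
- by have := cardsD1 g0 S; rewrite g0S; move: nS; rewrite /S'; clear; lia.
- by move=> i /setD1P[_ /WS].
have SE : S = g0 |: S' by rewrite setD1K.
have BS : B \subset S by apply: subset_trans BS' (subD1set _ _).
have g0B : g0 \notin B by apply/negP => /(subsetP BS'); rewrite in_setD1 eqxx.
have W0 i : i \in B -> W i <> hzero by move=> /(subsetP BS) /WS.
have inS' g : g \in S -> g <> g0 -> g \in S' by move=> gS /eqP gg; rewrite in_setD1 gg.
have rgB g : g \in S' -> r (g |: B) = r B.
  move=> gS'; apply/eqP; rewrite eqn_leq (rank_mono rF (subsetUr [set g] B)) andbT rBS'.
  by apply: rank_mono => //; rewrite subUset sub1set gS'.
have CirB g : g \in S' -> g \notin B -> exists X, [/\ C X, X g = W g & hsupp X \subset g |: B].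
  move=> gS' gB; apply: (fundamental_circuit CD gB (rgB g gS') _).
  by apply: WS; move: gS' => /setD1P[].
(* If [g0] is independent of [B] it joins the basis, and the fundamental circuits of the other
   elements vanish at it. *)
have [rg0|rg0] := pselect (r (g0 |: B) = r B); last first.
  have rg0' : r (g0 |: B) = #|g0 |: B|.
    rewrite cardsU1 g0B; have := rankU1 rF g0 B; have := rank_mono rF (subsetUr [set g0] B).
    by move: rg0 rB; clear; lia.
  exists (g0 |: B); split=> //.
  - by rewrite subUset sub1set g0S.
  - apply/eqP; rewrite eqn_leq rank_mono ?subUset ?sub1set ?g0S //= SE.
    have := rankU1 rF g0 S'; rewrite -rBS' => le; apply: leq_trans le _.
    by rewrite rg0' cardsU1 g0B rB.
  - move=> X g CX gS; rewrite in_setU1 negb_or => /andP[/eqP gg0 gB] XB Xg h hB.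
    have gS' := inS' g gS gg0.
    have [Z [CZ Zg ZB]] := CirB g gS' gB.
    have XZ : hsupp X = hsupp Z.
      apply: (same_supp rF Cr CX CZ XB); first by apply: subset_trans ZB (setUS _ (subsetUr _ _)).
      have := rank_mono rF (subsetUr [set g] (g0 |: B)); have := card_setU1_le g (g0 |: B).
      by rewrite rg0'; clear; lia.
    case/setU1P: hB => [->|hB]; last by apply: (opt X g) => //; rewrite XZ.
    have -> : X g0 = hzero; last exact/not_ball0/WS.
    apply/hsuppPn; rewrite XZ; apply/negP => /(subsetP ZB) /setU1P[/esym //|].
    by move=> h0; rewrite h0 in g0B.
have rS : r B = r S.
  rewrite SE rBS'; apply/esym; apply: (rank_closure rF (A := B)) => //.
have [X0 [CX0 X0g X0B]] := fundamental_circuit CD g0B rg0 (WS _ g0S).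
have uniq0 X : C X -> hsupp X \subset g0 |: B -> exists2 c, c <> hzero & X = lscale c X0.
  move=> CX XB; apply: (dp_lsub CD CX0 CX); rewrite (same_supp rF Cr CX0 CX X0B XB) //.
  by rewrite rg0 rB card_setU1_le.
have [bad|good] := pselect (exists h, h \in B /\ ball (X0 h) (W h)); last first.
  exists B; split=> // X g CX gS gB XB Xg h hB.
  have [gg0|gg0] := pselect (g = g0); last by apply: (opt X g) => //; apply: inS'.
  subst g; have [c c0 Xc] := uniq0 X CX XB.
  have c1 : c = hone.
    apply: (@hmulr_inj _ (W g0)); first exact: WS.
    by rewrite hmul1l -{1}X0g -Xg Xc lscaleE.
  by rewrite Xc c1 lscaleE hmul1l => Xh; apply: good; exists h.
(* The factor by which [X0] exceeds [W] at [h]. Quotients are taken on the right so that the left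
   scaling of circuits multiplies them. *)
pose q h := hmul (X0 h) (hinv (W h)).
have qW h : W h <> hzero -> hmul (q h) (W h) = X0 h by move=> Wh; rewrite /q hmulVKr.
have [|||h0 [h0B X0h0] max] := @ex_maximal _ (fun h => h \in B /\ ball (X0 h) (W h))
    (fun i j => q i <> hzero /\ ball (q j) (q i)).
- by move=> i [qi]; apply: ball_irr.
- by move=> i j k [qi ji] [qj kj]; split=> //; exact: (ball_trans HS ji kj).
- exact: bad.
have Wh0 := W0 _ h0B.
have qh1 : ball (q h0) hone.
  by apply: (@ball_mulrI _ (W h0)) => //; rewrite qW // hmul1l.
have qh0 : q h0 <> hzero by move=> q0; move: qh1; rewrite q0 => /ball_zero; apply: hone_neq0.
have q_le h : h \in g0 |: B -> ~ ball (q h) (q h0).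
  move=> /setU1P[->|hB].
    have -> : q g0 = hone by rewrite /q X0g hmulVr //; apply: WS.
    by move=> b; apply: nb1; exact: (ball_trans HS qh1 b).
  have [Xh|Xh] := pselect (ball (X0 h) (W h)).
    by move=> b; apply: (max h).
  move=> b; apply: Xh; have := ball_mulr (W h) (ball_trans HS qh1 b).
  by rewrite hmul1l qW //; apply: W0.
have X0h0' : X0 h0 <> hzero by rewrite -(qW h0) //; apply: hmul_neq0.
pose B' := g0 |: (B :\ h0).
have g0h0 : g0 <> h0 by move=> gh; rewrite gh h0B in g0B.
have cB' : #|B'| = #|B|.
  by rewrite /B' cardsU1 in_setD1 (negPf g0B) andbF (cardsD1 h0 B) h0B.
have B'B : B' \subset g0 |: B by apply: setUS; apply: subD1set.
have h0B' : h0 \notin B'.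
  by rewrite in_setU1 in_setD1 eqxx orbF; apply/eqP/nesym.
have rB' : r B' = #|B'|.
  apply/eqP; rewrite eqn_leq rank_le_card //= leqNgt; apply/negP => dB'.
  have [U cU UB'] := dep_circuit rF dB'; have [Z CZ ZU] := dp_circuit_ex CD cU.
  have [|c c0 Zc] := uniq0 Z CZ; first by rewrite ZU; apply: subset_trans UB' B'B.
  case/negP: h0B'; apply: (subsetP UB'); rewrite -ZU Zc hsupp_lscale //.
  exact/hsuppP.
have bnd (a : H) h : h \in g0 |: B -> W h <> hzero ->
    ball (hmul a (X0 h)) (W h) -> ball (hmul a (q h)) hone.
  move=> hB Wh b; apply: (@ball_mulrI _ (W h)) => //.
  by rewrite hmul1l -hmulA qW.
have WB' h : h \in B' -> W h <> hzero.
  by move=> /(subsetP B'B) /setU1P[->|/W0 //]; apply: WS.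
exists B'; split=> //.
- by rewrite subUset sub1set g0S; apply: subset_trans (subD1set _ _) BS.
- by rewrite rB' cB' -rB.
move=> X g CX gS gB' XB' Xg h hB'.
have hB := subsetP B'B h hB'.
have [gh0|gh0] := pselect (g = h0).
  subst g; have [|c c0 Xc] := uniq0 X CX.
    by apply: subset_trans XB' _; rewrite subUset sub1set in_setU1 h0B orbT.
  have ci : hmul c (q h0) = hone by rewrite /q hmulA -lscaleE -Xc Xg hmulVr.
  rewrite Xc lscaleE => /(bnd c h hB (WB' h hB')) b; apply: (q_le h hB).
  by apply: (@ball_mullI _ c) => //; rewrite ci.
have gg0 : g <> g0 by move=> gg; rewrite gg in_setU1 eqxx in gB'.
have gB : g \notin B.
  by apply: contra gB' => gB; rewrite in_setU1 in_setD1 gB (introN eqP gh0) orbT.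
have gS' := inS' g gS gg0.
have [X2 [CX2 X2g X2B]] := CirB g gS' gB.
pose a := hmul (X g0) (hinv (W g0)).
have Wg0 := WS _ g0S.
have Xs i : X i <> hzero -> [\/ i = g, i = g0 | i \in B :\ h0].
  move=> /hsuppP /(subsetP XB') /setU1P[->|/setU1P[->|iB]]; [by constructor 1|by constructor 2|by constructor 3].
(* On [B] the new fundamental circuit is a value of X2 + a X0: the fundamental cocircuit of h' meets
   [X] in at most h', [g0] and [g], so 3-orthogonality gives the relation entry by entry. *)
have rel h' : h' \in B -> hadd (X2 h') (hmul a (X0 h')) (X h').
  move=> h'B; have [Y [DY Yh Y0]] := fundamental_cocircuit CD rB h'B.
  have h'g0 : h' <> g0 by move=> hg; rewrite -hg h'B in g0B.
  have h'g : h' <> g by move=> hg; rewrite -hg h'B in gB.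
  have o0 := @korthogonal2 _ _ _ _ kor X0 Y h' g0 CX0 DY h'g0.
  have {}o0 : hmul (X0 g0) (Y g0) = hopp (hmul (X0 h') (Y h')).
    apply: o0 => i /hsuppP /(subsetP X0B) /setU1P[->|iB] Yi; first by right.
    by left; apply: contrapT => ih; apply: Yi; apply: Y0.
  have o2 : hmul (X2 g) (Y g) = hopp (hmul (X2 h') (Y h')).
    apply: (korthogonal2 kor CX2 DY h'g) => i /hsuppP /(subsetP X2B) /setU1P[->|iB] Yi; first by right.
    by left; apply: contrapT => ih; apply: Yi; apply: Y0.
  have := @korthogonal3 _ _ _ _ kor X Y h' g0 g CX DY h'g0 h'g (nesym gg0).
  have XY i : X i <> hzero -> Y i <> hzero -> [\/ i = h', i = g0 | i = g].
    move=> /Xs[->|->|/setD1P[_ iB]] Yi; [by constructor 3|by constructor 2|constructor 1].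
    by apply: contrapT => ih; apply: Yi; apply: Y0.
  move=> /(_ XY); rewrite Xg -X2g o2 hoppK Yh !hmul1r.
  have -> : hmul (X g0) (Y g0) = hopp (hmul a (X0 h')).
    by rewrite -hmulrN -[X0 h']hmul1r -Yh -o0 X0g /a -hmulA hmulKl.
  by move=> /hadd_revl; rewrite hoppK.
have Xh0 : X h0 = hzero.
  by apply/hsuppPn; apply/negP => /(subsetP XB') /setU1P[/esym //|]; apply/negP.
(* [X] vanishes at the pivot [h0], which determines [a]. Boundedness of [X2] at [h0] and maximality
   of [q h0] then bound [a X0] by [W]. *)
have aE : a = hmul (hopp (hmul (X2 h0) (hinv (W h0)))) (hinv (q h0)).
  apply: (@hmulr_inj _ (q h0)) => //; rewrite hmulVKr // /q hmulA -hmulNl; congr hmul.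
  by have := rel h0 h0B; rewrite Xh0 => /hadd_oppP.
have X2h0 : ~ ball (hopp (hmul (X2 h0) (hinv (W h0)))) hone.
  rewrite ball_oppc => b; apply: (opt X2 g CX2 gS' gB X2B X2g h0 h0B).
  by have := ball_mulr (W h0) b; rewrite hmulVKr // hmul1l.
have na h' : h' \in g0 |: B -> W h' <> hzero -> ~ ball (hmul a (X0 h')) (W h').
  move=> h'B Wh' /(bnd a h' h'B Wh'); rewrite aE.
  exact: (bounded_quotient qh0 (q_le h' h'B) X2h0).
case/setU1P: hB' => [->|/setD1P[_ hB'']].
  have -> : X g0 = hmul a (X0 g0) by rewrite X0g /a hmulVKr.
  by apply: na => //; rewrite setU11.
apply: (notin_ball_hadd HS _ _ (rel h hB'')); last by apply: na => //; apply: W0.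
exact: (opt X2 g).
Qed.

Hypothesis WD : forall Y, D Y -> orthogonal W Y.

(** The circuits are the fundamental ones of an optimal basis, scaled to agree with [W] at their
    element off the basis. At a basis element, orthogonality to the fundamental cocircuit puts the
    value of [W] into the sum, and optimality makes the sum a singleton. *)
Lemma circuit_decomposition : exists (P : {set E}) (X : E -> {ffun E -> H}),
  (forall g, g \in P -> C (X g)) /\
  forall f, (\big[@hsetadd H/[set hzero]]_(g in P) [set X g f] = [set W f])%classic.
Proof.
have [|B [BS rB rBS opt]] := @opt_basis_ex (hsupp W); first by move=> i /hsuppP.
set S := hsupp W in BS rBS opt; pose P := S :\: B.
have ex g : exists X, g \in P -> [/\ C X, X g = W g & hsupp X \subset g |: B].
  have [/setDP[gS gB]|] := boolP (g \in P); last by exists W.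
  have [|X XP] := fundamental_circuit CD gB _ (hsuppP _ _ gS); last by exists X.
  apply/eqP; rewrite eqn_leq (rank_mono rF (subsetUr [set g] B)) andbT rBS.
  by apply: rank_mono => //; rewrite subUset sub1set gS.
have [X XP] := choice ex; exists P, X; split=> [g /XP[]//|f].
have X0 g : g \in P -> f <> g -> f \notin B -> X g f = hzero.
  move=> /XP[_ _ XB] fg fB; apply/hsuppPn/negP => /(subsetP XB) /setU1P[//|].
  exact/negP.
have [fB|fB] := boolP (f \in B); last first.
  have [fS|fS] := boolP (f \in S); last first.
    rewrite big1 => [|g gP]; first by rewrite (hsuppPn _ _ fS).
    by rewrite X0 // => fg; move: gP; rewrite -fg in_setD (negPf fS) andbF.
  have fP : f \in P by rewrite in_setD fB.
  rewrite (bigD1 f) //= big1 => [|g /andP[gP /eqP gf]]; last by rewrite X0 //; exact/nesym.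
  have [_ -> _] := XP f fP.
  by rewrite hsetadd1 hadd0.
have Wf : W f <> hzero by apply/hsuppP; apply: (subsetP BS).
pose A : set H := [set x | ~ ball x (W f)]%classic.
have [Y [DY Yf Y0]] := fundamental_cocircuit CD rB fB.
have inSum : (\big[@hsetadd H/[set hzero]]_(g in P) [set X g f])%classic (W f).
  have := WD DY; rewrite /orthogonal -/(hdot _ _) (@hdot_on _ _ (f |: P)); last first.
    move=> i /hsuppP iS Yi; rewrite in_setU1 in_setD iS andbT.
    have [iB|//] := boolP (i \in B); rewrite ?orbT //.
    by apply/orP; left; apply/eqP; apply: contrapT => fi; apply: Yi; apply: Y0.
  rewrite big_setU1 /=; last by rewrite in_setD fB.
  move=> /hsetadd_0P[_ ->]; rewrite Yf hmul1r.
  have E1 : (\big[@hsetadd H/[set hzero]]_(g in P) [set hmul (W g) (Y g)] =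
      \big[@hsetadd H/[set hzero]]_(g in P) (hmul (hopp hone) @` [set X g f]))%classic.
    apply: eq_bigr => g gP; rewrite image_set1 hmulN1; congr classical_sets.set1.
    have [CX <- XB] := XP g gP.
    have fg : f <> g by move=> fg; move: gP; rewrite -fg in_setD fB.
    rewrite (korthogonal2 kor CX DY fg); first by rewrite Yf hmul1r.
    move=> i /hsuppP /(subsetP XB) /setU1P[->|iB] Yi; first by right.
    by left; apply: contrapT => fi; apply: Yi; apply: Y0.
  by rewrite E1 -hsum_mull => -[x Sx]; rewrite hmulN1 => /hopp_inj <-.
(* All terms are at most |W f|. If the sum were a ball, its radius would be at most |W f| as well,
   and a ball is strict here, so it could not contain [W f]. *)
have [||||[s Ss]|[a Aa Sa]] := @hsum_shape _ HS _ (fun g => g \in P) (fun g => X g f) A.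
- exact: not_ball0.
- by move=> x; rewrite /A /= ball_oppc.
- by move=> x y z; rewrite /A /=; apply: notin_ball_hadd.
- by move=> g gP; have [CX Xg XB] := XP g gP; move/setDP: gP => [gS gB]; apply: (opt _ g).
- by move: inSum; rewrite Ss => ->.
- by move: inSum; rewrite Sa => /Aa.
Qed.

(** Single-valued coordinates make W.u equal to the sum of the sets X_g.u, by distributivity over a
    sum and exchange of summations. Adding common elements, one for each g, then yields common
    elements of W.y and W.y'. *)
Lemma meet_field y y' : (forall X, C X -> hdot X y `&` hdot X y' !=set0)%classic ->
  (hdot W y `&` hdot W y' !=set0)%classic.
Proof.
move=> meet; have [P [X [CX sumX]]] := circuit_decomposition.
have ex g : exists z, g \in P -> (hdot (X g) y `&` hdot (X g) y')%classic z.
  have [gP|] := boolP (g \in P); last by exists hzero.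
  by have [z] := meet _ (CX g gP); exists z.
have [z zP] := choice ex.
have sum u : (forall g, g \in P -> hdot (X g) u (z g)) ->
    (\big[@hsetadd H/[set hzero]]_(g in P) [set z g] `<=` hdot W u)%classic.
  move=> zu; have -> : hdot W u = (\big[@hsetadd H/[set hzero]]_(g in P) hdot (X g) u)%classic.
    rewrite /hdot exchange_big /=; apply: eq_bigr => f _.
    rewrite -(image_set1 (fun x => hmul x (u f))) -sumX hsum_mulr.
    by apply: eq_bigr => g _; rewrite image_set1.
  by apply: hsumS => g gP _ ->; apply: zu.
have [s Ss] : (\big[@hsetadd H/[set hzero]]_(g in P) [set z g] !=set0)%classic.
  by apply: hsum_nonempty => g _; exists (z g).
by exists s; split; apply: sum Ss => g /zP[].
Qed.

End FieldLike.

(** * Conformal circuits when 1 lies in 1 - 1 *)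

Section IdempotentSums.
Variables (H : skewHyperfieldType) (HS : stringent H).
Hypothesis b1 : ball hone (hone : H).
Variables (I : finType) (P : pred I) (b : I -> H) (g : I).
Hypotheses (Pg : P g) (bg0 : b g <> hzero) (max : forall i, P i -> ball (b g) (b i)).

Lemma hsum_single : (forall i, P i -> i <> g -> b i <> hopp (b g)) ->
  (\big[@hsetadd H/[set hzero]]_(i | P i) [set b i] = [set b g])%classic.
Proof.
move=> nopp; rewrite (bigD1 g) //=; set S := (X in hsetadd _ X).
have SD : (S `<=` dominated (b g))%classic.
  apply: hsum_dominated => // i /andP[Pi /eqP ig]; split; [exact: max | exact: nopp].
have [s Ss] : (S !=set0)%classic by apply: hsum_nonempty => i _; exists (b i).
have abs x : S x -> hadd (b g) x = [set b g]%classic.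
  by move=> /SD[bx xb]; apply: ball_absorb.
apply/seteqP; split=> z; first by move=> /hsetaddP[_ [x [-> /abs ->]]].
by move=> ->; apply/hsetaddP; exists (b g), s; rewrite abs.
Qed.

End IdempotentSums.

Section Idempotent.
Variables (H : skewHyperfieldType) (HS : stringent H) (E : finType) (r : {set E} -> nat).
Variables (C D : set {ffun E -> H}) (CD : dual_pair r C D).
Hypothesis ortho : forall X Y, C X -> D Y -> orthogonal X Y.
Hypothesis b1 : ball hone (hone : H).
Implicit Types (X Y Z y : {ffun E -> H}) (A B R S : {set E}) (g h i f e : E) (p q t w : H).

Let rF := dp_rank CD.
Let Cr := dp_circuits CD.

(* [p] is at most 1 in absolute value, and not of sign opposite to 1. *)
Definition conformal p := ball hone p /\ (p = hopp hone -> p = hone).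

(** The purpose of conformality: a conformal factor creates no cancellation of a leading term [t]
    that was not there before. *)
Lemma conformal_mul_neq p t c : t <> hzero -> conformal p -> ball t c -> c <> hopp t ->
  hmul p c <> hopp t.
Proof.
move=> t0 [p1 pN] tc ct pc.
have c_pc : ball c (hmul p c) by have := ball_mulr c p1; rewrite hmul1l.
have ct' : ball c t by rewrite pc in c_pc; rewrite -[t]hoppK; apply: ball_opp.
case: (ball_anti HS ct' tc) => // ctE; subst c.
have pE : p = hopp hone by apply: (@hmulr_inj _ t) => //; rewrite hmulN1.
by rewrite pN // hmul1l in pc.
Qed.

Variable W : {ffun E -> H}.

(* A weighted form of the 3-painting lemma for oriented matroids, proved in the same
   way: an element [f] of [R] is moved to the two other colours in turn, and the circuit
   and the cocircuit that are wrong only at [f] cannot both exist, as they are orthogonal. *)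
Lemma painting R B e : e \in R -> [disjoint R & B] -> (forall i, i \in R -> W i <> hzero) ->
  (exists X, [/\ C X, X e = W e, hsupp X \subset R :|: B &
     forall f, f \in R -> conformal (hmul (X f) (hinv (W f)))]) \/
  (exists Y, [/\ D Y, Y e = hinv (W e), forall i, i \in B -> Y i = hzero &
     forall f, f \in R -> f <> e -> dominated hone (hmul (W f) (Y f))]).
Proof.
have [n] := ubnP #|R|; elim: n R B => // n IH R B nR eR RB WR.
have We := WR e eR; have Wi0 := hinv_neq0 We.
have eB : e \notin B by move/pred0P: RB => /(_ e) /=; rewrite eR /= => ->.
(* With [e] alone in [R], the alternative is whether [B] spans [e]: a circuit in e |: B if it does,
   a cocircuit through [e] that vanishes on [B] if not. *)
have [R1|[f /setD1P[/eqP fe fR]]] := set_0Vmem (R :\ e).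
  have {}R1 f : f \in R -> f = e.
    by move=> fR; apply/eqP; apply: contraT => fe; have := in_set0 f; rewrite -R1 in_setD1 fe fR.
  have [reB|reB] := pselect (r (e |: B) = r B).
    have [X [CX Xe XB]] := circuit_vector_through rF Cr eB reB.
    have a0 : hmul (W e) (hinv (X e)) <> hzero by apply: hmul_neq0 => //; apply: hinv_neq0.
    left; exists (lscale (hmul (W e) (hinv (X e))) X); split.
    - exact: dp_lscale CD _ _ CX a0.
    - by rewrite lscaleE hmulVKr.
    - rewrite hsupp_lscale //; apply: subset_trans XB _.
      by apply: setSU; rewrite sub1set.
    - by move=> f /R1 ->; rewrite lscaleE hmulVKr // hmulVr //; split.
  have [||I [_ IB rI rIB]] := @indep_extend _ r rF set0 B.
  - by have := rank_le_card rF set0; rewrite cards0; clear; lia.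
  - exact: sub0set.
  have eI : e \notin I by apply: contra eB; apply: (subsetP IB).
  have reI : r (e |: I) = #|e |: I|.
    have : r (e |: I) <> r I.
      by move=> reI; apply: reB; apply: (rank_closure rF reI IB).
    have := rank_mono rF (subsetUr [set e] I); have := rankU1 rF e I.
    by rewrite cardsU1 eI; move: rI; clear; lia.
  have [Y [DY Ye Y0]] := fundamental_cocircuit CD reI (setU11 e I).
  right; exists (rscale (hinv (W e)) Y); split.
  - by apply: dp_rscale CD _ _ DY _.
  - by rewrite rscaleE Ye hmul1l.
  - move=> i iB; suff Yi : Y i = hzero by rewrite rscaleE Yi hmul0l.
    apply/hsuppPn/negP => iY.
    have IY : I \subset ~: hsupp Y.
      apply/subsetP => j jI; rewrite in_setC; apply/hsuppPn; apply: Y0.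
        by rewrite in_setU1 jI orbT.
      by move=> je; rewrite -je jI in eI.
    have := rank_cocircuit rF (dp_cocircuit CD DY) IY iY.
    have : r (i |: I) <= r B by apply: rank_mono => //; rewrite subUset sub1set iB.
    by move: rIB; clear; lia.
  - by move=> f /R1.
have Wf := WR f fR.
have eR' : e \in R :\ f by rewrite in_setD1 eR andbT; apply/eqP/nesym.
have R'R : R :\ f \subset R := subD1set _ _.
have nR' : #|R :\ f| < n by have := cardsD1 f R; rewrite fR; move: nR; clear; lia.
have WR' i : i \in R :\ f -> W i <> hzero by move=> /(subsetP R'R); apply: WR.
have inR' i : i \in R -> i <> f -> i \in R :\ f.
  by move=> iR /eqP iF; rewrite in_setD1 iF.
(* [f] leaves [R] without joining [B]: circuits vanish at [f], which is conformal, while cocircuits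
   are unrestricted there. *)
case: (IH _ B nR' eR' _ WR'); first exact: disjointWl R'R RB.
  move=> [X [CX Xe XB Xc]]; left; exists X; split=> //.
    by apply: subset_trans XB _; apply: setSU.
  move=> i iR; have [->|/(inR' i iR)] := pselect (i = f); last exact: Xc.
  have -> : X f = hzero.
    apply/hsuppPn/negP => /(subsetP XB); rewrite in_setU in_setD1 eqxx /= => fB.
    by move/pred0P: RB => /(_ f) /=; rewrite fR fB.
  rewrite hmul0l; split; first exact: ball0.
  by move=> /esym h; case: (hopp_neq0 (@hone_neq0 H)).
move=> [Y [DY Ye YB Yd]].
have RB' : [disjoint R :\ f & f |: B].
  apply/pred0P => i /=; rewrite in_setD1 in_setU1; case: eqP => //= _.
  by move/pred0P: RB => /(_ i).
(* [f] joins [B]: cocircuits vanish at [f], which is dominated, while circuits are unrestricted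
   there. *)
case: (IH _ (f |: B) nR' eR' RB' WR'); last first.
  move=> [Z [DZ Ze ZB Zd]]; right; exists Z; split=> // i iX.
    by apply: ZB; rewrite in_setU1 iX orbT.
  move=> ie; have [->|/(inR' i iX)] := pselect (i = f); last by move=> ?; apply: Zd.
  by rewrite ZB ?setU11 // hmul0r; apply: dominated0; apply: hone_neq0.
move=> [X [CX Xe XB Xc]].
have XRB : hsupp X \subset R :|: B.
  apply: subset_trans XB _; rewrite setUA; apply: setSU.
  by rewrite subUset R'R sub1set fR.
pose u := hmul (X f) (hinv (W f)); pose v := hmul (W f) (Y f).
have [uc|nuc] := pselect (conformal u).
  left; exists X; split=> // i iR.
  by have [->//|/(inR' i iR)] := pselect (i = f); apply: Xc.
have [vd|nvd] := pselect (dominated hone v).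
  right; exists Y; split=> // i iR ie.
  by have [->//|/(inR' i iR) iR'] := pselect (i = f); apply: Yd.
(* Off [e] and [f], every term of X.Y is dominated by the term 1 at [e]. So the larger of the terms
   at [e] and [f] is cancelled by nothing, against orthogonality. *)
exfalso; pose t i := hmul (X i) (Y i).
have te : t e = hone by rewrite /t Xe Ye hmulVr.
have tf : t f = hmul u v by rewrite /t /u /v hmulA hmulVKr.
have h10 : hone <> (hzero : H) := @hone_neq0 H.
have td i : i <> e -> i <> f -> dominated hone (t i).
  move=> ie iF; have [iR|iR] := boolP (i \in R).
    have iR' := inR' i iR iF; have [dY nY] := Yd i iR' ie; have cX := Xc i iR'.
    have -> : t i = hmul (hmul (X i) (hinv (W i))) (hmul (W i) (Y i)).
      by rewrite hmulA hmulVKr //; apply: WR.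
    split; last exact: conformal_mul_neq.
    have [cX1 _] := cX; have := ball_mul HS cX1 dY; by rewrite hmul1l.
  have [iB|iB] := boolP (i \in B); first by rewrite /t YB // hmul0r; apply: dominated0.
  have -> : t i = hzero; last exact: dominated0.
  rewrite /t; have -> : X i = hzero; last by rewrite hmul0l.
  by apply/hsuppPn/negP => /(subsetP XRB); rewrite in_setU (negPf iR) (negPf iB).
have bN : ball (hopp hone) (hone : H) by rewrite ball_oppc.
(* Failure at [f] means that |u| > 1 or u = -1, and likewise for v. Hence |uv| > 1 unless u = v =
   -1, where uv = 1; this differs from -1, as otherwise u = 1 would be conformal. *)
have [uv1|[uv1 nuv1]] : dominated hone (t f) \/ (ball (t f) hone /\ ~ ball hone (t f)).
  rewrite tf; have big (x : H) : ~ ball hone x -> ball x hone.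
    by move=> n1; case: (ball_total HS b1 hone x).
  have u1 : ball u hone.
    have [bu|/big//] := pselect (ball hone u).
    have [->|un1] := pselect (u = hopp hone); first exact: bN.
    by case: nuc; split=> // /un1.
  have v1 : ball v hone.
    have [bv|/big//] := pselect (ball hone v).
    have [->|vn1] := pselect (v = hopp hone); first exact: bN.
    by case: nvd.
  have uvu : ball (hmul u v) u by have := ball_mull u v1; rewrite hmul1r.
  have uvv : ball (hmul u v) v by have := ball_mulr v u1; rewrite hmul1l.
  have [bu|nbu] := pselect (ball hone u); last first.
    right; split; first exact: (ball_trans HS u1 uvu).
    by move=> b; apply: nbu; apply: (ball_trans HS uvu b).
  have [bv|nbv] := pselect (ball hone v); last first.
    right; split; first exact: (ball_trans HS u1 uvu).
    by move=> b; apply: nbv; apply: (ball_trans HS uvv b).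
  have uN : u = hopp hone by apply: contrapT => un; apply: nuc; split=> // /un.
  have vN : v = hopp hone by apply: contrapT => vn; apply: nvd.
  left; rewrite uN vN hmulN1 hoppK; split=> // h1N; apply: nuc.
  by split=> // _; rewrite uN.
- have [||j _ [je]] := hsum_lead HS b1 (P := xpredT) (b := t) (g := e) isT _ _ (ortho CX DY).
  + by rewrite te.
  + move=> i _; rewrite te; have [->|ie] := pselect (i = e); first by rewrite te.
    by have [->|iF] := pselect (i = f); [case: uv1 | case: (td i ie iF)].
  + rewrite te; have [->|jf] := pselect (j = f); first by case: uv1.
    by case: (td j je jf).
- have t1 i : i <> f -> ball hone (t i).
    move=> iF; have [->|ie] := pselect (i = e); first by rewrite te.
    by case: (td i ie iF).
  have [||j _ [jf tj]] := hsum_lead HS b1 (P := xpredT) (b := t) (g := f) isT _ _ (ortho CX DY).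
  + by move=> tf0; apply: nuv1; rewrite tf0; apply: ball0.
  + move=> i _; have [->|iF] := pselect (i = f); first exact: ball_refl.
    exact: (ball_trans HS (t1 i iF) uv1).
  + by apply: nuv1; rewrite -[t f]hoppK -tj; apply: ball_opp; apply: t1.
Qed.

Hypothesis WD : forall Y, D Y -> orthogonal W Y.

(** Painting with the whole support of [W] in [R] and with [B] empty. The cocircuit alternative
    fails: in W.Y the term 1 at [e] would dominate all the others and remain uncancelled. *)
Lemma conformal_circuit e : W e <> hzero -> exists X, [/\ C X, X e = W e,
  hsupp X \subset hsupp W & forall f, exists2 p, conformal p & X f = hmul p (W f)].
Proof.
move=> We; have eW : e \in hsupp W by apply/hsuppP.
case: (@painting (hsupp W) set0 e eW) => [||[X [CX Xe XW Xc]]|[Y [DY Ye _ Yd]]].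
- by rewrite -setI_eq0 setI0.
- by move=> i /hsuppP.
- rewrite setU0 in XW; exists X; split=> // f.
  have [fW|fW] := boolP (f \in hsupp W).
    exists (hmul (X f) (hinv (W f))); first exact: Xc.
    by rewrite hmulVKr //; apply/hsuppP.
  exists hone; first by split.
  rewrite hmul1l (hsuppPn _ _ fW); apply/hsuppPn; apply: contra fW; exact: (subsetP XW).
exfalso; pose t i := hmul (W i) (Y i); have h10 : hone <> (hzero : H) := @hone_neq0 H.
have te : t e = hone by rewrite /t Ye hmulVr.
have td i : i <> e -> dominated hone (t i).
  move=> ie; have [iW|iW] := boolP (i \in hsupp W); first exact: Yd.
  by rewrite /t (hsuppPn _ _ iW) hmul0l; apply: dominated0.
have [||j _ [je]] := hsum_lead HS b1 (P := xpredT) (b := t) (g := e) isT _ _ (WD DY).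
- by rewrite te.
- move=> i _; rewrite te; have [->|ie] := pselect (i = e); first by rewrite te.
  by case: (td i ie).
- by rewrite te; case: (td j je).
Qed.

Section Meet.
Hypothesis E_nonempty : exists i : E, True.

(** The two shapes of W.y, according to whether a largest term has an opposite. The case where all
    terms vanish counts as [LeadBall], with ball {0}. *)
Variant leading y : Prop :=
| LeadBall g of (forall i, ball (hmul (W g) (y g)) (hmul (W i) (y i))) &
    (ball (hmul (W g) (y g)) `<=` hdot W y)%classic
| LeadSingle g of hmul (W g) (y g) <> hzero &
    (forall i, ball (hmul (W g) (y g)) (hmul (W i) (y i))) &
    (forall i, i <> g -> hmul (W i) (y i) <> hopp (hmul (W g) (y g))) &
    hdot W y = [set hmul (W g) (y g)]%classic.

Lemma leadingP y : leading y.
Proof.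
pose t i := hmul (W i) (y i).
have [g _ max] := ex_max_ball HS b1 (P := xpredT) t (let: ex_intro i _ := E_nonempty in ex_intro _ i isT).
have {}max i : ball (t g) (t i) by apply: max.
have [g0|g0] := pselect (t g = hzero).
  apply: (LeadBall max); rewrite -/(t g) g0 => _ /ball_zero ->.
  rewrite /hdot big1 // => i _; congr classical_sets.set1.
  by have := max i; rewrite g0 => /ball_zero.
have [[j [jg tj]]|none] := pselect (exists j, j <> g /\ t j = hopp (t g)).
  apply: (LeadBall max).
  exact: (@hsum_ball H HS E xpredT t g j isT isT jg tj (fun i _ => max i)).
have nopp i : i <> g -> t i <> hopp (t g) by move=> ig ti; apply: none; exists i.
apply: (LeadSingle g0 max nopp).
exact: (@hsum_single H HS b1 E xpredT t g isT g0 (fun i _ => max i) (fun i _ => @nopp i)).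
Qed.

Lemma hdot_conformal X y t : (forall f, exists2 p, conformal p & X f = hmul p (W f)) ->
  (forall i, ball t (hmul (W i) (y i))) -> (hdot X y `<=` ball t)%classic.
Proof.
move=> Xc max; apply: hsum_sub; first exact: ball0.
  by move=> a b c; apply: ball_hadd.
move=> i _ _ ->; have [p [p1 _] ->] := Xc i; rewrite -hmulA.
apply: (ball_trans HS _ (max i)).
by have := ball_mulr (hmul (W i) (y i)) p1; rewrite hmul1l.
Qed.

(* The circuit through the leading element of [y] transports its leading term to [y']. *)
Lemma leading_le y y' g : (forall X, C X -> hdot X y `&` hdot X y' !=set0)%classic ->
  hmul (W g) (y g) <> hzero ->
  (forall i, ball (hmul (W g) (y g)) (hmul (W i) (y i))) ->
  (forall i, i <> g -> hmul (W i) (y i) <> hopp (hmul (W g) (y g))) ->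
  exists X, [/\ C X, forall f, exists2 p, conformal p & X f = hmul p (W f) &
     hdot X y' (hmul (W g) (y g))].
Proof.
move=> meet g0 max nopp; have Wg : W g <> hzero by move=> Wg; apply: g0; rewrite Wg hmul0l.
have [X [CX Xg _ Xc]] := conformal_circuit Wg; exists X; split=> //.
have [z [+ zy']] := meet X CX;
have XgE : hmul (X g) (y g) = hmul (W g) (y g) by rewrite Xg.
have max' i : ball (hmul (X g) (y g)) (hmul (X i) (y i)).
  have [p [p1 _] ->] := Xc i; rewrite XgE -hmulA; apply: (ball_trans HS _ (max i)).
  by have := ball_mulr (hmul (W i) (y i)) p1; rewrite hmul1l.
rewrite /hdot (@hsum_single H HS b1 E xpredT (fun i => hmul (X i) (y i)) g isT).
- by rewrite XgE => <-.
- by rewrite XgE.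
- by move=> i _; apply: max'.
- move=> i _ ig; have [p cp ->] := Xc i; rewrite XgE -hmulA.
  by apply: conformal_mul_neq => //; apply: nopp.
Qed.

(** A conformal circuit X puts the leading term t of W.y into X.y', which bounds |t| by the leading
    term t' of W.y'. If W.y' is the singleton {t'}, symmetry gives t = t' or t = -t'. The latter
    with t distinct from t' is impossible: all terms of X.y' would be dominated by t', so their sum
    would avoid -t'. *)
Lemma meet_single y y' g : (forall X, C X -> hdot X y `&` hdot X y' !=set0)%classic ->
  hmul (W g) (y g) <> hzero ->
  (forall i, ball (hmul (W g) (y g)) (hmul (W i) (y i))) ->
  (forall i, i <> g -> hmul (W i) (y i) <> hopp (hmul (W g) (y g))) ->
  hdot W y' (hmul (W g) (y g)).
Proof.
move=> meet g0 max nopp; have [X [CX Xc Xt]] := leading_le meet g0 max nopp.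
set t := hmul (W g) (y g) in g0 max nopp Xt *.
case: (leadingP y') => g' => [max' B|g0' max' nopp' ->].
  by apply/B/(hdot_conformal Xc max').
set t' := hmul (W g') (y' g') in g0' max' nopp' *.
have tt' : ball t' t by apply: (hdot_conformal Xc max').
have meet' Z : C Z -> (hdot Z y' `&` hdot Z y !=set0)%classic.
  by move=> /meet[z [zy zy']]; exists z.
have [X' [CX' Xc' Xt']] := leading_le meet' g0' max' nopp'.
have t't : ball t t' by apply: (hdot_conformal Xc' max).
case: (ball_anti HS t't tt') => // tN; apply: contrapT => ntt'.
have : dominated t' t.
  apply: (hsum_dominated HS b1 (P := xpredT) (w := t') _ _ Xt) => // i _.
  have [p cp ->] := Xc i; rewrite -hmulA; split.
    have [p1 _] := cp; apply: (ball_trans HS _ (max' i)).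
    by have := ball_mulr (hmul (W i) (y' i)) p1; rewrite hmul1l.
  apply: conformal_mul_neq => //.
  have [->|ig'] := pselect (i = g'); last exact: nopp'.
  by rewrite -/t' => t'N; apply: ntt'; rewrite tN -t'N.
by case.
Qed.

Lemma meet_idem y y' : (forall X, C X -> hdot X y `&` hdot X y' !=set0)%classic ->
  (hdot W y `&` hdot W y' !=set0)%classic.
Proof.
move=> meet; case: (leadingP y) => g => [max B|g0 max nopp Wy]; last first.
  by exists (hmul (W g) (y g)); split; [rewrite Wy | apply: meet_single nopp].
case: (leadingP y') => g' => [max' B'|g0' max' nopp' Wy'].
  by exists hzero; split; [apply/B/ball0 | apply/B'/ball0].
exists (hmul (W g') (y' g')); split; last by rewrite Wy'.
apply: meet_single nopp' => //.
by move=> Z /meet[z [zy zy']]; exists z.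
Qed.

End Meet.
End Idempotent.

Section Meet.
Variables (H : skewHyperfieldType) (HS : stringent H) (E : finType) (r : {set E} -> nat).
Variables (C D : set {ffun E -> H}) (CD : dual_pair r C D).
Hypothesis ortho : forall X Y, C X -> D Y -> orthogonal X Y.
Implicit Types (W y : {ffun E -> H}).

Lemma hdot_meet W y y' : (forall Y, D Y -> orthogonal W Y) ->
  (forall X, C X -> hdot X y `&` hdot X y' !=set0)%classic ->
  (hdot W y `&` hdot W y' !=set0)%classic.
Proof.
move=> WD meet; have [b1|nb1] := pselect (ball hone (hone : H)); last first.
  exact: (meet_field HS CD nb1 WD meet).
have [E0|nE] := pselect (exists i : E, True).
  exact: (meet_idem HS CD ortho b1 WD E0 meet).
have hdot0 u : hdot W u hzero by rewrite /hdot big1 // => i; case: nE; exists i.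
by exists hzero.
Qed.

End Meet.

(** * Extending vectors of the minors *)

Section Extension.
Variables (H : skewHyperfieldType) (E : finType) (e : E).

Definition extend (w : H) (W : {ffun {i : E | i != e} -> H}) : {ffun E -> H} :=
  [ffun i => if insub i is Some j then W j else w].

Lemma extendE w W : extend w W e = w.
Proof. by rewrite ffunE insubF ?eqxx. Qed.

Lemma restr_extend w W : restr e (extend w W) = W.
Proof. by apply/ffunP => i; rewrite restrE ffunE valK. Qed.

End Extension.

Section MinorVectors.
Variables (H : skewHyperfieldType) (HS : stringent H) (E : finType).
Variables (M : set {ffun E -> H}) (hM : left_matroid M) (e : E).

Lemma vectors_contraction : vectors (contraction e M) = restr_all e (vectors M).
Proof.
have [r [D MD]] := dual_pair_ex hM; have ortho := @dp_orthogonal _ HS _ _ _ _ MD.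
have MDc := dual_pair_contraction e MD ortho.
apply/seteqP; split=> W; last first.
  move=> [V VM <-] Y; rewrite (dp_cocircuits_eq MDc) => -[Y' [DY' Y'e] <-].
  rewrite /orthogonal -/(hdot _ _) -hdot_restr0; last by right.
  by apply: VM; rewrite (dp_cocircuits_eq MD).
move=> Wvec; have WD Y : deletion e D Y -> orthogonal W Y.
  by move=> DY; apply: Wvec; rewrite (dp_cocircuits_eq MDc).
pose T Y := hdot W (restr e Y).
have meet Y1 Y2 : D Y1 -> D Y2 -> Y1 e = hopp hone -> Y2 e = hopp hone ->
    (T Y1 `&` T Y2 !=set0)%classic.
  move=> D1 D2 e1 e2; apply: (hdot_meet HS MDc _ WD).
    exact: contraction_deletion_orth.
  (* Because Y e = -1, orthogonality of [X] and [Y] says exactly that X e lies in X.(Y \ e),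
     whichever Y is taken. *)
  move=> _ [[X MX <-] _ _]; exists (X e).
  have onY Y : D Y -> Y e = hopp hone -> hdot (restr e X) (restr e Y) (X e).
    move=> DY Ye; have := ortho X Y MX DY; rewrite /orthogonal -/(hdot _ _) (hdot_restr e).
    by move=> /hsetadd_0P[_ ->]; rewrite Ye hmulrN hmul1r hoppK.
  by split; apply: onY.
have [w wT] : exists w, forall Y, D Y -> Y e = hopp hone -> T Y w.
  have [all0|] := pselect (forall Y, D Y -> Y e = hopp hone -> T Y hzero).
    by exists hzero.
  move=> /existsNP[Y /not_implyP[DY /not_implyP[Ye nT]]].
  (* No bound on the terms is tracked, so [A] is everything. A ball would contain 0, against the
     choice of [Y]; a singleton {s} meets each other set, so [s] lies in all of them. *)
  have [||||[s Ts]|[a _ Ta]] := @hsum_shape _ HS _ xpredT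
     (fun i => hmul (W i) (restr e Y i)) classical_sets.setT => //.
    exists s => Z DZ Ze; have [z []] := meet Y Z DY DZ Ye Ze.
    by rewrite {1}/T /hdot Ts => ->.
  by case: nT; rewrite /T /hdot Ta; apply: ball0.
exists (extend w W); last exact: restr_extend.
move=> Y; rewrite (dp_cocircuits_eq MD) => DY.
have [Ye|Ye] := pselect (Y e = hzero).
  rewrite /orthogonal -/(hdot _ _) (@hdot_restr0 _ _ e) ?restr_extend; last by right.
  by apply: WD; exists Y.
have a0 : hopp (hinv (Y e)) <> hzero by apply/hopp_neq0/hinv_neq0.
pose Z := rscale (hopp (hinv (Y e))) Y.
have DZ : D Z by apply: dp_rscale MD _ _ DY a0.
have Ze : Z e = hopp hone by rewrite rscaleE hmulrN hmulVr.
have -> : Y = rscale (hopp (Y e)) Z.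
  by apply/ffunP => i; rewrite !rscaleE !hmulrN hmulNl hoppK hmulVKr.
apply: orthogonal_rscale; rewrite /orthogonal -/(hdot _ _) (hdot_restr e) restr_extend extendE.
by apply/hsetadd_0P; exists (hmul w (Z e)) => //; rewrite Ze hmulrN hmul1r hoppK; apply: wT.
Qed.

Lemma vectors_deletion : vectors (deletion e M) = restr_zero e (vectors M).
Proof.
have [r [D MD]] := dual_pair_ex hM; have ortho := @dp_orthogonal _ HS _ _ _ _ MD.
have MDd := dual_pair_deletion e MD ortho.
apply/seteqP; split=> W; last first.
  move=> [V [VM Ve] <-] Y; rewrite (dp_cocircuits_eq MDd) => -[[Y' DY' <-] _ _].
  rewrite /orthogonal -/(hdot _ _) -hdot_restr0; last by left.
  by apply: VM; rewrite (dp_cocircuits_eq MD).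
move=> Wvec; have WD Y : contraction e D Y -> orthogonal W Y.
  by move=> DY; apply: Wvec; rewrite (dp_cocircuits_eq MDd).
exists (extend hzero W); last exact: restr_extend.
split; last exact: extendE.
move=> Y; rewrite (dp_cocircuits_eq MD) => DY.
rewrite /orthogonal -/(hdot _ _) (@hdot_restr0 _ _ e) ?restr_extend; last by left; exact: extendE.
have hdot0 X : hdot X (hvec0 H {i | i != e}) = [set hzero]%classic.
  by rewrite /hdot big1 // => i _; rewrite ffunE hmul0r.
have [||z [Wz]] := hdot_meet HS MDd _ WD (y := restr e Y) (y' := hvec0 H _).
- exact: deletion_contraction_orth.
- move=> _ [X [MX Xe] <-]; exists hzero; rewrite hdot0; split=> //.
  by rewrite -hdot_restr0; [apply: ortho | left].
- by rewrite hdot0 => z0; rewrite z0 in Wz.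
Qed.

End MinorVectors.

Theorem theorem40 (H : skewHyperfieldType) (HS : stringent H) (E : finType)
    (M : set {ffun E -> H}) (hM : left_matroid M) (e : E) :
  vectors (contraction e M) = restr_all e (vectors M) /\
  vectors (deletion e M) = restr_zero e (vectors M).
Proof. by split; [apply: vectors_contraction | apply: vectors_deletion]. Qed.
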